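(* Consider a linear differential system $x^2\frac{dY}{dx}=A(x)Y$ with $A(x)\in M_n(\mathbb{C}\{x\})$, $A(0)\neq 0$, and with formal fundamental solution $\widetilde Y(x)=\widetilde F(x)\,x^L\,e^{Q(1/x)}$, where $\widetilde F(x)\in M_n(\mathbb{C}((x)))$ is invertible, $L=\bigoplus_{j=1}^J(\lambda_jI_{n_j}+J_{n_j})$ with $J_{n_j}$ the nilpotent Jordan block of size $n_j$, and $Q(1/x)=\bigoplus_{j=1}^J\frac{-a_j}{x}I_{n_j}$, with $a_1,\dots,a_J\in\mathbb{C}$ not all equal (single level equal to one). Let $\boldsymbol{\Omega}=\{a_j-a_k : 1\le j,k\le J\}$. Then (every entry of) $\widetilde F(x)$ is summable-resurgent with singular support $\boldsymbol{\Omega},0$, i.e. $\widetilde F(x)\in\widetilde{\mathcal{R}es}^{\rm sum}_{\boldsymbol{\Omega}}$.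
   Context: The $a_j$ need not be distinct, $L$ need not be diagonal, and no genericity is assumed. Borel transform: $x^m\mapsto \xi^{m-1}/\Gamma(m)$ for $m\ge1$; the finitely many terms $x^m$ with $m\le 0$ are sent to derivatives $\delta^{(-m)}$ of the Dirac distribution at $0$ and play no role in analytic properties. Let $\Omega\subset\mathbb{C}$ be a finite set containing $0$. Riemann surface $\mathcal{R}_\Omega$: its points are the homotopy classes with fixed endpoints of paths issuing from $0$ and lying in $\mathbb{C}\setminus\Omega$ except for the starting point $0$ (no path ends at $0$ except those homotopic to the constant path); its complex structure is pulled back by $[\gamma]\mapsto\gamma(1)$. Thus there is no branch point at $0$ in the first sheet. Resurgence: a resurgent function with singular support $\Omega$ is a function analytic on all of $\mathcal{R}_\Omega$. A series in powers of $x$ is resurgent with singular support $\Omega$ if its Borel transform converges near $\xi=0$ and continues analytically to $\mathcal{R}_\Omega$. $\nu$-sectorial region: for $\nu>0$ smaller than half the minimal distance between elements of $\Omega$, a $\nu$-sectorial region $\Delta_\nu\subset\mathcal{R}_\Omega$ is a domain composed of (i) an open sector $\Sigma_\nu$ with bounded opening at infinity, (ii) an open disc $D_\nu$ centered at $0$, (iii) a tubular neighborhood $\mathcal{N}_\nu$ of a piecewise-$C^1$ path connecting $D_\nu$ to $\Sigma_\nu$ after a finite number of turns around all or part of the points of $\Omega$; moreover the distance of $D_\nu$ to $\Omega\setminus\{0\}$ and the distance of $\mathcal{N}_\nu\cup\Sigma_\nu$ to $\Omega$ are greater than $\nu$. Summable-resurgence: a resurgent function with singular support $\Omega$ is summable-resurgent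 if it grows at most exponentially at infinity on every $\nu$-sectorial region of $\mathcal{R}_\Omega$. A resurgent series is summable-resurgent if its Borel transform is a summable-resurgent function; the set of these series is denoted $\widetilde{\mathcal{R}es}^{\rm sum}_{\Omega}$ (''singular support $\Omega,0$'' emphasizes the special role of $0$). A matrix belongs to it if all its entries do. *)

(* Defs.v *)
From HB Require Import structures.
From mathcomp Require Import all_boot all_order all_algebra.
From mathcomp Require Import all_classical all_reals all_analysis.
From mathcomp Require Export complex.

Set Implicit Arguments.
Unset Strict Implicit.
Unset Printing Implicit Defensive.

Import Order.TTheory GRing.Theory Num.Theory.
Import numFieldNormedType.Exports.

Local Open Scope classical_set_scope.
Local Open Scope ring_scope.
Local Open Scope complex_scope.

(* R[i] packed as an abstract-looking field, so that the topology and the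
   complex normed-module structure of MathComp-Analysis are inferred. *)
Definition Cplx (R : realType) : numClosedFieldType := R[i].

Definition modulus (R : realType) (z : Cplx R) : R :=
  ComplexField.Normc.normc (z : R[i]).

(* [pseries] of the library is restricted to a realType. *)
Definition cpseries (R : realType) (f : nat -> Cplx R) (z : Cplx R) :=
  [series f k * z ^+ k]_k.

Section FormalExpressions.
Variables (R : realType) (n : nat).
Local Notation C := (Cplx R).

(* [T a l k] is the coefficient of e^(-a/x) x^l (log x)^k. *)
Definition logexp := C -> C -> nat -> 'M[C]_n.

(* The sum has finite support in all the products used below (and is 0 by
   convention otherwise): each factor involves finitely many a and k, and
   finitely many classes of l modulo integers, bounded from below. *)
Definition lemul (S T : logexp) : logexp := fun a l k =>
  \sum_(u \in [set: C * C * 'I_k.+1])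
    (S u.1.1 u.1.2 u.2 *m T (a - u.1.1) (l - u.1.2) (k - u.2)%N).

(* d/dx (e^(-a/x) x^l (log x)^k) is e^(-a/x) times
   a x^(l-2) (log x)^k + l x^(l-1) (log x)^k + k x^(l-1) (log x)^(k-1). *)
Definition lederiv (T : logexp) : logexp := fun a l k =>
  a *: T a (l + 2) k + (l + 1) *: T a (l + 1) k
  + k.+1%:R *: T a (l + 1) k.+1.

(* A matrix of formal Laurent series in x is given by its coefficients. *)
Definition laurent_series (F : int -> 'M[C]_n) : Prop :=
  exists N : int, forall m : int, m < N -> F m = 0.

Definition of_laurent (F : int -> 'M[C]_n) : logexp := fun a l k =>
  if (a == 0) && (k == 0)%N then
    \sum_(m \in [set m : int | l = m%:~R]) F m
  else 0.

Definition of_powerseries (A : nat -> 'M[C]_n) : logexp :=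
  of_laurent (fun m : int => if m is Posz k then A k else 0).

Definition xpow (d : int) : logexp :=
  of_laurent (fun m : int => (m == d)%:R%:M).

Definition laurent_invertible (F : int -> 'M[C]_n) : Prop :=
  exists G : int -> 'M[C]_n,
    [/\ laurent_series G,
        lemul (of_laurent F) (of_laurent G) = xpow 0 &
        lemul (of_laurent G) (of_laurent F) = xpow 0].

Definition convergent_powerseries (A : nat -> 'M[C]_n) : Prop :=
  exists2 r : R, 0 < r & forall (i j : 'I_n) (z : C), modulus z < r ->
    cvgn (cpseries (fun k => A k i j) z).

End FormalExpressions.

Definition nilpotent_jordan (K : pzRingType) (n : nat) : 'M[K]_n :=
  \matrix_(i, j) ((j == i.+1 :> nat)%:R : K).

(* x^L for L = (+)_j (lam_j I + N_j), N_j nilpotent Jordan of size p_j: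
   x^(lam I + N) = x^lam exp (N log x) = x^lam sum_k N^k (log x)^k / k!. *)
Definition xpow_jordan (R : realType) (J : nat) (p : 'I_J -> nat)
    (lam : 'I_J -> Cplx R) : logexp R (\sum_j p j) := fun a l k =>
  \mxdiag_j (if (a == 0) && (l == lam j) then
               (k`!%:R^-1 : Cplx R) *: (nilpotent_jordan (Cplx R) (p j)) ^+ k
             else 0).

(* e^Q for Q = (+)_j (- q_j / x) I_(p_j) *)
Definition exp_level_one (R : realType) (J : nat) (p : 'I_J -> nat)
    (q : 'I_J -> Cplx R) : logexp R (\sum_j p j) := fun a l k =>
  \mxdiag_j (if [&& a == q j, l == 0 & (k == 0)%N] then 1%:M else 0).

Section Surface.
Variable R : realType.
Local Notation C := (Cplx R).
Implicit Types (Om : set C) (g h : R -> C) (z w c : C).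

(* Only the values on [0, 1] of a path R -> C matter. *)

(* The path may rest at 0 for some initial time, which does not change the
   homotopy classes; after it has left 0 it never meets Omega. In particular,
   if 0 is in Omega then a path ending at 0 is constant. *)
Definition admissible Om g : Prop :=
  [/\ {within `[0, 1]%classic, continuous g}, g 0 = 0 &
      forall t : R, 0 <= t <= 1 -> Om (g t) ->
        forall s : R, 0 <= s <= t -> g s = 0].

Definition homotopic Om g0 g1 : Prop :=
  exists H : R * R -> C,
    [/\ {within `[0, 1]%classic `*` `[0, 1]%classic, continuous H},
        forall t : R, 0 <= t <= 1 -> H (0, t) = g0 t /\ H (1, t) = g1 t,
        forall s : R, 0 <= s <= 1 -> H (s, 1) = g0 1 &
        forall s : R, 0 <= s <= 1 -> admissible Om (fun t => H (s, t))].

Definition pathclass := set (R -> C).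

Definition hclass Om g : pathclass := [set h | homotopic Om g h].

Definition surface Om : set pathclass := [set hclass Om g | g in admissible Om].

Definition concat g h : R -> C := fun t =>
  if t <= 2^-1 then g (2 * t) else h (2 * t - 1).

Definition segment z w : R -> C := fun t => z + t%:C * (w - z).

(* The projection [g] |-> g 1 is a local homeomorphism with local inverse
   w |-> [g . segment (g 1) w] near g 1: these inverses are the charts. Only
   the values of Phi on [surface Om] matter. *)
Definition resurgent Om (Phi : pathclass -> C) : Prop :=
  forall g, admissible Om g ->
    \forall w \near g 1,
      derivable (fun w : C => Phi (hclass Om (concat g (segment (g 1) w)))) w 1.

Definition C1 (f : R -> R) : Prop :=
  (forall t, derivable f t 1) /\ continuous (f^`()%classic).

Definition piecewise_C1 g : Prop :=
  exists2 s : seq R, itv_partition 0 1 s &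
    forall i, (i < size s)%N -> exists h : R -> C,
      [/\ C1 (fun t => complex.Re (h t)), C1 (fun t => complex.Im (h t)) &
          forall t : R, nth 0 (0 :: s) i <= t <= nth 0 s i -> g t = h t].

Definition dist_gt (nu : R) (U Om : set C) : Prop :=
  exists2 d : R, nu < d & forall z w, U z -> Om w -> d <= modulus (z - w).

Definition polar c (r theta : R) : C := c + r%:C * (cos theta +i* sin theta).

(* The disc is {|w| < rho} in the first sheet. The path [sr_path], given by
   its projection, starts in the disc and is lifted from there. The sector
   {c + r e^(i theta) : r > r0, alpha < theta < beta} is lifted along the
   parameters (r, theta), starting from the end [polar c r1 theta1] of the
   path; its opening beta - alpha may exceed 2 pi. *)
Record sectorial_data := SectorialData {
  sr_rho : R;
  sr_path : R -> C;
  sr_delta : R;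
  sr_vertex : C;
  sr_r0 : R;
  sr_alpha : R;
  sr_beta : R;
  sr_r1 : R;
  sr_theta1 : R
}.

Implicit Type D : sectorial_data.

Definition plane_disc D : set C := [set w | modulus w < sr_rho D].

Definition plane_tube D : set C :=
  [set w | exists2 t : R, 0 <= t <= 1 & modulus (w - sr_path D t) < sr_delta D].

Definition sector_params D : set (R * R) :=
  [set u | sr_r0 D < u.1 /\ sr_alpha D < u.2 < sr_beta D].

Definition plane_sector D : set C :=
  [set polar (sr_vertex D) u.1 u.2 | u in sector_params D].

(* straight line from (r1, theta1) to u in the parameters (r, theta) *)
Definition sector_path D (u : R * R) : R -> C := fun s =>
  polar (sr_vertex D) (sr_r1 D + s * (u.1 - sr_r1 D))
                      (sr_theta1 D + s * (u.2 - sr_theta1 D)).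

Definition disc Om D : set pathclass :=
  [set hclass Om (segment 0 w) | w in plane_disc D].

Definition tube Om D : set pathclass :=
  [set P | exists t w,
    [/\ 0 <= t <= 1, modulus (w - sr_path D t) < sr_delta D &
        P = hclass Om (concat
              (concat (segment 0 (sr_path D 0)) (fun s => sr_path D (t * s)))
              (segment (sr_path D t) w))]].

Definition sector Om D : set pathclass :=
  [set hclass Om (concat (concat (segment 0 (sr_path D 0)) (sr_path D))
                         (sector_path D u)) | u in sector_params D].

Definition sectorial_region Om (nu : R) (Delta : set pathclass) : Prop :=
  exists D,
    [/\ [/\ 0 < sr_rho D, 0 < sr_delta D & 0 <= sr_r0 D],
        [/\ piecewise_C1 (sr_path D),
            plane_disc D (sr_path D 0),
            sector_params D (sr_r1 D, sr_theta1 D) &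
            sr_path D 1 = polar (sr_vertex D) (sr_r1 D) (sr_theta1 D)],
        dist_gt nu (plane_disc D) (Om `\ 0),
        dist_gt nu (plane_tube D `|` plane_sector D) Om &
        Delta `<=` surface Om /\ Delta = disc Om D `|` tube Om D `|` sector Om D].

Definition exp_growth Om (Delta : set pathclass) (Phi : pathclass -> C) : Prop :=
  exists K b M : R, forall g, admissible Om g -> Delta (hclass Om g) ->
    M <= modulus (g 1) ->
    modulus (Phi (hclass Om g)) <= K * expR (b * modulus (g 1)).

Definition summable_resurgent Om (Phi : pathclass -> C) : Prop :=
  resurgent Om Phi /\
  forall nu : R, 0 < nu ->
    (forall z w, Om z -> Om w -> z != w -> nu < modulus (z - w) / 2) ->
    forall Delta, sectorial_region Om nu Delta -> exp_growth Om Delta Phi.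

(* x^m |-> xi^(m-1) / Gamma(m) for m >= 1; the terms with m <= 0 are dropped.
   [borel f k] is the coefficient of xi^k. *)
Definition borel (f : int -> C) : nat -> C := fun k => f k.+1 / k`!%:R.

Definition continues_borel Om (f : int -> C) (Phi : pathclass -> C) : Prop :=
  exists2 r : R, 0 < r & forall xi : C, modulus xi < r ->
    cpseries (borel f) xi @ \oo --> Phi (hclass Om (segment 0 xi)).

Definition summable_resurgent_series Om (f : int -> C) : Prop :=
  exists2 Phi, continues_borel Om f Phi & summable_resurgent Om Phi.

End Surface.

(* Main.v *)
Require Import Defs.
From HB Require Import structures.
From mathcomp Require Import all_boot all_order all_algebra.
From mathcomp Require Import all_classical all_reals all_analysis.
From mathcomp Require Import zify ring lra.

(** The convergent matrix A enters the equation through an entire function of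
    exponential type, its Borel transform, and this makes the problem linear
    and of Volterra type with an entire kernel. Write D for the diagonal matrix
    of the a_j and phi for the Borel transform of the positive part of F. The
    equation x^2 F' + F (D + x L) = A F, read off coefficient by coefficient
    from the log-exponential expressions ([laurent_solution]), becomes
<<
      (xi - N) phi(xi) = int_0^xi K(xi - eta) phi(eta) d eta + S(xi),
>>
    where N X = A_0 X - X D, the kernel K is entire of exponential type, and so
    is S, because the polar part of F is finite ([source_bound]). As K is entire
    the integral may follow any path, and no product of multivalued functions
    has to be continued.

    Three facts give the result.

    The only singularities are at Omega. Applying x^2 d/dx - a_j repeatedly
    raises the order of vanishing in the basis F, hence kills the leading matrix
    A_0 modulo x: a product of factors A_0 - a_j vanishes
    ([leading_annihilated]). So xi - N is invertible off the differences of the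
    a_j, with an inverse bounded at any positive distance from them
    ([resolvent_bound]).

    The germ at 0 converges. A truncation T of the inverse of F carries the
    system to D + x L up to high order; the coefficients of T F then satisfy a
    recursion in which a division by a_i - a_j or by m is always possible,
    which bounds them by C K^m m! ([formal_solution_gevrey]).

    The germ continues along all paths. Freeze the upper limit of the integral:
    the right-hand side is then an entire function of a second variable, and its
    derivatives s_k on the diagonal satisfy the differential system
<<
      s_k' = s_(k+1) + kap_k phi,    (xi - N) phi = s_0
>>
    on sequences with |s_k| <= S b^k. Its coefficients are bounded away from
    Omega, so that it has solutions on discs whose radius and amplification
    depend only on the distance to Omega ([local_solution]), and solutions that
    agree at a point agree nearby ([flat_uniq]). These discs, with the germ at
    0, are charts covering evenly the complement of Omega
    ([volterra_sheets]); paths lift to them ([lift_exists]) and homotopic paths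
    end on the same sheet ([lift_homotopy]). This defines the continuation on
    homotopy classes.

    For the growth, the bounded parts of a sectorial region are discarded. The
    sector is reached by paths of length O(r) staying away from Omega; cutting
    them into pieces of constant length, each of which at most doubles the
    state, gives an exponential bound ([continuation_growth]). *)

Set Implicit Arguments.
Unset Strict Implicit.
Unset Printing Implicit Defensive.

Import Order.TTheory GRing.Theory Num.Theory.
Import numFieldNormedType.Exports.

Local Open Scope classical_set_scope.
Local Open Scope ring_scope.

(** * Modulus and matrix norm *)

Section Modulus.
Variable R : realType.
Local Notation C := (Cplx R).
Implicit Types z w v : C.

Lemma modulus_norm z : `|z| = (modulus z)%:C%C :> C.
Proof. by case: z. Qed.

Lemma modulus_ge0 z : 0 <= modulus z.
Proof. by case: z => x y; rewrite /modulus /=; exact: Num.Theory.sqrtr_ge0. Qed.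

Lemma modulus0 : modulus (0 : C) = 0.
Proof. exact: ComplexField.Normc.normc0. Qed.

Lemma modulus1 : modulus (1 : C) = 1.
Proof. exact: ComplexField.Normc.normc1. Qed.

Lemma modulusM z w : modulus (z * w) = modulus z * modulus w.
Proof. exact: ComplexField.Normc.normcM. Qed.

Lemma modulusV z : modulus z^-1 = (modulus z)^-1.
Proof. exact: ComplexField.Normc.normcV. Qed.

Lemma modulusN z : modulus (- z) = modulus z.
Proof. by case: z => x y; rewrite /modulus /= !sqrrN. Qed.

Lemma modulusD z w : modulus (z + w) <= modulus z + modulus w.
Proof.
have := ler_normD z w; rewrite !modulus_norm.
by rewrite -rmorphD /= lecR.
Qed.

Lemma modulusB z w : modulus (z - w) = modulus (w - z).
Proof. by rewrite -modulusN opprB. Qed.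

Lemma modulus_dist z w v : modulus (z - v) <= modulus (z - w) + modulus (w - v).
Proof. by have := modulusD (z - w) (w - v); rewrite addrA subrK. Qed.

Lemma modulusX z k : modulus (z ^+ k) = modulus z ^+ k.
Proof. by elim: k => [|k IH]; rewrite ?expr0 ?modulus1 // !exprS modulusM IH. Qed.

Lemma modulus_eq0 z : (modulus z == 0) = (z == 0).
Proof.
apply/eqP/eqP => [/ComplexField.Normc.eq0_normc //|->]; exact: modulus0.
Qed.

Lemma modulus_gt0 z : (0 < modulus z) = (z != 0).
Proof. by rewrite lt_neqAle modulus_ge0 andbT eq_sym modulus_eq0. Qed.

Lemma modulus_real (x : R) : modulus (x%:C%C : C) = `|x|.
Proof. by rewrite /modulus /= expr0n /= addr0 sqrtr_sqr. Qed.

Lemma modulus_nat (k : nat) : modulus (k%:R : C) = k%:R.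
Proof.
have -> : (k%:R : C) = (k%:R : R)%:C%C.
  exact/esym/(rmorph_nat (real_complex R)).
by rewrite modulus_real ger0_norm.
Qed.

Lemma modulus_le_ReIm z :
  modulus z <= `|complex.Re z| + `|complex.Im z|.
Proof.
case: z => x y; rewrite /modulus /=.
rewrite -[leRHS]ger0_norm ?addr_ge0 // -sqrtr_sqr ler_wsqrtr //.
rewrite sqrrD !real_normK ?num_real // -addrA lerD2l.
by rewrite lerDr mulrn_wge0 // mulr_ge0.
Qed.

Lemma modulus_ge_Re z : `|complex.Re z| <= modulus z.
Proof.
case: z => x y; rewrite /modulus /= -sqrtr_sqr ler_wsqrtr //.
by rewrite lerDl sqr_ge0.
Qed.

Lemma modulus_ge_Im z : `|complex.Im z| <= modulus z.
Proof.
case: z => x y; rewrite /modulus /= -[`|y|]sqrtr_sqr ler_wsqrtr //.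
by rewrite lerDr sqr_ge0.
Qed.

Lemma modulus_sum (I : Type) (r : seq I) (P : pred I) (f : I -> C) :
  modulus (\sum_(i <- r | P i) f i) <= \sum_(i <- r | P i) modulus (f i).
Proof.
elim/big_ind2: _ => [||//]; first by rewrite modulus0.
by move=> x y z t xy zt; apply: le_trans (modulusD _ _) _; rewrite lerD.
Qed.

End Modulus.

Section MatrixNorm.
Variables (R : realType).
Local Notation C := (Cplx R).

Definition mnorm n m (X : 'M[C]_(n, m)) : R := \sum_i \sum_j modulus (X i j).

Section Any.
Variables n m : nat.
Implicit Types X Y : 'M[C]_(n, m).

Lemma mnorm_ge0 X : 0 <= mnorm X.
Proof. by rewrite !sumr_ge0 // => i _; rewrite sumr_ge0 // => j _; exact: modulus_ge0. Qed.

Lemma mnorm0 : mnorm (0 : 'M[C]_(n, m)) = 0.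
Proof. by rewrite /mnorm !big1 // => i _; rewrite big1 // => j _; rewrite mxE modulus0. Qed.

Lemma mnormD X Y : mnorm (X + Y) <= mnorm X + mnorm Y.
Proof.
rewrite /mnorm -big_split ler_sum // => i _; rewrite -big_split ler_sum // => j _.
by rewrite mxE modulusD.
Qed.

Lemma mnormN X : mnorm (- X) = mnorm X.
Proof. by apply: eq_bigr => i _; apply: eq_bigr => j _; rewrite mxE modulusN. Qed.

Lemma mnormB X Y : mnorm (X - Y) <= mnorm X + mnorm Y.
Proof. by rewrite -(mnormN Y) mnormD. Qed.

Lemma mnormZ c X : mnorm (c *: X) = modulus c * mnorm X.
Proof.
rewrite /mnorm mulr_sumr; apply: eq_bigr => i _; rewrite mulr_sumr.
by apply: eq_bigr => j _; rewrite mxE modulusM.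
Qed.

Lemma mnorm_sum (I : Type) (r : seq I) (P : pred I) (f : I -> 'M[C]_(n, m)) :
  mnorm (\sum_(i <- r | P i) f i) <= \sum_(i <- r | P i) mnorm (f i).
Proof.
elim/big_ind2: _ => [||//]; first by rewrite mnorm0.
by move=> x y z t xy zt; apply: le_trans (mnormD _ _) _; rewrite lerD.
Qed.

Lemma mnorm_entry X i j : modulus (X i j) <= mnorm X.
Proof.
rewrite /mnorm (bigD1 i) //= (bigD1 j) //= -addrA lerDl addr_ge0 //.
  by apply: sumr_ge0 => k _; exact: modulus_ge0.
by rewrite !sumr_ge0 // => k _; rewrite sumr_ge0 // => l _; exact: modulus_ge0.
Qed.

Lemma mnorm_eq0 X : mnorm X <= 0 -> X = 0.
Proof.
move=> X0; apply/matrixP => i j; rewrite mxE; apply/eqP; rewrite -modulus_eq0.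
by rewrite eq_le modulus_ge0 andbT (le_trans (mnorm_entry _ _ _)).
Qed.

Lemma mnorm_distC X Y : mnorm (X - Y) = mnorm (Y - X).
Proof. by rewrite -mnormN opprB. Qed.

Lemma mnorm_dist X Y Z : mnorm (X - Z) <= mnorm (X - Y) + mnorm (Y - Z).
Proof. by have := mnormD (X - Y) (Y - Z); rewrite addrA subrK. Qed.

End Any.

Lemma mnormM n m l (X : 'M[C]_(n, m)) (Y : 'M[C]_(m, l)) :
  mnorm (X *m Y) <= mnorm X * mnorm Y.
Proof.
apply: (@le_trans _ _ (\sum_i \sum_j \sum_k modulus (X i k) * modulus (Y k j))).
  apply: ler_sum => i _; apply: ler_sum => j _; rewrite mxE.
  by apply: le_trans (modulus_sum _ _ _) _; apply: ler_sum => k _; rewrite modulusM.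
rewrite /mnorm mulr_suml; apply: ler_sum => i _.
rewrite exchange_big /= mulr_suml; apply: ler_sum => k _.
rewrite -mulr_sumr ler_wpM2l ?modulus_ge0 // (bigD1 k) //= lerDl.
by rewrite !sumr_ge0 // => k' _; rewrite sumr_ge0 // => j _; exact: modulus_ge0.
Qed.

End MatrixNorm.

(** * Gluing over an interval, matrix series *)

(** Compactness of an interval, as a gluing principle: an additive property of
    subintervals holds on [a, b] as soon as it holds around every point. *)
Lemma interval_gluing (R : realType) (a b : R) (Q : R -> R -> Prop) :
    a <= b ->
    (forall x y z, a <= x -> x <= y -> y <= z -> z <= b ->
       Q x y -> Q y z -> Q x z) ->
    (forall t, a <= t -> t <= b -> exists2 e : R, 0 < e &
       forall x y, a <= x -> x <= t -> t <= y -> y <= b ->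
         t - x < e -> y - t < e -> Q x y) ->
  Q a b.
Proof.
move=> ab trQ locQ.
pose S := [set x : R | a <= x <= b /\ Q a x].
have Sa : S a.
  have [|//|e e0 He] := locQ a; first exact: lexx.
  split; first by rewrite lexx.
  by apply: He => //; rewrite subrr.
have ubS : ubound S b by move=> x [/andP[]].
have hS : has_sup S by split; [exists a | exists b].
have aS : a <= sup S by apply: ub_le_sup => //; exists b.
have Sb : sup S <= b by apply: ge_sup => //; exists a.
have [e e0 He] := locQ _ aS Sb.
have [x [/andP[ax xb] Qax] xS] := sup_adherent e0 hS.
have xleS : x <= sup S by apply: ub_le_sup; [exists b | split => //; rewrite ax xb].
pose y := Num.min b (sup S + e / 2).
have Sy : sup S <= y by rewrite le_min Sb /= lerDl divr_ge0 // ltW.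
have yb : y <= b by rewrite ge_min lexx.
have ySe : y <= sup S + e / 2 by rewrite ge_min lexx orbT.
have Qay : Q a y.
  apply: (trQ a x y) => //; first exact: le_trans Sy.
  by apply: He => //; lra.
have yS : y <= sup S.
  apply: ub_le_sup; first by exists b.
  by split=> //; rewrite yb (le_trans aS Sy).
have /eqP yE : y == sup S by rewrite eq_le yS Sy.
suff <- : y = b by [].
move: yE; rewrite /y; case: (leP b (sup S + e / 2)) => // _ E.
by exfalso; lra.
Qed.

Section Series.
Variables (R : realType) (n m : nat).
Local Notation C := (Cplx R).
Local Notation V := 'M[C]_(n, m).

Definition is_sum (c : nat -> V) (v : V) : Prop :=
  forall e : R, 0 < e -> exists N0, forall N, (N0 <= N)%N ->
    mnorm (v - \sum_(k < N) c k) < e.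

Lemma is_sum_uniq c v w : is_sum c v -> is_sum c w -> v = w.
Proof.
move=> cv cw; apply/eqP; rewrite -subr_eq0; apply/eqP/mnorm_eq0.
apply/ler_addgt0Pr => e e0; rewrite add0r.
have [N1 H1] := cv (e / 2) (divr_gt0 e0 (ltr0n R 2)).
have [N2 H2] := cw (e / 2) (divr_gt0 e0 (ltr0n R 2)).
have := H1 (maxn N1 N2) (leq_maxl _ _); have := H2 (maxn N1 N2) (leq_maxr _ _).
set S := \sum_(k < _) _ => h2 h1.
have := mnorm_dist v S w; rewrite (mnorm_distC S w) => h3; lra.
Qed.

Lemma is_sumD c d v w : is_sum c v -> is_sum d w ->
  is_sum (fun k => c k + d k) (v + w).
Proof.
move=> cv cw e e0.
have [N1 H1] := cv (e / 2) (divr_gt0 e0 (ltr0n R 2)).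
have [N2 H2] := cw (e / 2) (divr_gt0 e0 (ltr0n R 2)).
exists (maxn N1 N2) => N; rewrite geq_max => /andP[/H1 h1 /H2 h2].
rewrite big_split /= opprD addrACA.
by apply: le_lt_trans (mnormD _ _) _; lra.
Qed.

Lemma is_sum_unshift c v : is_sum (fun k => c k.+1) v -> is_sum c (c 0%N + v).
Proof.
move=> cv e e0; have [N0 H] := cv e e0; exists N0.+1 => -[//|N] N0N.
have := H N N0N; rewrite big_ord_recl /= opprD addrACA subrr add0r.
by congr (_ < _); congr mnorm; congr (_ - _); apply: eq_bigr => i _; rewrite /bump add1n.
Qed.

Lemma eq_is_sum c d v : c =1 d -> is_sum c v -> is_sum d v.
Proof. by move=> cd cv; have -> : d = c by apply/funext => k; rewrite cd. Qed.

Lemma sum_half_le (B : R) (N : nat) : 0 <= B ->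
  \sum_(k < N) B * 2^-1 ^+ k <= 2 * B.
Proof.
move=> B0; suff -> : \sum_(k < N) B * 2^-1 ^+ k = 2 * B - 2 * B * 2^-1 ^+ N.
  by rewrite gerBl mulr_ge0 ?mulr_ge0 // exprn_ge0.
elim: N => [|N IH]; first by rewrite big_ord0 expr0 mulr1 subrr.
rewrite big_ord_recr /= IH exprS; set q := _ ^+ N; lra.
Qed.

Lemma is_sum_bound c v (B : R) : 0 <= B -> is_sum c v ->
  (forall k, mnorm (c k) <= B * 2^-1 ^+ k) -> mnorm v <= 2 * B.
Proof.
move=> B0 cv cB; apply/ler_addgt0Pr => e e0.
have [N0 /(_ N0 (leqnn _)) H] := cv e e0.
rewrite -[v](subrK (\sum_(k < N0) c k)) addrC.
apply: le_trans (mnormD _ _) _; rewrite lerD // ?(ltW H) //.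
apply: le_trans (mnorm_sum _ _ _) _.
by apply: le_trans (ler_sum _ (fun (i : 'I_N0) _ => cB i)) (sum_half_le _ _).
Qed.

End Series.

Lemma is_sum_map (R : realType) n m n' m' (f : 'M[Cplx R]_(n, m) -> 'M[Cplx R]_(n', m'))
    (K : R) c v :
  (forall X Y, f (X + Y) = f X + f Y) -> f 0 = 0 ->
  (forall X, mnorm (f X) <= K * mnorm X) ->
  is_sum c v -> is_sum (fun k => f (c k)) (f v).
Proof.
move=> fD f0 fK cv e e0.
have K1 : 0 < `|K| + 1 by rewrite ltr_wpDl.
have [N0 H] := cv (e / (`|K| + 1)) (divr_gt0 e0 K1).
exists N0 => N /H; rewrite ltr_pdivlMr // => hN.
have fN X : f (- X) = - f X by apply/eqP; rewrite -addr_eq0 -fD addNr f0.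
rewrite -(big_morph f fD f0) -fN -fD.
apply: le_lt_trans hN; apply: le_trans (fK _) _.
rewrite mulrC ler_wpM2l ?mnorm_ge0 //.
by have := ler_norm K; lra.
Qed.

Lemma is_sumZ (R : realType) n m (a : Cplx R) (c : nat -> 'M[Cplx R]_(n, m)) v :
  is_sum c v -> is_sum (fun k => a *: c k) (a *: v).
Proof.
apply: (@is_sum_map _ _ _ _ _ (fun X => a *: X) (modulus a)).
- by move=> X Y; rewrite scalerDr.
- by rewrite scaler0.
- by move=> X; rewrite mnormZ.
Qed.

Section SumExists.
Variables (R : realType).
Local Notation C := (Cplx R).

Lemma ReB (z w : C) : complex.Re (z - w) = complex.Re z - complex.Re w.
Proof. by case: z w => [a b] [c d]. Qed.

Lemma ImB (z w : C) : complex.Im (z - w) = complex.Im z - complex.Im w.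
Proof. by case: z w => [a b] [c d]. Qed.

Lemma Re_sum (f : nat -> C) N :
  complex.Re (\sum_(k < N) f k) = \sum_(k < N) complex.Re (f k).
Proof.
by apply: (big_morph (fun z : C => complex.Re z)) => // -[a b] [c d].
Qed.

Lemma Im_sum (f : nat -> C) N :
  complex.Im (\sum_(k < N) f k) = \sum_(k < N) complex.Im (f k).
Proof.
by apply: (big_morph (fun z : C => complex.Im z)) => // -[a b] [c d].
Qed.

Lemma real_geo_sum (u : nat -> R) (B : R) : 0 <= B ->
  (forall k, `|u k| <= B * 2^-1 ^+ k) ->
  exists l : R, forall e : R, 0 < e -> exists N0, forall N, (N0 <= N)%N ->
    `|l - \sum_(k < N) u k| < e.
Proof.
move=> B0 uB.
have cv : cvgn (series u).
  apply: normed_cvg; apply: (series_le_cvg _ _ uB) => [k|k|].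
  - exact: normr_ge0.
  - by rewrite mulr_ge0 // exprn_ge0.
  - apply: is_cvg_geometric_series; rewrite ger0_norm //; lra.
exists (limn (series u)) => e e0.
have /cvgrPdist_lt/(_ e e0)[N0 _ H] := cv.
by exists N0 => N NN; have := H N NN; rewrite /series /= big_mkord.
Qed.

Lemma geo_sum_exists n m (c : nat -> 'M[C]_(n, m)) (B : R) : 0 <= B ->
  (forall k, mnorm (c k) <= B * 2^-1 ^+ k) -> exists v, is_sum c v.
Proof.
move=> B0 cB.
have cBe i j k : modulus (c k i j) <= B * 2^-1 ^+ k.
  exact: le_trans (mnorm_entry _ _ _) (cB k).
have HR (i : 'I_n) (j : 'I_m) := real_geo_sum B0
  (fun k => le_trans (modulus_ge_Re _) (cBe i j k)).
have HI (i : 'I_n) (j : 'I_m) := real_geo_sum B0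
  (fun k => le_trans (modulus_ge_Im _) (cBe i j k)).
pose lR i j := projT1 (cid (HR i j)); pose lI i j := projT1 (cid (HI i j)).
exists (\matrix_(i, j) (Complex (lR i j) (lI i j) : C)) => e e0.
pose e' := e / (2 * (n * m)%:R + 1).
have e'0 : 0 < e' by rewrite divr_gt0 // ltr_wpDl // mulr_ge0.
have HRI i j : exists N0, forall N, (N0 <= N)%N ->
    modulus ((Complex (lR i j) (lI i j) : C) - \sum_(k < N) c k i j) <= 2 * e'.
  have [N1 H1] := projT2 (cid (HR i j)) _ e'0.
  have [N2 H2] := projT2 (cid (HI i j)) _ e'0.
  exists (maxn N1 N2) => N; rewrite geq_max => /andP[/H1 h1 /H2 h2].
  apply: le_trans (modulus_le_ReIm _) _.
  rewrite ReB ImB (Re_sum (fun k => c k i j)) (Im_sum (fun k => c k i j)) /=.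
  by rewrite mulrDl mul1r lerD // ltW.
pose N0 i j := projT1 (cid (HRI i j)).
exists (\max_i \max_j N0 i j)%N => N NN.
apply: (@le_lt_trans _ _ ((n * m)%:R * (2 * e'))).
  have -> : (n * m)%:R * (2 * e') = \sum_(i < n) \sum_(j < m) (2 * e').
    by rewrite !sumr_const !card_ord -mulrnA mulnC mulr_natl.
  apply: ler_sum => i _; apply: ler_sum => j _; rewrite !mxE summxE.
  apply: (projT2 (cid (HRI i j))); apply: leq_trans NN.
  apply: leq_trans (leq_bigmax i) => /=.
  exact: leq_trans (leq_bigmax j).
have D0 : 0 < 2 * (n * m)%:R + 1 :> R by rewrite ltr_wpDl // mulr_ge0.
rewrite -[ltRHS](divfK (lt0r_neq0 D0) e) -/e'; lra.
Qed.

End SumExists.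

(** * Complex derivatives *)

Section Derivative.
Variables (R : realType) (n m : nat).
Local Notation C := (Cplx R).
Local Notation V := 'M[C]_(n, m).

Definition hasder (f : C -> V) (z : C) (d : V) : Prop :=
  forall e : R, 0 < e -> exists2 h : R, 0 < h & forall w, modulus (w - z) < h ->
    mnorm (f w - f z - (w - z) *: d) <= e * modulus (w - z).

Definition point_on (p z : C) (t : R) : C := p + t%:C%C * (z - p).

Lemma point_on_dist p z s t :
  modulus (point_on p z s - point_on p z t) = `|s - t| * modulus (z - p).
Proof.
rewrite /point_on opprD addrACA subrr add0r -mulrBl modulusM.
by rewrite -modulus_real; congr (modulus _ * _); rewrite rmorphB.
Qed.

Lemma point_on0 p z : point_on p z 0 = p.
Proof. by rewrite /point_on mul0r addr0. Qed.

Lemma point_on1 p z : point_on p z 1 = z.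
Proof. by rewrite /point_on mul1r addrC subrK. Qed.

Lemma hasder_locally f g z d (r : R) : 0 < r ->
  (forall w, modulus (w - z) < r -> f w = g w) -> hasder f z d -> hasder g z d.
Proof.
move=> r0 fg fd e e0; have [h h0 H] := fd e e0.
exists (Num.min h r); first by rewrite lt_min h0.
move=> w; rewrite lt_min => /andP[/H wh wr].
by rewrite -!fg // subrr modulus0.
Qed.

Lemma hasder_comp_shift f z c d : hasder f (z - c) d ->
  hasder (fun w => f (w - c)) z d.
Proof.
move=> fd e e0; have [h h0 H] := fd e e0; exists h => // w wh.
have := H (w - c); have -> : w - c - (z - c) = w - z by ring.
exact.
Qed.

Lemma hasderB f g z d d' : hasder f z d -> hasder g z d' ->
  hasder (fun w => f w - g w) z (d - d').
Proof.
move=> fd gd e e0.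
have e2 : 0 < e / 2 by rewrite divr_gt0.
have [h h0 H] := fd _ e2; have [k k0 K] := gd _ e2.
exists (Num.min h k); first by rewrite lt_min h0.
move=> w; rewrite lt_min => /andP[/H wh /K wk].
have -> : f w - g w - (f z - g z) - (w - z) *: (d - d') =
  (f w - f z - (w - z) *: d) - (g w - g z - (w - z) *: d').
  by apply/matrixP => i j; rewrite !mxE; ring.
by apply: le_trans (mnormB _ _) _; lra.
Qed.

(** Chopping the segment: on small pieces the increment of [f] is controlled by
    its derivative, and the bounds add up. *)
Lemma mean_value f p z (B : R) : 0 <= B ->
  (forall t, 0 <= t -> t <= 1 ->
    exists2 d, hasder f (point_on p z t) d & mnorm d <= B) ->
  mnorm (f z - f p) <= B * modulus (z - p).
Proof.
move=> B0 H; set m' := modulus (z - p).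
have m0 : 0 <= m' by exact: modulus_ge0.
suff: forall e, 0 < e -> mnorm (f z - f p) <= (B + e) * m'.
  move=> K; apply/ler_addgt0Pr => e e0.
  have := K (e / (m' + 1)) (divr_gt0 e0 (ltr_wpDl m0 ltr01)).
  move=> /le_trans; apply; rewrite mulrDl lerD2l mulrAC ler_pdivrMr ?ltr_wpDl //.
  by rewrite ler_pM2l // lerDl.
move=> e e0.
pose Q x y := mnorm (f (point_on p z y) - f (point_on p z x)) <= (B + e) * (y - x) * m'.
suff : Q 0 1 by rewrite /Q subr0 mulr1 point_on0 point_on1.
apply: (@interval_gluing R 0 1 Q ler01).
  rewrite /Q => x y w _ _ _ _ xy yw.
  apply: le_trans (mnorm_dist _ (f (point_on p z y)) _) _.
  by apply: le_trans (lerD yw xy) _; rewrite -mulrDl -mulrDr; lra.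
move=> t t0 t1; have [d fd dB] := H t t0 t1.
have [h h0 K] := fd e e0.
have hm : 0 < h / (m' + 1) by rewrite divr_gt0 // ltr_wpDl.
exists (h / (m' + 1)) => // x y _ xt ty _ tx yt.
have near s : `|s - t| < h / (m' + 1) ->
    mnorm (f (point_on p z s) - f (point_on p z t)) <= (B + e) * `|s - t| * m'.
  move=> st; have := K (point_on p z s); rewrite point_on_dist.
  have H1 : `|s - t| * m' < h.
    apply: le_lt_trans (_ : `|s - t| * (m' + 1) < h).
      by rewrite ler_wpM2l // lerDl.
    by rewrite -ltr_pdivlMr // ltr_wpDl.
  move=> /(_ H1) {}H1.
  rewrite -[X in mnorm X](subrK ((point_on p z s - point_on p z t) *: d)).
  apply: le_trans (mnormD _ _) _; apply: le_trans (lerD H1 (lexx _)) _.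
  rewrite mnormZ point_on_dist -/m' -[_ * _ * m']mulrA.
  set q := _ * m'; have q0 : 0 <= q by rewrite mulr_ge0.
  by have := ler_wpM2l q0 dB; lra.
have := near y; have := near x.
rewrite [`|x - t|]distrC !ger0_norm ?subr_ge0 // => /(_ tx) H1 /(_ yt) H2.
apply: le_trans (mnorm_dist _ (f (point_on p z t)) _) _.
rewrite [X in _ + X]mnorm_distC.
by apply: le_trans (lerD H2 H1) _; rewrite -mulrDl -mulrDr; lra.
Qed.

Lemma pow_taylor_bound (z w : C) (r : R) k : 0 < r -> modulus z <= r -> modulus w <= r ->
  modulus (w ^+ k - z ^+ k - (w - z) * (k%:R * z ^+ k.-1)) * r ^+ 2 <=
  k%:R ^+ 2 * modulus (w - z) ^+ 2 * r ^+ k.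
Proof.
move=> r0 zr wr.
have zrk j : modulus (z ^+ j) <= r ^+ j.
  by rewrite modulusX lerXn2r // ?nnegrE ?modulus_ge0 // ltW.
elim: k => [|k IH].
  by rewrite !expr0 subrr mul0r mulr0 subr0 modulus0 mul0r expr0n /= !mul0r.
set h := w - z in IH *.
pose D := w ^+ k - z ^+ k - h * (k%:R * z ^+ k.-1).
have -> : w ^+ k.+1 - z ^+ k.+1 - h * (k.+1%:R * z ^+ k.+1.-1) =
   w * D + k%:R * h ^+ 2 * z ^+ k.-1.
  rewrite /D /h /=; case: k {IH D} => [|k] /=; first by rewrite !expr1 !expr0; ring.
  by rewrite !exprS -[in LHS]natr1; ring.
apply: le_trans (ler_wpM2r (sqr_ge0 r) (modulusD _ _)) _.
rewrite mulrDl (modulusM w) (modulusM (_ * _)) (modulusM k%:R) modulus_nat (modulusX h).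
have H1 : modulus w * modulus D * r ^+ 2 <= r * (k%:R ^+ 2 * modulus h ^+ 2 * r ^+ k).
  rewrite -mulrA; apply: ler_pM => //; first exact: modulus_ge0.
  by rewrite mulr_ge0 ?modulus_ge0 // sqr_ge0.
have H2 : k%:R * modulus h ^+ 2 * modulus (z ^+ k.-1) * r ^+ 2 <=
     k%:R * modulus h ^+ 2 * r ^+ k.+1.
  case: k {IH D H1} => [|k]; first by rewrite !mul0r.
  rewrite -mulrA ler_wpM2l ?mulr_ge0 ?modulus_ge0 //.
  have -> : r ^+ k.+2 = r ^+ k * r ^+ 2 by rewrite -exprD addn2.
  by rewrite ler_wpM2r // sqr_ge0.
apply: le_trans (lerD H1 H2) _.
have -> : r * (k%:R ^+ 2 * modulus h ^+ 2 * r ^+ k) = k%:R ^+ 2 * modulus h ^+ 2 * r ^+ k.+1.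
  by rewrite [r ^+ k.+1]exprS; ring.
rewrite -!mulrDl ler_wpM2r ?exprn_ge0 ?(ltW r0) // ler_wpM2r ?sqr_ge0 //.
rewrite -natr1 sqrrD expr1n mulr1 -addrA lerD2l.
by rewrite mulr2n -addrA lerDl addr_ge0.
Qed.

Lemma sqr_le_pow2 k : (k ^ 2 <= 2 * 2 ^ k)%N.
Proof.
have [->|[->|[->|]]] // : k = 0%N \/ k = 1%N \/ k = 2 \/ (2 < k)%N by lia.
elim: k => // k IH; rewrite ltnS leq_eqVlt => /orP[/eqP<-//|k2].
by have := IH k2; rewrite (expnS 2 k) => H; nia.
Qed.

(** Second-order Taylor estimate summed term by term. *)
Lemma power_series_hasder (c : nat -> V) (B beta r : R) (f g : C -> V) :
  0 <= B -> 0 < beta -> 0 < r -> r * beta <= 4^-1 ->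
  (forall k, mnorm (c k) <= B * beta ^+ k) ->
  (forall z, modulus z < r -> is_sum (fun k => z ^+ k *: c k) (f z)) ->
  (forall z, modulus z < r ->
     is_sum (fun k => z ^+ k *: (k.+1%:R *: c k.+1)) (g z)) ->
  forall z, modulus z < r -> hasder f z (g z).
Proof.
move=> B0 b0 r0 rb cB fs gs z zr.
have key w : modulus w < r ->
    mnorm (f w - f z - (w - z) *: g z) <= 4 * B / r ^+ 2 * modulus (w - z) ^+ 2.
  move=> wr; have r20 : 0 < r ^+ 2 by rewrite exprn_gt0.
  have S : is_sum (fun k => (w ^+ k - z ^+ k - (w - z) * (k%:R * z ^+ k.-1)) *: c k)
      (f w - f z - (w - z) *: g z).
    have := is_sumD (is_sumD (fs w wr) (is_sumZ (-1) (fs z zr)))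
      (is_sumZ (z - w) (@is_sum_unshift _ _ _ (fun k => (k%:R * z ^+ k.-1) *: c k) _ _)).
    move=> /(_ (g z)); rewrite /= mul0r scale0r add0r.
    have -> : f w + -1 *: f z + (z - w) *: g z = f w - f z - (w - z) *: g z.
      by rewrite scaleN1r -[z - w]opprB scaleNr.
    have H : is_sum (fun k : nat => (k.+1%:R * z ^+ k) *: c k.+1) (g z).
      by apply: eq_is_sum (gs z zr) => k; rewrite scalerA mulrC.
    move=> /(_ H); apply: eq_is_sum => k.
    by rewrite !scalerA -!scalerDl; congr (_ *: _); ring.
  have := is_sum_bound (B := 2 * B / r ^+ 2 * modulus (w - z) ^+ 2) _ S.
  have -> : 2 * (2 * B / r ^+ 2 * modulus (w - z) ^+ 2) =
            4 * B / r ^+ 2 * modulus (w - z) ^+ 2 by field; rewrite lt0r_neq0.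
  apply=> [|k].
    by rewrite mulr_ge0 ?sqr_ge0 // mulr_ge0 ?invr_ge0 ?(ltW r20) // mulr_ge0.
  rewrite mnormZ.
  have H := pow_taylor_bound k r0 (ltW zr) (ltW wr).
  have {}H := ler_wpM2r (mnorm_ge0 (c k)) H.
  rewrite -(ler_pM2r r20) mulrAC; apply: le_trans H _.
  apply: (@le_trans _ _ (k%:R ^+ 2 * modulus (w - z) ^+ 2 * r ^+ k * (B * beta ^+ k))).
    by rewrite ler_wpM2l // mulr_ge0 ?exprn_ge0 ?(ltW r0) // mulr_ge0 ?sqr_ge0.
  have rbk : (r * beta) ^+ k <= 2^-1 ^+ k * 2^-1 ^+ k.
    rewrite -exprMn lerXn2r ?nnegrE ?mulr_ge0 ?(ltW r0) ?(ltW b0) //.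
    by apply: le_trans rb _; lra.
  have k2 : k%:R ^+ 2 * 2^-1 ^+ k <= 2 :> R.
    rewrite exprVn ler_pdivrMr ?exprn_gt0 // -!natrX -natrM ler_nat.
    exact: sqr_le_pow2.
  rewrite exprMn in rbk.
  have -> : k%:R ^+ 2 * modulus (w - z) ^+ 2 * r ^+ k * (B * beta ^+ k) =
    B * modulus (w - z) ^+ 2 * (k%:R ^+ 2 * (r ^+ k * beta ^+ k)) by ring.
  have -> : 2 * B / r ^+ 2 * modulus (w - z) ^+ 2 * 2^-1 ^+ k * r ^+ 2 =
    B * modulus (w - z) ^+ 2 * (2 * 2^-1 ^+ k) by field; rewrite lt0r_neq0.
  rewrite ler_wpM2l ?mulr_ge0 ?modulus_ge0 //.
  apply: (@le_trans _ _ (k%:R ^+ 2 * (2^-1 ^+ k * 2^-1 ^+ k))).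
    by rewrite ler_wpM2l // sqr_ge0.
  by rewrite mulrA ler_wpM2r // exprn_ge0.
move=> e e0.
have r20 : 0 < r ^+ 2 by rewrite exprn_gt0.
pose K := 4 * B / r ^+ 2.
have K0 : 0 <= K by rewrite /K mulr_ge0 ?mulr_ge0 // invr_ge0 ltW.
exists (Num.min (e / (K + 1)) (r - modulus z)).
  by rewrite lt_min subr_gt0 zr andbT divr_gt0 // ltr_wpDl.
move=> w; rewrite lt_min => /andP[wK wr].
have {}wr : modulus w < r.
  by have := modulusD (w - z) z; rewrite subrK; lra.
apply: le_trans (key w wr) _; rewrite -/K expr2 mulrA ler_wpM2r ?modulus_ge0 //.
apply: (@le_trans _ _ ((K + 1) * modulus (w - z))).
  by rewrite ler_wpM2r ?modulus_ge0 // lerDl.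
by rewrite mulrC -ler_pdivlMr ?ltr_wpDl // ltW.
Qed.

End Derivative.

(** * Path lifting over the punctured plane *)

Section Covering.
Variables (R : realType).
Local Notation C := (Cplx R).

(** A sheaf-like description of a possibly multivalued object over the plane
    punctured at [Om]: local sections [sheet_val i], which agree on the common
    domain as soon as they agree at one point, and which cover evenly a
    neighbourhood of every point outside [Om]. At a point of [Om] nothing is
    covered evenly; [sheet_chart0] is the germ at the origin, where paths start. *)
Record sheets (Om : set C) := Sheets {
  sheet_state : Type;
  sheet_chart : Type;
  sheet_dom : sheet_chart -> C -> Prop;
  sheet_val : sheet_chart -> C -> sheet_state;
  sheet_regular : sheet_state -> Prop;
  sheet_state0 : sheet_state;
  sheet_chart0 : sheet_chart;
  sheets_agree : forall i j x y, sheet_dom i x -> sheet_dom j x -> sheet_dom i y -> sheet_dom j y ->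
    sheet_val i x = sheet_val j x -> sheet_val i y = sheet_val j y;
  sheets_open : forall i x, sheet_dom i x ->
    exists2 r : R, 0 < r & forall y, modulus (y - x) < r -> sheet_dom i y;
  sheets_cover : forall x, ~ Om x -> exists2 r : R, 0 < r &
    forall y, modulus (y - x) < r -> ~ Om y /\ forall e, sheet_regular e ->
      exists2 i, sheet_val i y = e & forall w, modulus (w - x) < r -> sheet_dom i w;
  sheets_regular : forall i x, sheet_dom i x -> ~ Om x -> sheet_regular (sheet_val i x);
  sheets_dom0 : sheet_dom sheet_chart0 0;
  sheets_val0 : sheet_val sheet_chart0 0 = sheet_state0
}.

Definition continuous01 (g : R -> C) : Prop :=
  forall t, 0 <= t <= 1 -> forall e, 0 < e -> exists2 d : R, 0 < d &
    forall s, 0 <= s <= 1 -> `|s - t| < d -> modulus (g s - g t) < e.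

Variables (Om : set C) (S : sheets Om).
Hypothesis Om0 : Om 0.

Definition path_lift (g : R -> C) (a b : R) (L : R -> sheet_state S) : Prop :=
  forall t, a <= t -> t <= b -> exists i : sheet_chart S, exists2 e : R, 0 < e &
    forall s, a <= s -> s <= b -> `|s - t| < e -> sheet_dom i (g s) /\ L s = sheet_val i (g s).

(** Charts that agree at one time of a common stretch agree along it, so the set
    of times where the lifts agree propagates. *)
Lemma lift_uniq g a b L L' : a <= b -> path_lift g a b L -> path_lift g a b L' ->
  L a = L' a -> L b = L' b.
Proof.
move=> ab Ll Ll'.
apply: (@interval_gluing _ a b (fun x y => L x = L' x -> L y = L' y)) => //.
  by move=> x y z _ _ _ _ H1 H2 /H1.
move=> t at_ tb; have [i [e e0 H]] := Ll t at_ tb.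
have [j [e' e'0 H']] := Ll' t at_ tb.
exists (Num.min e e'); first by rewrite lt_min e0.
move=> x y ax xt ty yb tx yt.
have near s : a <= s -> s <= b -> `|s - t| < Num.min e e' ->
    [/\ sheet_dom i (g s), sheet_dom j (g s), L s = sheet_val i (g s) & L' s = sheet_val j (g s)].
  by move=> as_ sb; rewrite lt_min => /andP[/(H s as_ sb)[? ?] /(H' s as_ sb)[? ?]].
have [|||dix djx -> ->] := near x => //; first exact: le_trans tb.
  by rewrite distrC ger0_norm ?subr_ge0.
have [|||diy djy -> ->] := near y => //; first exact: le_trans ty.
  by rewrite ger0_norm ?subr_ge0.
exact: sheets_agree.
Qed.

Lemma lift_sub g a b c d L : a <= c -> d <= b -> path_lift g a b L -> path_lift g c d L.
Proof.
move=> ac db Ll t ct td; have [|//|i [e e0 H]] := Ll t; rewrite ?(le_trans _ ct) ?(le_trans td) //.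
exists i, e => // s cs sd; apply: H; [exact: le_trans cs|exact: le_trans db].
Qed.

Lemma lift_eq g g' a b L : (forall t, a <= t -> t <= b -> g t = g' t) ->
  path_lift g a b L -> path_lift g' a b L.
Proof.
move=> gg Ll t at_ tb; have [i [e e0 H]] := Ll t at_ tb.
by exists i, e => // s as_ sb; rewrite -gg //; exact: H.
Qed.

Lemma lift_affine g a b (k l : R) L : 0 < k ->
  path_lift g (k * a + l) (k * b + l) L ->
  path_lift (fun t => g (k * t + l)) a b (fun t => L (k * t + l)).
Proof.
move=> k0 Ll t at_ tb; have [||i [e e0 H]] := Ll (k * t + l); rewrite ?lerD2r ?ler_pM2l //.
exists i, (e / k); rewrite ?divr_gt0 // => s as_ sb st.
apply: H; rewrite ?lerD2r ?ler_pM2l //.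
rewrite opprD addrACA subrr addr0 -mulrBr normrM gtr0_norm // mulrC.
by rewrite -ltr_pdivlMr.
Qed.

Lemma lift_chart g a b i : (forall t, a <= t -> t <= b -> sheet_dom i (g t)) ->
  path_lift g a b (fun t => sheet_val (s := S) i (g t)).
Proof. by move=> H t _ _; exists i, 1 => // s as_ sb _; split=> //; apply: H. Qed.

Lemma lift_glue g a b c L L' : 0 <= a -> a <= b -> b <= c -> c <= 1 -> continuous01 g ->
  path_lift g a b L -> path_lift g b c L' -> L b = L' b ->
  path_lift g a c (fun t => if t <= b then L t else L' t).
Proof.
move=> a0 ab bc c1 cg Ll Ll' LL' t at_ tc.
have [tb|tb|tb] := ltgtP t b.
- have [i [e e0 H]] := Ll t at_ (ltW tb).
  exists i, (Num.min e (b - t)); first by rewrite lt_min e0 subr_gt0.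
  move=> s as_ sc; rewrite lt_min => /andP[se sb].
  have {}sb : s <= b by have := ler_norm (s - t); lra.
  by rewrite sb; exact: H.
- have [i [e e0 H]] := Ll' t (ltW tb) tc.
  exists i, (Num.min e (t - b)); first by rewrite lt_min e0 subr_gt0.
  move=> s as_ sc; rewrite lt_min => /andP[se sb].
  have {}sb : b < s by have := ler_norm (t - s); rewrite distrC; lra.
  by rewrite leNgt sb /=; apply: H => //; exact: ltW.
have [i [e e0 H]] := Ll b ab (lexx b); have [j [e' e'0 H']] := Ll' b (lexx b) bc.
have [dib Lb] : sheet_dom i (g b) /\ L b = sheet_val i (g b) by apply: H; rewrite // subrr normr0.
have [djb L'b] : sheet_dom j (g b) /\ L' b = sheet_val j (g b) by apply: H'; rewrite // subrr normr0.
have [r r0 Hr] := sheets_open dib.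
have b01 : 0 <= b <= 1 by apply/andP; split; lra.
have [d d0 Hd] := cg b b01 r r0.
exists i, (Num.min e (Num.min e' d)); first by rewrite !lt_min e0 e'0.
move=> s as_ sc; rewrite tb !lt_min => /and3P[se se' sd].
have [sb|sb] := leP s b; first exact: H.
have [djs L's] := H' s (ltW sb) sc se'.
have dis : sheet_dom i (g s) by apply/Hr/Hd => //; apply/andP; split; lra.
split=> //; rewrite L's; apply: (sheets_agree djb dib djs dis).
by rewrite -Lb -L'b.
Qed.

Definition eventually_off (g : R -> C) : Prop :=
  forall t, 0 <= t <= 1 -> Om (g t) -> forall s, 0 <= s <= t -> g s = 0.

(** While the path rests at the origin it stays in the chart of the first sheet;
    afterwards evenly covered neighbourhoods prolong any lift. *)
Lemma lift_exists g : continuous01 g -> g 0 = 0 -> eventually_off g ->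
  exists2 L, path_lift g 0 1 L & L 0 = sheet_state0 S.
Proof.
move=> cg g0 adm.
have gOm t : 0 <= t <= 1 -> Om (g t) -> g t = 0.
  by move=> /andP[t0 t1] /adm; apply; rewrite ?t0 ?t1 ?lexx.
pose ok t (e : sheet_state S) := (Om (g t) -> e = sheet_state0 S) /\ (~ Om (g t) -> sheet_regular e).
pose Q x y := forall e, ok x e -> exists L, [/\ path_lift g x y L, L x = e & ok y (L y)].
suff : Q 0 1.
  move=> /(_ (sheet_state0 S))[|L [Ll L0 _]]; last by exists L.
  by split=> //; rewrite g0.
have ok_val i t : sheet_dom i (g t) -> (Om (g t) -> sheet_val (s := S) i (g t) = sheet_state0 S) ->
    ok t (sheet_val i (g t)).
  by move=> di H; split=> // nO; exact: sheets_regular.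
apply: (@interval_gluing _ 0 1 Q) => //.
  move=> x y z x0 xy yz z1 H1 H2 e /H1[L [Ll Lx]] /H2[L' [Ll' L'y okz]].
  exists (fun t => if t <= y then L t else L' t); split; rewrite ?xy //.
    by apply: (@lift_glue g x y z).
  case: leP => // zy; have zE : z = y by apply/eqP; rewrite eq_le yz zy.
  by rewrite zE -L'y -zE.
move=> t t0 t1; have t01 : 0 <= t <= 1 by rewrite t0.
have [Ot|nOt] := pselect (Om (g t)).
  (* the path is still resting at the origin at time t *)
  have gt := gOm t t01 Ot.
  have dt : sheet_dom (sheet_chart0 S) (g t) by rewrite gt; exact: sheets_dom0.
  have [r r0 Hr] := sheets_open dt.
  have [d d0 Hd] := cg t t01 r r0.
  exists d => // x y x0 xt ty y1 tx yt e [oke _].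
  have gx : g x = 0 by apply: (adm t) => //; rewrite x0.
  have dy s : x <= s -> s <= y -> sheet_dom (sheet_chart0 S) (g s).
    move=> xs sy; apply/Hr/Hd; first by apply/andP; split; lra.
    by rewrite ltr_norml; apply/andP; split; lra.
  exists (fun s => sheet_val (sheet_chart0 S) (g s)); split.
  - exact: lift_chart.
  - by rewrite gx sheets_val0 oke // gx.
  - apply: ok_val; first by apply: dy; lra.
    by move=> Oy; rewrite gOm ?sheets_val0 //; apply/andP; split; lra.
have [r r0 Hr] := sheets_cover S nOt.
have [d d0 Hd] := cg t t01 r r0.
exists d => // x y x0 xt ty y1 tx yt e [_ oke].
have near s : x <= s -> s <= y -> modulus (g s - g t) < r.
  move=> xs sy; apply: Hd; first by apply/andP; split; lra.
  by rewrite ltr_norml; apply/andP; split; lra.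
have [xr yr] : modulus (g x - g t) < r /\ modulus (g y - g t) < r.
  by split; apply: near; lra.
have [nOx /(_ e (oke nOx))[i ie di]] := Hr _ xr.
exists (fun s => sheet_val i (g s)); split=> //.
  by apply: lift_chart => s xs sy; apply/di/near.
apply: ok_val; first exact: di.
by have [] := Hr _ yr.
Qed.

(** The charts followed by one lift are followed by the lifts of all sufficiently
    close paths, so that the end of the lift is locally constant along H. *)
Lemma lift_homotopy (H : R -> R -> C) (L : R -> R -> sheet_state S) :
  (forall s t, 0 <= s <= 1 -> 0 <= t <= 1 -> forall e, 0 < e -> exists2 d : R, 0 < d &
     forall s' t', 0 <= s' <= 1 -> 0 <= t' <= 1 -> `|s' - s| < d -> `|t' - t| < d ->
       modulus (H s' t' - H s t) < e) ->
  (forall s, 0 <= s <= 1 -> H s 0 = 0) ->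
  (forall s, 0 <= s <= 1 -> H s 1 = H 0 1) ->
  (forall s, 0 <= s <= 1 -> path_lift (H s) 0 1 (L s)) ->
  (forall s, 0 <= s <= 1 -> L s 0 = sheet_state0 S) ->
  L 0 1 = L 1 1.
Proof.
move=> cH H0 H1 LH L0.
apply: (@interval_gluing _ 0 1 (fun x y => L x 1 = L y 1) ler01).
  by move=> x y z _ _ _ _ -> ->.
move=> u u0 u1; have u01 : 0 <= u <= 1 by rewrite u0.
suff [e e0 He] : exists2 e : R, 0 < e & forall s, 0 <= s <= 1 -> `|s - u| < e ->
    L s 1 = L u 1.
  exists e => // x y x0 xu uy y1 ux yu; rewrite !He //.
  - by apply/andP; split; lra.
  - by rewrite ger0_norm ?subr_ge0.
  - by apply/andP; split; lra.
  - by rewrite distrC ger0_norm ?subr_ge0.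
pose compat s t := exists i, [/\ sheet_dom i (H u t), sheet_dom i (H s t),
  L u t = sheet_val (s := S) i (H u t) & L s t = sheet_val i (H s t)].
pose P x y := exists2 e : R, 0 < e & forall s, 0 <= s <= 1 -> `|s - u| < e ->
  compat s x -> compat s y.
have [e e0 He] : P 0 1.
  apply: (@interval_gluing _ 0 1 P ler01).
    move=> x y z _ _ _ _ [e e0 He] [e' e'0 He'].
    exists (Num.min e e'); first by rewrite lt_min e0.
    by move=> s s01; rewrite lt_min => /andP[se se'] /(He s s01 se) /(He' s s01 se').
  move=> t t0 t1; have t01 : 0 <= t <= 1 by rewrite t0.
  have [i [e e0 He]] := LH u u01 t t0 t1.
  have [dit _] : sheet_dom i (H u t) /\ L u t = sheet_val i (H u t) by apply: He; rewrite // subrr normr0.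
  have [r r0 Hr] := sheets_open dit.
  have [d d0 Hd] := cH u t u01 t01 r r0.
  exists (Num.min e d); first by rewrite lt_min e0.
  move=> x y x0 xt ty y1; rewrite !lt_min => /andP[txe txd] /andP[yte ytd].
  exists d => // s s01 su [j [djux djsx Lux Lsx]].
  have near v w : 0 <= v <= 1 -> `|v - u| < d -> x <= w -> w <= y -> sheet_dom i (H v w).
    move=> v01 vu xw wy; apply/Hr/Hd => //; first by apply/andP; split; lra.
    by rewrite ltr_norml; apply/andP; split; lra.
  have uu : `|u - u| < d by rewrite subrr normr0.
  have Lu w : x <= w -> w <= y -> L u w = sheet_val i (H u w).
    move=> xw wy; have w0 : 0 <= w by lra.
    have w1 : w <= 1 by lra.
    have wt : `|w - t| < e by rewrite ltr_norml; apply/andP; split; lra.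
    exact: (He w w0 w1 wt).2.
  have xy : x <= y by lra.
  exists i; split; [exact: near|exact: near|exact: Lu|].
  apply: (@lift_uniq (H s) x y (L s) (fun w => sheet_val i (H s w))) => //.
  - by apply: lift_sub (LH s s01).
  - by apply: lift_chart => w xw wy; exact: near.
  - rewrite Lsx; apply: (@sheets_agree _ S j i (H u x)) => //; try exact: near.
    by rewrite -Lux Lu.
exists e => // s s01 su.
have [|i [_ _ -> ->]] := He s s01 su; last by rewrite !H1.
exists (sheet_chart0 S); rewrite !H0 // !L0 // sheets_val0.
by split => //; exact: sheets_dom0.
Qed.

End Covering.

(** * Formal matrix series and the gauge equation *)

Section FormalSeries.
Variables (K : comPzRingType) (n : nat).
Local Notation V := 'M[K]_n.
Implicit Types f g h : nat -> V.

Definition convol f g : nat -> V := fun m => \sum_(i < m.+1) f i *m g (m - i)%N.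

Definition xshift f : nat -> V := fun m => if m is k.+1 then f k else 0.

Definition monomial (d : nat) : nat -> V := fun m => (m == d)%:R *: 1%:M.

Lemma conv0 f g : convol f g 0 = f 0%N *m g 0%N.
Proof. by rewrite /convol big_ord_recl big_ord0 addr0. Qed.

Lemma convS f g m :
  convol f g m.+1 = f 0%N *m g m.+1 + convol (fun k => f k.+1) g m.
Proof.
by rewrite /convol big_ord_recl subn0; congr (_ + _).
Qed.

Lemma eq_conv f f' g g' m : (forall k, (k <= m)%N -> f k = f' k) ->
  (forall k, (k <= m)%N -> g k = g' k) -> convol f g m = convol f' g' m.
Proof.
move=> ff gg; apply: eq_bigr => i _.
by rewrite ff -1?ltnS // gg // leq_subr.
Qed.

Lemma convDl f f' g m : convol (fun k => f k + f' k) g m = convol f g m + convol f' g m.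
Proof. by rewrite -big_split /=; apply: eq_bigr => i _; rewrite mulmxDl. Qed.

Lemma convDr f g g' m : convol f (fun k => g k + g' k) m = convol f g m + convol f g' m.
Proof. by rewrite -big_split /=; apply: eq_bigr => i _; rewrite mulmxDr. Qed.

Lemma convNl f g m : convol (fun k => - f k) g m = - convol f g m.
Proof. by rewrite -sumrN; apply: eq_bigr => i _; rewrite mulNmx. Qed.

Lemma convZl c f g m : convol (fun k => c *: f k) g m = c *: convol f g m.
Proof. by rewrite /convol scaler_sumr; apply: eq_bigr => i _; rewrite scalemxAl. Qed.

Lemma conv_mulmxl X f g m : convol (fun k => X *m f k) g m = X *m convol f g m.
Proof. by rewrite /convol mulmx_sumr; apply: eq_bigr => i _; rewrite mulmxA. Qed.

Lemma conv_mulmxr X f g m : convol f (fun k => g k *m X) m = convol f g m *m X.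
Proof. by rewrite /convol mulmx_suml; apply: eq_bigr => i _; rewrite mulmxA. Qed.

Lemma conv_shiftl f g m : convol (xshift f) g m = xshift (convol f g) m.
Proof. by case: m => [|m]; rewrite ?conv0 ?convS /= mul0mx ?add0r. Qed.

Lemma conv_shiftr f g m : convol f (xshift g) m = xshift (convol f g) m.
Proof.
case: m => [|m]; first by rewrite conv0 mulmx0.
rewrite /= /convol big_ord_recr /= subnn mulmx0 addr0.
by apply: eq_bigr => i _; rewrite subSn // -ltnS.
Qed.

Lemma eq_shift f g m : (forall k, (k < m)%N -> f k = g k) -> xshift f m = xshift g m.
Proof. by case: m => //= m; apply. Qed.

Lemma shiftD f g m : xshift (fun k => f k + g k) m = xshift f m + xshift g m.
Proof. by case: m => //=; rewrite addr0. Qed.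

Lemma shiftN f m : xshift (fun k => - f k) m = - xshift f m.
Proof. by case: m => //=; rewrite oppr0. Qed.

Lemma conv_euler f g m :
  convol (fun k => k%:R *: f k) g m + convol f (fun k => k%:R *: g k) m = m%:R *: convol f g m.
Proof.
rewrite -big_split /= /convol scaler_sumr; apply: eq_bigr => i _.
by rewrite -scalemxAl -scalemxAr -scalerDl -natrD subnKC // -ltnS.
Qed.

Lemma convA f g h m : convol (convol f g) h m = convol f (convol g h) m.
Proof.
elim: m f g => [|m IH] f g; first by rewrite !conv0 mulmxA.
rewrite [RHS]convS convS conv0 -mulmxA convS -IH mulmxDr -addrA; congr (_ + _).
rewrite -conv_mulmxl -convDl; apply: eq_conv => // k _.
by rewrite convS.
Qed.

Lemma iter_shift_ge d f m : iter d xshift f (m + d)%N = f m.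
Proof. by elim: d => [|d IH]; rewrite ?addn0 // addnS /= IH. Qed.

Lemma iter_shift_lt d f m : (m < d)%N -> iter d xshift f m = 0.
Proof. by elim: d m => // d IH [|m] //=; rewrite ltnS; exact: IH. Qed.

Lemma iter_shift_inv d f m : (forall k, (k < d)%N -> f k = 0) ->
  f m = iter d xshift (fun k => f (k + d)%N) m.
Proof.
move=> f0; have [md|dm] := ltnP m d; first by rewrite f0 // iter_shift_lt.
by rewrite -(subnK dm) iter_shift_ge.
Qed.

Lemma conv_iter_shiftl d f g m : convol (iter d xshift f) g m = iter d xshift (convol f g) m.
Proof.
elim: d m => // d IH m /=; rewrite conv_shiftl.
by apply: eq_shift => k _; exact: IH.
Qed.

Lemma conv_iter_shiftr d f g m : convol f (iter d xshift g) m = iter d xshift (convol f g) m.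
Proof.
elim: d m => // d IH m /=; rewrite conv_shiftr.
by apply: eq_shift => k _; exact: IH.
Qed.

Lemma monomialS d m : monomial d.+1 m = xshift (monomial d) m.
Proof. by case: m => [|m]; rewrite /monomial //= scale0r. Qed.

Lemma conv_monomiall d f m : convol (monomial d) f m = iter d xshift f m.
Proof.
elim: d m => [|d IH] m.
  case: m => [|m]; rewrite ?conv0 ?convS /monomial eqxx scale1r mul1mx //.
  rewrite /convol big1 ?addr0 // => i _; by rewrite scale0r mul0mx.
rewrite (eq_conv (f' := xshift (monomial d)) (g' := f)) //; last by move=> k _; exact: monomialS.
by rewrite conv_shiftl /=; apply: eq_shift => k _; exact: IH.
Qed.

Lemma conv_monomialr d f m : convol f (monomial d) m = iter d xshift f m.
Proof.
elim: d m => [|d IH] m.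
  rewrite /convol big_ord_recr /= subnn /monomial eqxx scale1r mulmx1 big1 ?add0r // => i _.
  by rewrite subn_eq0 leqNgt ltn_ord scale0r mulmx0.
rewrite (eq_conv (f' := f) (g' := xshift (monomial d))) //; last by move=> k _; exact: monomialS.
by rewrite conv_shiftr /=; apply: eq_shift => k _; exact: IH.
Qed.

End FormalSeries.

Arguments xshift {K n} f m.

(** The formal gauge equation x^2 F' + F (D + x L) = A F with D diagonal, for a
    matrix F of power series with a Laurent inverse x^(-d) G. *)
Record formal_gauge (K : comPzRingType) n (A F G : nat -> 'M[K]_n) (a : 'I_n -> K)
    (L : 'M[K]_n) (d : nat) : Prop := FormalGauge {
  gauge_eq : forall m, convol A F m =
    F m *m diag_mx (\row_j a j) + xshift (fun k => k%:R *: F k + F k *m L) m;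
  gauge_FG : forall m, convol F G m = monomial K n d m;
  gauge_GF : forall m, convol G F m = monomial K n d m
}.

Section GaugeAlgebra.
Variables (K : comPzRingType) (n : nat) (A F G : nat -> 'M[K]_n) (a : 'I_n -> K).
Variables (L : 'M[K]_n) (d : nat).
Hypothesis gau : formal_gauge A F G a L d.
Local Notation V := 'M[K]_n.
Local Notation D := (diag_mx (\row_j a j)).

Lemma conv_gauge (T : nat -> V) m :
  convol (convol T A) F m = convol T F m *m D +
    xshift (fun k => convol T (fun k => k%:R *: F k) k + convol T F k *m L) m.
Proof.
rewrite convA (eq_conv (f' := T) (g' := fun m => F m *m D +
  xshift (fun k => k%:R *: F k + F k *m L) m)) //; last by move=> k _; rewrite (gauge_eq gau).
rewrite convDr conv_mulmxr conv_shiftr; congr (_ + _); apply: eq_shift => k _.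
by rewrite convDr conv_mulmxr.
Qed.

Definition dual_defect (T : nat -> V) (m : nat) : V :=
  convol T A m - D *m T m - xshift (fun k => d%:R *: T k - k%:R *: T k + L *m T k) m.

(** [dual_defect T] measures how far T is from satisfying the equation of
    x^d F^(-1); multiplied by F it gives the equation satisfied by T F. *)
Lemma conv_dual_defect (T : nat -> V) m (H := convol T F) :
  convol (dual_defect T) F m = H m *m D - D *m H m +
    xshift (fun k => k%:R *: H k + H k *m L - d%:R *: H k - L *m H k) m.
Proof.
rewrite /dual_defect convDl convNl convDl convNl conv_gauge conv_mulmxl conv_shiftl.
rewrite -/H -shiftN [X in X + _]addrAC -[LHS]addrA -shiftD; congr (_ + _).
apply: eq_shift => k _.
rewrite !convDl convNl convZl conv_mulmxl -/(H k) -conv_euler -/H.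
rewrite !opprD opprK !addrA.
by apply/matrixP => i j; rewrite !mxE; ring.
Qed.

(** Multiplication by G on the right undoes F up to the factor x^d. *)
Lemma gauge_cancel (U : nat -> V) : (forall m, convol U F m = 0) -> forall m, U m = 0.
Proof.
move=> UF m; rewrite -(iter_shift_ge d U m) -conv_monomialr.
rewrite -(eq_conv (f := U) (g := convol F G)) //; last by move=> k _; rewrite (gauge_FG gau).
by rewrite -convA; apply: big1 => i _; rewrite UF mul0mx.
Qed.

Lemma gauge_dual m : dual_defect G m = 0.
Proof.
move: m; apply: gauge_cancel => m; rewrite conv_dual_defect.
rewrite (eq_shift (g := fun=> 0)) => [|k _]; rewrite (gauge_GF gau) /monomial.
  by case: m => [|m]; rewrite /= -scalemxAl -scalemxAr mulmx1 mul1mx subrr addr0.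
case: eqP => [->|_]; last by rewrite scale0r mul0mx mulmx0 !scaler0 !subr0 addr0.
rewrite scale1r mul1mx mulmx1.
by rewrite [X in X - _]addrAC subrr add0r subrr.
Qed.

End GaugeAlgebra.

(** * Annihilation of the leading matrix *)

Section Annihilator.
Variables (K : comPzRingType) (n : nat) (A F G : nat -> 'M[K]_n) (a : 'I_n -> K).
Variables (L : 'M[K]_n) (d : nat).
Hypothesis gau : formal_gauge A F G a L d.
Local Notation V := 'M[K]_n.
Local Notation D := (diag_mx (\row_j a j)).

Definition connection_step (U : nat -> V) (c : K) : nat -> V :=
  fun m => convol U A m + xshift (fun k => k%:R *: U k) m - c *: U m.

Definition shifted_product (X : V) (cs : seq K) : V :=
  foldl (fun Y c => Y *m (X - c%:M)) 1%:M cs.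

Lemma conv_connection_step U c m (W := convol U F) :
  convol (connection_step U c) F m =
    W m *m D - c *: W m + xshift (fun k => k%:R *: W k + W k *m L) m.
Proof.
rewrite /connection_step !convDl convNl convZl (conv_gauge gau) conv_shiftl -/W.
rewrite [LHS]addrAC -!addrA; congr (_ + _); rewrite addrC addrAC -addrA; congr (_ + _).
rewrite -shiftD; apply: eq_shift => k _.
by rewrite /W -conv_euler; apply/matrixP => i j; rewrite !mxE; ring.
Qed.

Lemma foldl_connection_step0 cs U :
  foldl connection_step U cs 0 = foldl (fun Y c => Y *m (A 0%N - c%:M)) (U 0%N) cs.
Proof.
elim: cs U => //= c cs IH U; rewrite IH; congr foldl.
by rewrite /connection_step conv0 /= addr0 mulmxBr mul_mx_scalar.
Qed.

(** In the basis F, the lowest coefficient of a series is multiplied by a_j - c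
    in column j, so that a factor c = a_j kills this column and no later factor
    revives it. *)
Lemma foldl_connection_step_order cs U v (P : pred 'I_n) :
  (forall m, (m < v)%N -> convol U F m = 0) ->
  (forall i j, P j -> convol U F v i j = 0) ->
  let W := convol (foldl connection_step U cs) F in
  (forall m, (m < v)%N -> W m = 0) /\
  (forall i j, P j || (a j \in cs) -> W v i j = 0).
Proof.
elim: cs U P => [|c cs IH] U P U0 UP /=; first by split=> // i j; rewrite orbF; exact: UP.
have [||H1 H2] := IH (connection_step U c) (fun j => P j || (a j == c)).
- move=> m mv; rewrite conv_connection_step U0 // mul0mx scaler0 subrr add0r.
  case: m mv => //= m mv; by rewrite U0 ?(ltnW mv) // scaler0 mul0mx addr0.
- move=> i j Pj; rewrite conv_connection_step.
  have -> : xshift (fun k => k%:R *: convol U F k + convol U F k *m L) v = 0.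
    by case: v U0 {UP IH} => //= v U0; rewrite U0 // scaler0 mul0mx addr0.
  rewrite addr0 mul_mx_diag !mxE; case/orP: Pj => [/(UP i) ->|/eqP->].
    by rewrite mul0r mulr0 subrr.
  by rewrite mulrC subrr.
by split=> // i j; rewrite in_cons orbA => Pj; exact: H2.
Qed.

Definition exponents_repeated : seq K :=
  flatten (nseq d.+1 [seq a j | j <- enum 'I_n]).

(** Applying x^2 d/dx - a_j once for each j raises the order of vanishing in
    the basis F by one; after d + 1 rounds the identity is sent to a series
    divisible by x in the original basis, whose constant term is the product. *)
Lemma leading_annihilated : shifted_product (A 0%N) exponents_repeated = 0.
Proof.
pose U k := foldl connection_step (monomial K n 0) (flatten (nseq k [seq a j | j <- enum 'I_n])).
have ord k m : (m < k)%N -> convol (U k) F m = 0.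
  elim: k m => // k IH m; rewrite ltnS => mk.
  have -> : U k.+1 = foldl connection_step (U k) [seq a j | j <- enum 'I_n].
    by rewrite /U -{1}(addn1 k) nseqD flatten_cat foldl_cat /= cats0.
  have [||H1 H2] := @foldl_connection_step_order [seq a j | j <- enum 'I_n] (U k) k pred0.
  - exact: IH.
  - by [].
  move: mk; rewrite leq_eqVlt => /orP[/eqP->|]; last exact: H1.
  apply/matrixP => i j; rewrite mxE; apply: H2.
  by rewrite /= map_f // mem_enum.
have <- : U d.+1 0%N = shifted_product (A 0%N) exponents_repeated.
  by rewrite /U foldl_connection_step0 /monomial eqxx scale1r.
rewrite -(iter_shift_ge d (U d.+1) 0) add0n -conv_monomialr.
rewrite -(eq_conv (f := U d.+1) (g := convol F G)) //; last by move=> k _; rewrite (gauge_FG gau).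
by rewrite -convA; apply: big1 => i _; rewrite ord // mul0mx.
Qed.

Lemma exponents_repeatedP c : c \in exponents_repeated -> exists j, c = a j.
Proof.
move=> /flattenP[s]; rewrite mem_nseq => /andP[_ /eqP->] /mapP[j _ ->].
by exists j.
Qed.

End Annihilator.

(** * The resolvent of the leading part *)

Section Resolvent.
Variables (R : realType) (n : nat).
Local Notation C := (Cplx R).
Local Notation V := 'M[C]_n.

Lemma shifted_product_cons (X : V) c cs :
  shifted_product X (c :: cs) = (X - c%:M) *m shifted_product X cs.
Proof.
have H : forall s (Y : V), foldl (fun Z c => Z *m (X - c%:M)) Y s = Y *m shifted_product X s.
  rewrite /shifted_product; elim=> [|e s IH] Y /=; first by rewrite mulmx1.
  by rewrite IH [in RHS]IH mul1mx mulmxA.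
by rewrite /shifted_product /= mul1mx H.
Qed.

(** Newton form of the resolvent of [X], inverse to [t - X] when the product
    of the [X - c] vanishes. Unlike a formula through eigenvectors it shows the
    bound away from the points [c] at once. *)
Fixpoint newton_inverse (X : V) (cs : seq C) (t : C) : V :=
  if cs is c :: cs' then (t - c)^-1 *: (1%:M + (X - c%:M) *m newton_inverse X cs' t)
  else 0.

Lemma newton_inverse_comm X cs t : X *m newton_inverse X cs t = newton_inverse X cs t *m X.
Proof.
elim: cs => [|c cs IH] /=; first by rewrite mulmx0 mul0mx.
rewrite -scalemxAr -scalemxAl mulmxDr mulmxDl mulmx1 mul1mx; congr (_ *: (_ + _)).
by rewrite -[RHS]mulmxA -IH !mulmxA; congr (_ *m _); rewrite mulmxBr mulmxBl scalar_mxC.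
Qed.

(** The sum telescopes, since t - X = (t - c) - (X - c) at every step. *)
Lemma newton_inverseP X cs t : (forall c, c \in cs -> t != c) ->
  (t%:M - X) *m newton_inverse X cs t =
    1%:M - (\prod_(c <- cs) (t - c))^-1 *: shifted_product X cs.
Proof.
elim: cs => [|c cs IH] tc /=.
  by rewrite mulmx0 big_nil invr1 scale1r /shifted_product /= subrr.
have tc0 : t - c != 0 by rewrite subr_eq0; apply: tc; rewrite in_cons eqxx.
rewrite -scalemxAr mulmxDr mulmx1 mulmxA.
have -> : (t%:M - X) *m (X - c%:M) = (X - c%:M) *m (t%:M - X).
  rewrite !mulmxBr !mulmxBl (scalar_mxC t X) (scalar_mxC c X) (scalar_mxC t c%:M).
  by rewrite !opprB addrACA [RHS]addrACA; congr (_ + _); rewrite addrC.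
rewrite -mulmxA IH => [|e ecs]; last by apply: tc; rewrite in_cons ecs orbT.
rewrite mulmxBr mulmx1 -scalemxAr -shifted_product_cons big_cons invfM.
rewrite -scalerA -[X in _ = X - _](scalerK tc0) [_ *: 1%:M]scalemx1 -scalerBr.
congr (_ *: _); rewrite addrA; congr (_ - _).
by rewrite addrA subrK raddfB.
Qed.

Lemma newton_inverse_bound X cs (e : R) : 0 < e -> exists2 B, 0 <= B &
  forall t, (forall c, c \in cs -> e <= modulus (t - c)) ->
    mnorm (newton_inverse X cs t) <= B.
Proof.
move=> e0; elim: cs => [|c cs [B B0 IH]] /=; first by exists 0 => // t _; rewrite mnorm0.
exists (e^-1 * (mnorm (1%:M : V) + mnorm (X - c%:M) * B)).
  by rewrite mulr_ge0 ?invr_ge0 ?(ltW e0) // addr_ge0 ?mulr_ge0 ?mnorm_ge0.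
move=> t tc; rewrite mnormZ modulusV.
have {}IH := IH t (fun c' h => tc c' (mem_behead (s := c :: cs) h)).
apply: ler_pM; rewrite ?invr_ge0 ?modulus_ge0 ?mnorm_ge0 //.
  by rewrite lef_pV2 ?posrE // ?(lt_le_trans e0) // tc // in_cons eqxx.
apply: le_trans (mnormD _ _) _; rewrite lerD2l.
by apply: le_trans (mnormM _ _) _; rewrite ler_wpM2l ?mnorm_ge0.
Qed.

Variables (A0 : V) (a : 'I_n -> C) (cs : seq C).
Hypothesis annih : shifted_product A0 cs = 0.
Hypothesis csP : forall c, c \in cs -> exists j, c = a j.

(** Its eigenvalues are differences of the a_j, which is how Omega arises. *)
Definition leading_op (X : V) : V := A0 *m X - X *m diag_mx (\row_j a j).

(** As D is diagonal, the operator acts on column j as A_0 - a_j. *)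
Definition resolvent (xi : C) (X : V) : V :=
  \matrix_(i, j) (newton_inverse A0 cs (xi + a j) *m X) i j.

Lemma leading_op_col X j : col j (leading_op X) = (A0 - (a j)%:M) *m col j X.
Proof.
rewrite /leading_op mulmxBl raddfB /=; congr (_ - _); first by rewrite !colE mulmxA.
by apply/matrixP => i k; rewrite mul_scalar_mx mxE mul_mx_diag !mxE mulrC.
Qed.

Lemma resolvent_col xi X j :
  col j (resolvent xi X) = newton_inverse A0 cs (xi + a j) *m col j X.
Proof. by apply/matrixP => i k; rewrite [col j X]colE mulmxA -colE !mxE. Qed.

Lemma newton_inverse_leading xi j : (forall z, (exists j k, z = a j - a k) -> xi != z) ->
  ((xi + a j)%:M - A0) *m newton_inverse A0 cs (xi + a j) = 1%:M.
Proof.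
move=> xiO; rewrite newton_inverseP ?annih ?scaler0 ?subr0 // => c /csP[k ->].
have : xi != a k - a j by apply: xiO; exists k, j.
by apply: contra => /eqP <-; rewrite addrK.
Qed.

Lemma resolvent_right xi X : (forall z, (exists j k, z = a j - a k) -> xi != z) ->
  xi *: resolvent xi X - leading_op (resolvent xi X) = X.
Proof.
move=> xiO; apply/matrixP => i j.
have : col j (xi *: resolvent xi X - leading_op (resolvent xi X)) = col j X.
  rewrite raddfB /= leading_op_col linearZ /= resolvent_col -mul_scalar_mx -mulmxBl.
  rewrite opprB addrA -raddfD /= mulmxA.
  by rewrite newton_inverse_leading // mul1mx.
by move=> /matrixP/(_ i 0); rewrite !mxE.
Qed.

Lemma resolvent_left xi X : (forall z, (exists j k, z = a j - a k) -> xi != z) ->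
  resolvent xi (xi *: X - leading_op X) = X.
Proof.
move=> xiO; apply/matrixP => i j.
have : col j (resolvent xi (xi *: X - leading_op X)) = col j X.
  rewrite resolvent_col raddfB /= leading_op_col linearZ /= -mul_scalar_mx -mulmxBl.
  rewrite opprB addrA -raddfD /= mulmxA.
  rewrite mulmxBr scalar_mxC -newton_inverse_comm -mulmxBl.
  by rewrite newton_inverse_leading // mul1mx.
by move=> /matrixP/(_ i 0); rewrite !mxE.
Qed.

Lemma resolvent_bound (e : R) : 0 < e -> exists2 B, 0 <= B &
  forall xi, (forall z, (exists j k, z = a j - a k) -> e <= modulus (xi - z)) ->
    forall X, mnorm (resolvent xi X) <= B * mnorm X.
Proof.
move=> e0; have [B B0 H] := newton_inverse_bound A0 cs e0.
exists (B * n%:R); first by rewrite mulr_ge0.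
move=> xi xiO X.
have Hj j : mnorm (newton_inverse A0 cs (xi + a j) *m X) <= B * mnorm X.
  apply: le_trans (mnormM _ _) _; rewrite ler_wpM2r ?mnorm_ge0 // H // => c /csP[k ->].
  have -> : xi + a j - a k = xi - (a k - a j) by ring.
  by apply: xiO; exists k, j.
apply: (@le_trans _ _ (\sum_(j < n) mnorm (newton_inverse A0 cs (xi + a j) *m X))).
  rewrite /mnorm exchange_big /= ler_sum // => j _; apply: ler_sum => i _.
  rewrite (bigD1 j) //= mxE lerDl sumr_ge0 // => k _; exact: modulus_ge0.
apply: le_trans (ler_sum _ (fun j _ => Hj j)) _.
by rewrite sumr_const card_ord [leRHS]mulrAC mulr_natr.
Qed.

End Resolvent.

(** * Gevrey estimate for the formal solution *)

Section GevreyBound.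
Variable R : realType.

(** The shape in which a convolution with a geometrically bounded series without
    constant term enters the estimates. *)
Definition tail_sum (rho : R) (u : nat -> R) (m : nat) : R :=
  \sum_(j < m) rho ^+ (m - j) * u j.

Lemma tail_sumS rho u m : tail_sum rho u m.+1 = rho * (tail_sum rho u m + u m).
Proof.
rewrite /tail_sum big_ord_recr /= subSnn expr1 mulrDr; congr (_ + _).
rewrite mulr_sumr; apply: eq_bigr => i _.
by rewrite subSn 1?ltnW // exprS mulrA.
Qed.

Lemma tail_sum_le rho u v m : 0 <= rho -> (forall j, (j < m)%N -> u j <= v j) ->
  tail_sum rho u m <= tail_sum rho v m.
Proof. by move=> r0 uv; apply: ler_sum => i _; rewrite ler_wpM2l ?exprn_ge0 // uv. Qed.

Lemma tail_sum_ge0 rho u m : 0 <= rho -> (forall j, 0 <= u j) -> 0 <= tail_sum rho u m.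
Proof. by move=> r0 u0; apply: sumr_ge0 => i _; rewrite mulr_ge0 ?exprn_ge0. Qed.

(** As m j! <= m! for j < m, the factor m is absorbed by the factorial, and the
    geometric sum by a ratio K that is large against rho. *)
Lemma gevrey_recursion (u : nat -> R) (rho c : R) (m0 : nat) :
  1 <= rho -> 0 <= c -> (forall m, 0 <= u m) ->
  (forall m, (m0 <= m)%N -> u m <= c * m%:R * tail_sum rho u m) ->
  exists B K : R, [/\ 0 <= B, 1 <= K & forall m, u m <= B * K ^+ m * (m`!)%:R].
Proof.
move=> rho1 c0 u0 rec; have rho0 : 0 <= rho by rewrite (le_trans ler01).
pose K := rho * (1 + c); pose B := \sum_(j < m0) u j.
have K1 : 1 <= K by rewrite -[leLHS]mulr1 ler_pM // lerDl.
have K0 : 0 <= K by rewrite (le_trans ler01).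
have B0 : 0 <= B by rewrite sumr_ge0.
exists B, K; split=> // m; elim/ltn_ind: m => m IH.
have [m0m|mm0] := leqP m0 m; last first.
  apply: (@le_trans _ _ B); first by rewrite /B (bigD1 (Ordinal mm0)) //= lerDl sumr_ge0.
  rewrite -mulrA ler_peMr // mulr_ege1 ?exprn_ege1 //.
  by rewrite ler1n fact_gt0.
apply: le_trans (rec m m0m) _.
have geo k : c * tail_sum rho (fun j => K ^+ j) k <= K ^+ k.
  elim: k => [|k IHk]; first by rewrite /tail_sum big_ord0 mulr0 ler01.
  rewrite tail_sumS mulrCA exprS /K -mulrA ler_wpM2l // -/K mulrDr mulrDl mul1r.
  by rewrite lerD2r.
case: m m0m IH => [|m] m0m IH; first by rewrite mulr0 mul0r mulr_ge0 // mulr_ge0.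
apply: (@le_trans _ _ (c * m.+1%:R * tail_sum rho (fun j => B * K ^+ j * (m`!)%:R) m.+1)).
  rewrite ler_wpM2l ?mulr_ge0 // tail_sum_le // => j jm.
  apply: le_trans (IH j jm) _; rewrite ler_wpM2l ?mulr_ge0 ?exprn_ge0 //.
  by rewrite ler_nat leq_fact // -ltnS.
have -> : tail_sum rho (fun j => B * K ^+ j * (m`!)%:R) m.+1 =
   B * (m`!)%:R * tail_sum rho (fun j => K ^+ j) m.+1.
  by rewrite /tail_sum mulr_sumr; apply: eq_bigr => i _; ring.
rewrite factS natrM.
have -> : c * m.+1%:R * (B * m`!%:R * tail_sum rho (fun j => K ^+ j) m.+1) =
  B * (m.+1%:R * m`!%:R) * (c * tail_sum rho (fun j => K ^+ j) m.+1) by ring.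
by rewrite [leRHS]mulrAC ler_wpM2l // mulr_ge0 // mulr_ge0.
Qed.

Lemma bin_le_exp2 m k : ('C(m, k) <= 2 ^ m)%N.
Proof.
elim: m k => [|m IH] [|k] //; first by rewrite bin0 expn_gt0.
by rewrite binS expnS mul2n -addnn leq_add.
Qed.

Lemma gevrey_shift (u : nat -> R) (e : nat) (B K : R) : 0 <= B -> 1 <= K ->
  (forall m, u m <= B * K ^+ m * (m`!)%:R) ->
  exists B' K' : R, [/\ 0 <= B', 1 <= K' &
    forall m, u (m + e)%N <= B' * K' ^+ m * (m`!)%:R].
Proof.
move=> B0 K1 H; have K0 : 0 <= K by rewrite (le_trans ler01).
exists (B * (2 * K) ^+ e * (e`!)%:R), (2 * K); split.
- by rewrite !mulr_ge0 // exprn_ge0 // mulr_ge0.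
- by rewrite mulr_ege1 // ler1n.
move=> m; apply: le_trans (H _) _.
have -> : B * (2 * K) ^+ e * (e`!)%:R * (2 * K) ^+ m * (m`!)%:R =
   B * K ^+ (m + e) * (2 ^+ (m + e) * ((e`!)%:R * (m`!)%:R)).
  by rewrite !exprMn !exprD; ring.
rewrite ler_wpM2l ?mulr_ge0 ?exprn_ge0 // -natrM -natrX -natrM ler_nat.
have := bin_fact (leq_addl m e); rewrite addnK => <-.
by rewrite leq_mul2r bin_le_exp2 orbT.
Qed.

Lemma conv_bound n (f g : nat -> 'M[Cplx R]_n) (B rho : R) e m : 0 <= B -> 0 <= rho ->
  (forall k, (k < e)%N -> f k = 0) -> (forall k, mnorm (f k) <= B * rho ^+ k) ->
  mnorm (convol f g m) <= B * \sum_(j < m.+1 - e) rho ^+ (m - j) * mnorm (g j).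
Proof.
move=> B0 r0 f0 fB.
have bnd k : mnorm (f k *m g (m - k)%N) <= B * rho ^+ k * mnorm (g (m - k)%N).
  by apply: le_trans (mnormM _ _) _; rewrite ler_wpM2r ?mnorm_ge0.
have [em|me] := leqP e m.+1; last first.
  rewrite /convol big1 ?mnorm0 => [|i _]; last by rewrite f0 ?mul0mx // (ltn_trans _ me).
  by rewrite mulr_ge0 // sumr_ge0 // => j _; rewrite mulr_ge0 ?exprn_ge0 ?mnorm_ge0.
rewrite /convol -(big_mkord xpredT (fun i => f i *m g (m - i)%N)) (@big_cat_nat _ _ _ e) //=.
rewrite big_nat_cond big1 ?add0r => [|i /andP[/andP[_ ie] _]]; last by rewrite f0 // mul0mx.
apply: le_trans (mnorm_sum _ _ _) _; rewrite mulr_sumr.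
rewrite -{1}(add0n e) big_addn big_mkord.
rewrite (reindex_inj rev_ord_inj) /=; apply: ler_sum => j _.
apply: le_trans (bnd _) _; rewrite mulrA.
have jm := ltn_ord j.
have -> : ((m.+1 - e) - j.+1 + e = m - j)%N by lia.
by rewrite subKn //; lia.
Qed.

End GevreyBound.

Section GevreySolution.
Variables (R : realType) (n : nat).
Local Notation C := (Cplx R).
Local Notation V := 'M[C]_n.
Variables (A F G : nat -> V) (a : 'I_n -> C) (L : V) (d : nat).
Hypothesis gau : formal_gauge A F G a L d.
Variables (CA rho : R).
Hypothesis CA0 : 0 <= CA.
Hypothesis rho1 : 1 <= rho.
Hypothesis A_bound : forall k, mnorm (A k) <= CA * rho ^+ k.
Hypothesis L_block : forall i l, L i l != 0 -> a i = a l.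

Definition geo_bounded (f : nat -> V) : Prop :=
  exists2 B : R, 0 <= B & forall k, mnorm (f k) <= B * rho ^+ k.

Lemma rho_ge0 : 0 <= rho. Proof. exact: le_trans rho1. Qed.

Lemma geometric_finite f N : (forall k, (N <= k)%N -> f k = 0) -> geo_bounded f.
Proof.
move=> f0; exists (\sum_(i < N) mnorm (f i)).
  by rewrite sumr_ge0 // => i _; exact: mnorm_ge0.
move=> k; have [Nk|kN] := leqP N k.
  rewrite f0 // mnorm0 mulr_ge0 ?exprn_ge0 ?rho_ge0 //.
  by rewrite sumr_ge0 // => i _; exact: mnorm_ge0.
apply: (@le_trans _ _ (\sum_(i < N) mnorm (f i))).
  rewrite (bigD1 (Ordinal kN)) //= lerDl sumr_ge0 // => i _; exact: mnorm_ge0.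
rewrite ler_peMr ?exprn_ege1 //.
by rewrite sumr_ge0 // => i _; exact: mnorm_ge0.
Qed.

Lemma geometricD f g : geo_bounded f -> geo_bounded g -> geo_bounded (fun k => f k + g k).
Proof.
move=> [B B0 H] [B' B'0 H']; exists (B + B'); first by rewrite addr_ge0.
by move=> k; apply: le_trans (mnormD _ _) _; rewrite mulrDl lerD.
Qed.

Lemma geometric_shift_left f e : geo_bounded f -> geo_bounded (fun k => f (k + e)%N).
Proof.
move=> [B B0 H]; exists (B * rho ^+ e); first by rewrite mulr_ge0 ?exprn_ge0 ?rho_ge0.
by move=> k; rewrite -mulrA -exprD addnC.
Qed.

Lemma geometric_conv f N : (forall k, (N <= k)%N -> f k = 0) -> geo_bounded (convol f A).
Proof.
move=> f0; exists ((\sum_(i < N) mnorm (f i)) * CA).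
  by rewrite mulr_ge0 // sumr_ge0 // => i _; exact: mnorm_ge0.
move=> k; apply: le_trans (mnorm_sum _ _ _) _.
apply: (@le_trans _ _ (\sum_(i < k.+1) mnorm (f i) * (CA * rho ^+ k))).
  apply: ler_sum => i _; apply: le_trans (mnormM _ _) _.
  rewrite ler_wpM2l ?mnorm_ge0 //; apply: le_trans (A_bound _) _.
  by rewrite ler_wpM2l // ler_weXn2l // leq_subr.
rewrite -mulr_suml -mulrA ler_wpM2r ?mulr_ge0 ?exprn_ge0 ?rho_ge0 //.
rewrite -(big_mkord xpredT (fun i => mnorm (f i))) -(big_mkord xpredT (fun i => mnorm (f i))).
have pos s t : 0 <= \sum_(s <= i < t) mnorm (f i).
  by rewrite sumr_ge0 // => i _; exact: mnorm_ge0.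
have [Nk|kN] := leqP N k.+1; last by rewrite [leRHS](big_cat_nat (n := k.+1)) 1?ltnW //= lerDl.
rewrite [leLHS](big_cat_nat (n := N)) //= big_nat_cond [X in _ + X]big_nat_cond.
rewrite [X in _ + X]big1 ?addr0; last by move=> i /andP[/andP[Ni _] _]; rewrite f0 ?mnorm0.
by rewrite -big_nat_cond.
Qed.

Local Notation D := (diag_mx (\row_j a j)).

(** On these entries the commutator with D vanishes, and the recursion is solved
    through the term m H_m of the next order instead. *)
Definition resonant_part (X : V) : V := \matrix_(i, j) (if a i == a j then X i j else 0).

Lemma resonant_partD X Y : resonant_part (X + Y) = resonant_part X + resonant_part Y.
Proof. by apply/matrixP => i j; rewrite !mxE; case: eqP; rewrite ?addr0. Qed.

Lemma resonant_partN X : resonant_part (- X) = - resonant_part X.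
Proof. by apply/matrixP => i j; rewrite !mxE; case: eqP; rewrite ?oppr0. Qed.

Lemma resonant_partZ c X : resonant_part (c *: X) = c *: resonant_part X.
Proof. by apply/matrixP => i j; rewrite !mxE; case: eqP; rewrite ?mulr0. Qed.

Lemma resonant_part_comm X : resonant_part (X *m D - D *m X) = 0.
Proof.
apply/matrixP => i j; rewrite mxE mul_mx_diag mul_diag_mx !mxE.
by case: eqP => // ->; rewrite mulrC subrr.
Qed.

Lemma resonant_part_mull X : resonant_part (L *m X) = L *m resonant_part X.
Proof.
apply/matrixP => i j; rewrite !mxE; case: eqP => [ij|ij].
  apply: eq_bigr => k _; rewrite mxE.
  by have [->|/L_block <-] := eqVneq (L i k) 0; rewrite ?mul0r // ij eqxx.
rewrite big1 // => k _; rewrite mxE.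
by have [->|/L_block <-] := eqVneq (L i k) 0; rewrite ?mul0r //; case: eqP; rewrite ?mulr0.
Qed.

Lemma resonant_part_mulr X : resonant_part (X *m L) = resonant_part X *m L.
Proof.
apply/matrixP => i j; rewrite !mxE; case: eqP => [ij|ij].
  apply: eq_bigr => k _; rewrite mxE.
  by have [->|/L_block ->] := eqVneq (L k j) 0; rewrite ?mulr0 // ij eqxx.
rewrite big1 // => k _; rewrite mxE.
by have [->|/L_block ->] := eqVneq (L k j) 0; rewrite ?mulr0 //; case: eqP; rewrite ?mul0r.
Qed.

Lemma resonant_part_defect b c X :
  resonant_part (b *: X + X *m L - c *: X - L *m X) =
  b *: resonant_part X + resonant_part X *m L - c *: resonant_part X -
    L *m resonant_part X.
Proof.
by rewrite !resonant_partD !resonant_partN !resonant_partZ resonant_part_mull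
  resonant_part_mulr.
Qed.

Lemma resonant_part_le X : mnorm (resonant_part X) <= mnorm X.
Proof.
apply: ler_sum => i _; apply: ler_sum => j _; rewrite mxE.
by case: eqP => // _; rewrite modulus0 modulus_ge0.
Qed.

(** Off the resonant entries the commutator with D can be inverted. *)
Lemma nonresonant_bound : exists2 k : R, 0 <= k & forall X,
  mnorm X <= mnorm (resonant_part X) + k * mnorm (X *m D - D *m X).
Proof.
pose k := \sum_i \sum_j modulus (a j - a i)^-1.
have pos i : 0 <= \sum_j modulus (a j - a i)^-1.
  by rewrite sumr_ge0 // => j _; exact: modulus_ge0.
exists k => [|X]; first by rewrite sumr_ge0.
rewrite /mnorm mulr_sumr -big_split ler_sum // => i _ /=.
rewrite mulr_sumr -big_split ler_sum // => j _ /=.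
rewrite mul_mx_diag mul_diag_mx !mxE; case: eqP => [_|/eqP ij].
  by rewrite lerDl mulr_ge0 ?modulus_ge0 // sumr_ge0.
have -> : X i j * a j - a i * X i j = (a j - a i) * X i j by ring.
have nz : a j - a i != 0 by rewrite subr_eq0 eq_sym.
rewrite modulus0 add0r -{1}[X i j](mulKf nz) (modulusM (_^-1)) ler_wpM2r ?modulus_ge0 //.
rewrite /k (bigD1 i) //= (bigD1 j) //= -addrA lerDl addr_ge0 //.
  by rewrite sumr_ge0 // => l _; exact: modulus_ge0.
by rewrite sumr_ge0.
Qed.

Local Notation defect := (dual_defect A a L d).

Lemma eq_dual_defect T T' m : (forall k, (k <= m)%N -> T k = T' k) ->
  defect T m = defect T' m.
Proof.
move=> TT; rewrite /dual_defect (TT m (leqnn m)); congr (_ - _ - _).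
  exact: eq_conv.
by apply: eq_shift => k km; rewrite TT // ltnW.
Qed.

Lemma defect_geometric T N : (forall k, (N <= k)%N -> T k = 0) -> geo_bounded (defect T).
Proof.
move=> T0; apply: geometricD.
  apply: geometricD; first exact: geometric_conv T0.
  by apply: (@geometric_finite _ N) => k Nk; rewrite T0 // mulmx0 oppr0.
apply: (@geometric_finite _ N.+1) => -[|k] //= Nk.
by rewrite T0 // !scaler0 mulmx0 subrr addr0 oppr0.
Qed.

(** The zero of order d of W compensates the pole of F^(-1). *)
Lemma conv_order_shift (W : nat -> V) m : (forall k, (k < d)%N -> W k = 0) ->
  convol W F m = convol (fun k => W (k + d)%N) (iter d xshift F) m.
Proof.
move=> W0; rewrite conv_iter_shiftr -conv_iter_shiftl.
by apply: eq_conv => // k _; rewrite -iter_shift_inv.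
Qed.

(** The gauge by a truncation T of x^d F^(-1) brings the system to
    D + x L up to high order, so that H = T F obeys a recursion with no small
    divisor; F is recovered from H through a truncation of F itself. *)
Lemma formal_solution_gevrey : exists B K : R, [/\ 0 <= B, 1 <= K &
  forall m, mnorm (F m) <= B * K ^+ m * (m`!)%:R].
Proof.
have rho0 := rho_ge0.
pose trunc (f : nat -> V) m := if (m < d.+2)%N then f m else 0.
have trunc_ge f k : (d.+2 <= k)%N -> trunc f k = 0 by rewrite /trunc leqNgt; case: ifP.
have trunc_lt f k : (k < d.+2)%N -> trunc f k = f k by rewrite /trunc => ->.
(* With d + 2 terms the defect W still vanishes to order 2 after the loss of
   x^d; one order is spent on the resonant entries, which are read off from the
   coefficient of index m + 1. *)
pose T := trunc G; pose P := trunc F; pose H := convol T F.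
pose W := defect T; pose W' k := W (k + d)%N.
pose Z m := convol P T m - monomial C n d m; pose Z' k := Z (k + d)%N.
pose g := iter d xshift F.
have W0 k : (k < d.+2)%N -> W k = 0.
  move=> kd; rewrite -(gauge_dual gau k); apply: eq_dual_defect => l lk.
  by rewrite ?/T ?/P trunc_lt // (leq_ltn_trans lk).
have Z0 k : (k < d.+2)%N -> Z k = 0.
  move=> kd; rewrite /Z -(gauge_FG gau k); apply/eqP; rewrite subr_eq0; apply/eqP.
  by apply: eq_conv => l lk; rewrite ?/T ?/P trunc_lt // (leq_ltn_trans lk).
have [CW CW0 HW] : geo_bounded W'.
  by apply/geometric_shift_left/(@defect_geometric _ d.+2) => k; exact: trunc_ge.
have [CZ CZ0 HZ] : geo_bounded Z'.
  apply/geometric_shift_left/geometricD.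
    apply: (@geometric_finite _ (d.+2 + d.+2)) => k dk; apply: big1 => i _.
    have [id|di] := ltnP i d.+2; last by rewrite /P trunc_ge // mul0mx.
    by rewrite /T trunc_ge ?mulmx0 //; lia.
  apply: (@geometric_finite _ d.+1) => k dk.
  by rewrite /monomial gtn_eqF // scale0r oppr0.
have [CP CP0 HP] : geo_bounded P by apply: (@geometric_finite _ d.+2) => k; exact: trunc_ge.
have WF m : convol W F m = convol W' g m.
  by apply: conv_order_shift => k kd; apply: W0; rewrite ltnW // ltnW.
have ZF m : convol Z F m = convol Z' g m.
  by apply: conv_order_shift => k kd; apply: Z0; rewrite ltnW // ltnW.
have PH m : convol P H m = g m + convol Z' g m.
  rewrite /H -convA -ZF /g -conv_monomiall -convDl; apply: eq_conv => // k _.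
  by rewrite /Z addrC subrK.
pose h m := mnorm (H m); pose u m := h m + mnorm (g m).
have h0 m : 0 <= h m by exact: mnorm_ge0.
have g0 m : 0 <= mnorm (g m) by exact: mnorm_ge0.
have u0 m : 0 <= u m by rewrite addr_ge0.
pose t m := tail_sum rho u m.
have t0 m : 0 <= t m by exact: tail_sum_ge0.
have tg m : tail_sum rho (fun j => mnorm (g j)) m <= t m.
  by apply: tail_sum_le => // j _; rewrite lerDr.
have th m : tail_sum rho h m <= t m by apply: tail_sum_le => // j _; rewrite lerDl.
have hprev m : h m <= t m.+1.
  rewrite /t tail_sumS; apply: (@le_trans _ _ (t m + u m)).
    by rewrite -[h m]add0r lerD // lerDl.
  by rewrite ler_peMl // addr_ge0.
have W'0 k : (k < 2)%N -> W' k = 0 by move=> k2; apply: W0; lia.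
have Z'0 k : (k < 1)%N -> Z' k = 0 by move=> k2; apply: Z0; lia.
have bW m : mnorm (convol W' g m) <= CW * t m.
  apply: le_trans (conv_bound (e := 1) g m CW0 rho0 _ HW) _.
    by move=> k k1; apply: W'0; rewrite ltnW.
  by rewrite ler_wpM2l // subSS subn0; exact: tg.
have bWS m : mnorm (convol W' g m.+1) <= CW * rho * t m.
  apply: le_trans (conv_bound (e := 2) g m.+1 CW0 rho0 W'0 HW) _.
  rewrite -mulrA ler_wpM2l //.
  apply: le_trans (ler_wpM2l rho0 (tg m)).
  rewrite /tail_sum mulr_sumr !subSS subn0; apply: ler_sum => j _.
  by rewrite subSn 1?ltnW // exprS mulrA.
have bZ m : mnorm (convol Z' g m) <= CZ * t m.
  apply: le_trans (conv_bound (e := 1) g m CZ0 rho0 Z'0 HZ) _.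
  by rewrite ler_wpM2l // subSS subn0; exact: tg.
have bP m : mnorm (convol P H m) <= CP * (t m + h m).
  apply: le_trans (conv_bound (e := 0) H m CP0 rho0 _ HP) _ => //.
  rewrite ler_wpM2l // subn0 big_ord_recr /= subnn expr0 mul1r lerD2r.
  exact: th.
pose l := mnorm L.
have l0 : 0 <= l by exact: mnorm_ge0.
have [kap kap0 Hkap] := nonresonant_bound.
pose E m := H m *m D - D *m H m.
pose S m := m%:R *: H m + H m *m L - d%:R *: H m - L *m H m.
have HE m : E m = convol W' g m - xshift S m.
  by rewrite -WF (conv_dual_defect gau) addrK.
have bS m : mnorm (S m) <= (m%:R + l + d%:R + l) * h m.
  rewrite /S; apply: le_trans (mnormB _ _) _; rewrite mulrDl; apply: lerD; last exact: mnormM.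
  apply: le_trans (mnormB _ _) _; rewrite mulrDl mnormZ modulus_nat lerD2r.
  apply: le_trans (mnormD _ _) _; rewrite mulrDl mnormZ modulus_nat lerD2l.
  by rewrite mulrC; exact: mnormM.
have res m : (d%:R + 2 * l + 1 <= m%:R) -> mnorm (resonant_part (H m)) <= CW * rho * t m.
  move=> md; set X := resonant_part (H m).
  have eP : resonant_part (E m.+1) = 0 by exact: resonant_part_comm.
  have sP := resonant_part_defect m%:R d%:R (H m); rewrite -/(S m) -/X in sP.
  have EY : convol W' g m.+1 = E m.+1 + S m by rewrite HE /= subrK.
  move: EY eP sP (bWS m).
  move: (convol W' g m.+1) (E m.+1) (S m) => Y E' S' EY eP sP bY.
  have EX : resonant_part Y = resonant_part S' by rewrite EY resonant_partD eP add0r.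
  rewrite sP in EX.
  have : m%:R *: X = resonant_part Y + (d%:R *: X + L *m X - X *m L).
    by rewrite EX; apply/matrixP => i j; rewrite !mxE; ring.
  move=> /(congr1 (@mnorm R n n)); rewrite mnormZ modulus_nat => EN.
  have b1 : mnorm (d%:R *: X + L *m X - X *m L) <= (d%:R + 2 * l) * mnorm X.
    apply: le_trans (mnormB _ _) _; rewrite mulr_natl mulr2n addrA mulrDl; apply: lerD.
      apply: le_trans (mnormD _ _) _; rewrite mulrDl mnormZ modulus_nat lerD2l.
      exact: mnormM.
    by rewrite mulrC; exact: mnormM.
  have b2 := mnormD (resonant_part Y) (d%:R *: X + L *m X - X *m L).
  rewrite -EN in b2.
  have b3 := le_trans (resonant_part_le _) bY.
  have b4 : (d%:R + 2 * l + 1) * mnorm X <= m%:R * mnorm X by rewrite ler_wpM2r ?mnorm_ge0.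
  by lra.
pose c1 := CW * rho + kap * (CW + (1 + l + d%:R + l)).
have c10 : 0 <= c1.
  by rewrite /c1 addr_ge0 ?mulr_ge0 // addr_ge0 // addr_ge0 // addr_ge0 // addr_ge0.
pose m0 := (Num.trunc (d%:R + 2 * l + 1 : R)).+1.
have bh m : (m0 <= m)%N -> h m <= c1 * m%:R * t m.
  move=> m0m; case: m m0m => // m m0m.
  have m1 : 1 <= m.+1%:R :> R by rewrite ler1n.
  have md : d%:R + 2 * l + 1 <= m.+1%:R.
    apply: le_trans (_ : m0%:R <= _); last by rewrite ler_nat.
    by apply: ltW; exact: truncnS_gt.
  have tm : t m.+1 <= m.+1%:R * t m.+1 by rewrite ler_peMl.
  apply: le_trans (Hkap _) _.
  rewrite /c1 mulrDl mulrDl; apply: lerD.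
    by apply: le_trans (res _ md) _; rewrite -!mulrA !ler_wpM2l.
  rewrite -!mulrA ler_wpM2l // -/(E m.+1) HE.
  apply: le_trans (mnormB _ _) _; rewrite mulrDl; apply: lerD.
    by apply: le_trans (bW _) _; rewrite ler_wpM2l.
  apply: le_trans (bS m) _; rewrite mulrA; apply: ler_pM => //.
    by rewrite !addr_ge0.
  rewrite !mulrDl mul1r !lerD ?ler_nat // ler_peMr //.
have bg m : (m0 <= m)%N -> mnorm (g m) <= (CP + CP * c1 + CZ) * m%:R * t m.
  move=> m0m; have -> : g m = convol P H m - convol Z' g m by rewrite PH addrK.
  have m1 : 1 <= m%:R :> R by rewrite ler1n (leq_trans _ m0m).
  have tm : t m <= m%:R * t m by rewrite ler_peMl.
  apply: le_trans (mnormB _ _) _; rewrite -mulrA mulrDl; apply: lerD; last first.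
    by apply: le_trans (bZ _) _; rewrite ler_wpM2l.
  apply: le_trans (bP _) _; rewrite mulrDr mulrDl; apply: lerD; rewrite -?mulrA ler_wpM2l //.
  by rewrite mulrA; exact: bh.
have bu m : (m0 <= m)%N -> u m <= (c1 + (CP + CP * c1 + CZ)) * m%:R * t m.
  by move=> m0m; rewrite (mulrDl c1) (mulrDl (c1 * _)) lerD ?bh ?bg.
have c20 : 0 <= c1 + (CP + CP * c1 + CZ) := addr_ge0 c10 (addr_ge0 (addr_ge0 CP0 (mulr_ge0 CP0 c10)) CZ0).
have [B [K [B0 K1 HB]]] := gevrey_recursion rho1 c20 u0 bu.
have [B' [K' [B'0 K'1 HB']]] := gevrey_shift d B0 K1 HB.
exists B', K'; split=> // m; apply: le_trans (HB' m).
by rewrite /u /g iter_shift_ge lerDr; exact: h0.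
Qed.

End GevreySolution.

(** * The transport system in the Borel plane *)

Section Sums.
Variables (R : realType) (n m : nat).
Local Notation V := 'M[Cplx R]_(n, m).

Definition sum_of (c : nat -> V) : V := xget 0 [set v | is_sum c v].

Lemma sum_ofP (c : nat -> V) (B : R) : 0 <= B ->
  (forall k, mnorm (c k) <= B * 2^-1 ^+ k) -> is_sum c (sum_of c).
Proof.
move=> B0 cB; have [v cv] := geo_sum_exists B0 cB.
exact: (xgetPex (P := [set v | is_sum c v]) 0 (ex_intro _ v cv)).
Qed.

Lemma power_term_bound (c : nat -> V) (B beta r : R) z k : 0 <= B -> 0 < beta ->
  r * beta <= 4^-1 -> (forall k, mnorm (c k) <= B * beta ^+ k) -> modulus z < r ->
  mnorm (z ^+ k *: c k) <= B * 4^-1 ^+ k.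
Proof.
move=> B0 b0 rb cB zr; rewrite mnormZ modulusX.
have r0 : 0 < r by rewrite (le_lt_trans (modulus_ge0 z)).
apply: (@le_trans _ _ (r ^+ k * (B * beta ^+ k))).
  apply: ler_pM; rewrite ?exprn_ge0 ?modulus_ge0 ?mnorm_ge0 //.
  by rewrite lerXn2r ?nnegrE ?modulus_ge0 ?ltW.
rewrite mulrCA -exprMn ler_wpM2l // lerXn2r ?nnegrE ?invr_ge0 //.
by rewrite mulr_ge0 // ltW.
Qed.

Lemma quarter_le_half k : (4^-1 : R) ^+ k <= 2^-1 ^+ k.
Proof. by rewrite lerXn2r ?nnegrE ?invr_ge0 // lef_pV2 ?posrE // ler_nat. Qed.

Lemma power_sumP (c : nat -> V) (B beta r : R) z : 0 <= B -> 0 < beta ->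
  r * beta <= 4^-1 -> (forall k, mnorm (c k) <= B * beta ^+ k) -> modulus z < r ->
  is_sum (fun k => z ^+ k *: c k) (sum_of (fun k => z ^+ k *: c k)).
Proof.
move=> B0 b0 rb cB zr; apply: (sum_ofP B0) => k.
apply: le_trans (power_term_bound k B0 b0 rb cB zr) _.
by rewrite ler_wpM2l // quarter_le_half.
Qed.

Lemma is_sum_0 (c : nat -> V) : is_sum (fun k => 0 ^+ k *: c k) (c 0%N).
Proof.
move=> e e0; exists 1%N => -[//|N] _; rewrite big_ord_recl expr0 scale1r big1 ?addr0.
  by rewrite subrr mnorm0.
by move=> i _; rewrite lift0 expr0n scale0r.
Qed.

End Sums.

Section Transport.
Variables (R : realType) (n : nat).
Local Notation C := (Cplx R).
Local Notation V := 'M[C]_n.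
Variables (Om : set C) (N : V -> V) (kap : nat -> V -> V) (res : C -> V -> V).
Variables (b ck : R).

(** The Borel transform phi of a solution solves a convolution equation with
    entire kernel. Its history up to the point xi is summarised by the
    derivatives s_k at xi of the entire function obtained by freezing the upper
    limit of the convolution; the equation becomes (xi - N) phi = s_0 together
    with the linear differential system s_k' = s_(k+1) + kap_k phi. *)
Record transport_data : Prop := TransportData {
  td_N_add : forall X Y, N (X + Y) = N X + N Y;
  td_N_scale : forall c X, N (c *: X) = c *: N X;
  td_N_bound : exists B : R, forall X, mnorm (N X) <= B * mnorm X;
  td_kap_add : forall k X Y, kap k (X + Y) = kap k X + kap k Y;
  td_kap_scale : forall k c X, kap k (c *: X) = c *: kap k X;
  td_b : 1 <= b;
  td_ck : 0 <= ck;
  td_kap_bound : forall k X, mnorm (kap k X) <= ck * b ^+ k * mnorm X;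
  td_res_right : forall xi X, ~ Om xi -> xi *: res xi X - N (res xi X) = X;
  td_res_left : forall xi X, ~ Om xi -> res xi (xi *: X - N X) = X;
  td_res_bound : forall e : R, 0 < e -> exists2 B, 0 <= B & forall xi,
    (forall z, Om z -> e <= modulus (xi - z)) ->
    forall X, mnorm (res xi X) <= B * mnorm X
}.
Hypothesis td : transport_data.

Definition away (e : R) (xi : C) : Prop := forall z, Om z -> e <= modulus (xi - z).

Lemma away_notin e xi : 0 < e -> away e xi -> ~ Om xi.
Proof. by move=> e0 xe /xe; rewrite subrr modulus0 leNgt e0. Qed.

Lemma away_near e e' xi y : away e xi -> modulus (y - xi) <= e' -> away (e - e') y.
Proof.
move=> xe yx z /xe exz; rewrite lerBlDr; apply: le_trans exz _.
apply: le_trans (modulus_dist _ y _) _; rewrite addrC lerD2l.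
by rewrite modulusB.
Qed.

(** The sequences of derivatives at a point of the entire functions of
    exponential type b. *)
Definition state_bound (s : nat -> V) (S : R) : Prop :=
  0 <= S /\ forall k, mnorm (s k) <= S * b ^+ k.

(** The function phi is eliminated through phi = (xi - N)^(-1) s_0. *)
Definition flat_at (sg : C -> nat -> V) (xi : C) : Prop := forall k,
  hasder (fun w => sg w k) xi (sg xi k.+1 + kap k (res xi (sg xi 0%N))).

Lemma b_ge0 : 0 <= b. Proof. exact: le_trans (td_b td). Qed.

Lemma kap0 k : kap k 0 = 0.
Proof. by have := td_kap_scale td k 0 0; rewrite !scale0r. Qed.

Lemma N0 : N 0 = 0.
Proof. by have := td_N_scale td 0 0; rewrite !scale0r. Qed.

Lemma kapB k X Y : kap k (X - Y) = kap k X - kap k Y.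
Proof. by rewrite (td_kap_add td) -scaleN1r (td_kap_scale td) scaleN1r. Qed.

Lemma resB xi X Y : ~ Om xi -> res xi (X - Y) = res xi X - res xi Y.
Proof.
move=> xO; rewrite -{1}(td_res_right td X xO) -{1}(td_res_right td Y xO).
set X' := res xi X; set Y' := res xi Y.
rewrite -[RHS](td_res_left td _ xO); congr (res xi _).
rewrite (td_N_add td) -(scaleN1r Y') (td_N_scale td) scalerDr !scaleN1r scalerN.
by rewrite !opprD !opprK addrACA.
Qed.

(** The geometric bounds allow every equation of the system to be checked on the
    coefficients; the centre [c] may be a singular point, such as the origin. *)
Lemma power_solution (c : C) (ph : nat -> V) (sg : nat -> nat -> V) (S G beta r : R) :
  0 <= S -> 0 <= G -> 1 <= beta -> 0 < r -> r * beta <= 4^-1 ->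
  (forall j k, mnorm (sg j k) <= S * b ^+ j * beta ^+ k) ->
  (forall k, mnorm (ph k) <= G * beta ^+ k) ->
  (forall j k, k.+1%:R *: sg j k.+1 = sg j.+1 k + kap j (ph k)) ->
  c *: ph 0%N - N (ph 0%N) = sg 0%N 0%N ->
  (forall k, c *: ph k.+1 - N (ph k.+1) + ph k = sg 0%N k.+1) ->
  exists (Sg : C -> nat -> V) (Ph : C -> V), forall xi, modulus (xi - c) < r ->
    [/\ state_bound (Sg xi) (2 * S),
        xi *: Ph xi - N (Ph xi) = Sg xi 0%N,
        (forall j, hasder (fun w => Sg w j) xi (Sg xi j.+1 + kap j (Ph xi))),
        (exists d, hasder Ph xi d) &
        is_sum (fun k => (xi - c) ^+ k *: ph k) (Ph xi) /\
        (xi = c -> Sg xi = sg ^~ 0%N /\ Ph xi = ph 0%N)].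
Proof.
move=> S0 G0 beta1 r0 rb sgB phB rec init eqs.
have beta0 : 0 < beta by rewrite (lt_le_trans ltr01).
have Sb0 j : 0 <= S * b ^+ j by rewrite mulr_ge0 ?exprn_ge0 ?b_ge0.
pose f j z := sum_of (fun k => z ^+ k *: sg j k).
pose p z := sum_of (fun k => z ^+ k *: ph k).
have fP j z : modulus z < r -> is_sum (fun k => z ^+ k *: sg j k) (f j z).
  by move=> zr; apply: (power_sumP (Sb0 j) beta0 rb (sgB j) zr).
have pP z : modulus z < r -> is_sum (fun k => z ^+ k *: ph k) (p z).
  by move=> zr; apply: (power_sumP G0 beta0 rb phB zr).
have kapP j z : modulus z < r -> is_sum (fun k => z ^+ k *: kap j (ph k)) (kap j (p z)).
  move=> zr; have := is_sum_map (td_kap_add td j) (kap0 j) (td_kap_bound td j) (pP z zr).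
  by apply: eq_is_sum => k; rewrite (td_kap_scale td).
have fder j z : modulus z < r -> hasder (f j) z (f j.+1 z + kap j (p z)).
  move=> zr; apply: (@power_series_hasder _ _ _ (sg j) (S * b ^+ j) beta r (f j)
    (fun z => f j.+1 z + kap j (p z))) => // {zr}z zr.
    exact: fP.
  apply: eq_is_sum (is_sumD (fP j.+1 z zr) (kapP j z zr)) => k.
  by rewrite rec scalerDr.
have pder z : modulus z < r -> exists d, hasder p z d.
  move=> zr; pose q z := sum_of (fun k => z ^+ k *: (k.+1%:R *: ph k.+1)).
  exists (q z); apply: (@power_series_hasder _ _ _ ph G beta r p q) => // {zr}z zr.
  apply: (sum_ofP (B := G * beta)); first by rewrite mulr_ge0 // ltW.
  have phB' k : mnorm (ph k.+1) <= G * beta * beta ^+ k.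
    by apply: le_trans (phB _) _; rewrite exprS mulrA.
  have Gb0 : 0 <= G * beta by rewrite mulr_ge0 // ltW.
  move=> k; have H := power_term_bound k Gb0 beta0 rb phB' zr.
  have -> : z ^+ k *: (k.+1%:R *: ph k.+1) = (k.+1%:R : C) *: (z ^+ k *: ph k.+1).
    by rewrite !scalerA mulrC.
  rewrite mnormZ modulus_nat.
  apply: le_trans (ler_wpM2l _ H) _ => //.
  rewrite mulrCA ler_wpM2l //.
  have -> : 4^-1 = 2^-1 * 2^-1 :> R by field.
  rewrite exprMn mulrA ler_piMl ?exprn_ge0 ?invr_ge0 //.
  by rewrite exprVn ler_pdivrMr ?exprn_gt0 // mul1r -natrX ler_nat ltn_expl.
have fp z : modulus z < r -> (c + z) *: p z - N (p z) = f 0%N z.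
  move=> zr; apply: is_sum_uniq (fP 0%N z zr).
  have [BN HN] := td_N_bound td.
  have NP : is_sum (fun k => z ^+ k *: N (ph k)) (N (p z)).
    have := is_sum_map (td_N_add td) N0 HN (pP z zr).
    by apply: eq_is_sum => k; rewrite (td_N_scale td).
  have S1 : is_sum (fun k => if k is k'.+1 then z ^+ k *: ph k' else 0) (0 + z *: p z).
    apply: (@is_sum_unshift _ _ _ (fun k => if k is k'.+1 then z ^+ k *: ph k' else 0)).
    by apply: eq_is_sum (is_sumZ z (pP z zr)) => k; rewrite scalerA -exprS.
  have := is_sumD (is_sumD (is_sumZ c (pP z zr)) (is_sumZ (-1) NP)) S1.
  have -> : c *: p z + -1 *: N (p z) + (0 + z *: p z) = (c + z) *: p z - N (p z).
    by rewrite add0r scaleN1r scalerDl addrAC.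
  apply: eq_is_sum => -[|k].
    by rewrite expr0 !scale1r addr0 scaleN1r init.
  rewrite -eqs scalerDr scalerBr; congr (_ + _).
  by rewrite scaleN1r !scalerA mulrC.
have bnd z : modulus z < r -> state_bound (fun j => f j z) (2 * S).
  move=> zr; split=> [|j]; first by rewrite mulr_ge0.
  rewrite -mulrA; apply: (is_sum_bound (Sb0 j) (fP j z zr)) => k.
  apply: le_trans (power_term_bound k (Sb0 j) beta0 rb (sgB j) zr) _.
  by rewrite ler_wpM2l // quarter_le_half.
exists (fun xi j => f j (xi - c)), (fun xi => p (xi - c)) => xi xr; split.
- exact: bnd.
- by rewrite -fp // [c + _]addrC subrK.
- move=> j; exact: (hasder_comp_shift (fder j _ xr)).
- have [d Hd] := pder _ xr; exists d; exact: (hasder_comp_shift Hd).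
split; first exact: pP.
move=> xc; rewrite xc subrr in xr *; split.
  apply/funext => j; exact: is_sum_uniq (fP j 0 xr) (is_sum_0 (sg j)).
exact: is_sum_uniq (pP 0 xr) (is_sum_0 ph).
Qed.


Lemma flat_bound (sg : C -> nat -> V) xi S B k : ~ Om xi ->
  (forall X, mnorm (res xi X) <= B * mnorm X) -> 0 <= B -> state_bound (sg xi) S ->
  mnorm (sg xi k.+1 + kap k (res xi (sg xi 0%N))) <= S * b ^+ k * (b + ck * B).
Proof.
move=> xO HB B0 [S0 HS]; apply: le_trans (mnormD _ _) _; rewrite mulrDr; apply: lerD.
  by apply: le_trans (HS _) _; rewrite exprSr mulrA.
apply: le_trans (td_kap_bound td _ _) _.
have H0 : mnorm (res xi (sg xi 0%N)) <= B * S.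
  by apply: le_trans (HB _) _; rewrite ler_wpM2l //; have := HS 0%N; rewrite expr0 mulr1.
apply: le_trans (ler_wpM2l _ H0) _; last by rewrite le_eqVlt; apply/orP; left; apply/eqP; ring.
by rewrite mulr_ge0 ?exprn_ge0 ?b_ge0 ?(td_ck td).
Qed.

(** Two flat families that agree at p agree at every nearby point: by the
    mean value inequality their distance is at most half its own bound. *)
Lemma flat_uniq (sg sg' : C -> nat -> V) p y (B S : R) : 0 <= B ->
  (forall t, 0 <= t -> t <= 1 -> let q := point_on p y t in
    [/\ ~ Om q, (forall X, mnorm (res q X) <= B * mnorm X), flat_at sg q /\ flat_at sg' q,
        state_bound (sg q) S & state_bound (sg' q) S]) ->
  modulus (y - p) * (b + ck * B) <= 2^-1 -> sg p = sg' p -> sg y = sg' y.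
Proof.
move=> B0 H small agree.
have S0 : 0 <= S by have [_ _ _ []] := H 0 (lexx _) ler01.
have key j : forall t, 0 <= t -> t <= 1 -> forall k,
    mnorm (sg (point_on p y t) k - sg' (point_on p y t) k) <= 2 * S * 2^-1 ^+ j * b ^+ k.
  elim: j => [|j IH] t t0 t1 k.
    have [_ _ _ [_ H1] [_ H2]] := H t t0 t1.
    rewrite expr0 mulr1; apply: le_trans (mnormB _ _) _.
    by rewrite -mulrA mulr_natl mulr2n lerD.
  have on s : point_on p (point_on p y t) s = point_on p y (s * t).
    by rewrite /point_on addrAC subrr add0r mulrA rmorphM.
  pose S' := 2 * S * 2^-1 ^+ j.
  have S'0 : 0 <= S' by rewrite !mulr_ge0 // exprn_ge0 // invr_ge0.
  have D0 : 0 <= S' * b ^+ k * (b + ck * B).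
    by rewrite !mulr_ge0 ?exprn_ge0 ?b_ge0 // addr_ge0 ?b_ge0 // mulr_ge0 ?(td_ck td).
  have := @mean_value R n n (fun w => sg w k - sg' w k) p (point_on p y t) _ D0.
  rewrite agree subrr subr0 => MV; apply: le_trans (MV _) _ => {MV}.
    move=> s s0 s1; rewrite on.
    have st0 : 0 <= s * t by rewrite mulr_ge0.
    have st1 : s * t <= 1 by rewrite mulr_ile1.
    have [nO HB [f1 f2] _ _] := H _ st0 st1.
    eexists; first exact: hasderB (f1 k) (f2 k).
    rewrite opprD addrACA -kapB -resB //.
    apply: (@flat_bound (fun w i => sg w i - sg' w i)) => //; split=> // i.
    exact: IH.
  have -> : modulus (point_on p y t - p) = t * modulus (y - p).
    by rewrite -{2}(point_on0 p y) point_on_dist subr0 ger0_norm.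
  have tm : t * modulus (y - p) * (b + ck * B) <= 2^-1.
    apply: le_trans small; rewrite -mulrA ler_piMl // mulr_ge0 ?modulus_ge0 //.
    by rewrite addr_ge0 ?b_ge0 // mulr_ge0 ?(td_ck td).
  have -> : 2 * S * 2^-1 ^+ j.+1 * b ^+ k = S' * b ^+ k * 2^-1.
    by rewrite /S' exprSr; ring.
  rewrite -mulrA ler_wpM2l ?mulr_ge0 ?exprn_ge0 ?b_ge0 //.
  by rewrite mulrC.
apply/funext => k; apply/eqP; rewrite -subr_eq0; apply/eqP/mnorm_eq0.
apply/ler_addgt0Pr => e e0; rewrite add0r.
pose T := 2 * S * b ^+ k.
have T0 : 0 <= T by rewrite !mulr_ge0 ?exprn_ge0 ?b_ge0.
have [j Hj] : exists j, T * 2^-1 ^+ j <= e.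
  exists (Num.bound (T / e)).
  have := @upper_nthrootP R (T / e) _ (leqnn _) => /ltW.
  rewrite ler_pdivrMr // exprVn => Te.
  by rewrite ler_pdivrMr ?exprn_gt0 // mulrC.
apply: le_trans Hj; have := key j 1 ler01 (lexx _) k; rewrite point_on1.
by move=> /le_trans; apply; rewrite /T mulrAC.
Qed.

Fixpoint local_coef (c : C) (s : nat -> V) (k : nat) : (nat -> V) * V :=
  if k is k'.+1 then
    let: (t, p) := local_coef c s k' in
    let t' := fun j => (k'.+1%:R)^-1 *: (t j.+1 + kap j p) in
    (t', res c (t' 0%N - p))
  else (s, res c (s 0%N)).

(** Away from [Om] the system can be solved on a disc whose radius depends only
    on the distance to [Om], with a solution at most twice as large as its
    initial value. *)
Lemma local_solution (e : R) : 0 < e -> exists2 h : R, 0 < h & forall c, away e c ->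
  forall s S, state_bound s S -> exists2 sg : C -> nat -> V, sg c = s &
    forall xi, modulus (xi - c) < h ->
      [/\ away (e / 2) xi, state_bound (sg xi) (2 * S), flat_at sg xi &
          exists d, hasder (fun w => res w (sg w 0%N)) xi d].
Proof.
move=> e0; have [B B0 HB] := td_res_bound td e0.
(* beta bounds the growth of both coefficient recursions: b + 2 ck B for the
   s_k, and 2 B for the term phi_(k-1) in the equation of phi_k *)
pose beta := b + 2 * ck * B + 2 * B.
have b1 := td_b td; have b0 := b_ge0; have ck0 := td_ck td.
have beta1 : 1 <= beta.
  by rewrite /beta -addrA (le_trans b1) // lerDl addr_ge0 ?mulr_ge0.
have beta0 : 0 < beta by rewrite (lt_le_trans ltr01).
pose r := (4 * beta)^-1.
have r0 : 0 < r by rewrite invr_gt0 mulr_gt0.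
have rb : r * beta <= 4^-1 by rewrite /r invfM divfK ?lt0r_neq0.
exists (Num.min r (e / 2)); first by rewrite lt_min r0 divr_gt0.
move=> c ce s S [S0 HS].
have cO := away_notin e0 ce.
pose sg j k := (local_coef c s k).1 j; pose ph k := (local_coef c s k).2.
have sgS j k : sg j k.+1 = k.+1%:R^-1 *: (sg j.+1 k + kap j (ph k)).
  by rewrite /sg /ph /=; case: (local_coef c s k).
have phS k : ph k.+1 = res c (sg 0%N k.+1 - ph k).
  by rewrite /sg /ph /=; case: (local_coef c s k).
have bnd k : (forall j, mnorm (sg j k) <= S * b ^+ j * beta ^+ k) /\
    mnorm (ph k) <= 2 * B * S * beta ^+ k.
  elim: k => [|k [IHs IHp]].
    rewrite expr0; split=> [j|]; rewrite mulr1; first exact: HS.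
    apply: le_trans (HB _ ce _) _; rewrite [2 * B]mulrC -!mulrA ler_wpM2l //.
    by have := HS 0%N; rewrite expr0 mulr1 => H; apply: le_trans H _; rewrite ler_peMl ?ler1n.
  have sgb j : mnorm (sg j k.+1) <= S * b ^+ j * beta ^+ k.+1.
    rewrite sgS mnormZ modulusV modulus_nat.
    apply: (@le_trans _ _ (mnorm (sg j.+1 k + kap j (ph k)))).
      by rewrite ler_piMl ?mnorm_ge0 // invf_le1 ?ler1n ?ltr0n.
    apply: le_trans (mnormD _ _) _.
    have H1 := IHs j.+1.
    have H2 : mnorm (kap j (ph k)) <= ck * b ^+ j * (2 * B * S * beta ^+ k).
      by apply: le_trans (td_kap_bound td _ _) _; rewrite ler_wpM2l // mulr_ge0 ?exprn_ge0.
    apply: le_trans (lerD H1 H2) _.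
    rewrite !exprS.
    have -> : S * (b * b ^+ j) * beta ^+ k + ck * b ^+ j * (2 * B * S * beta ^+ k) =
      S * b ^+ j * ((b + 2 * ck * B) * beta ^+ k) by ring.
    rewrite ler_wpM2l ?mulr_ge0 ?exprn_ge0 // ler_wpM2r ?exprn_ge0 ?(ltW beta0) //.
    by rewrite /beta lerDl mulr_ge0.
  split=> //; rewrite phS; apply: le_trans (HB _ ce _) _.
  have H0 := sgb 0%N; rewrite expr0 mulr1 in H0.
  have H1 : mnorm (ph k) <= S * beta ^+ k.+1.
    apply: le_trans IHp _; rewrite exprS mulrA [_ * S]mulrC.
    rewrite ler_wpM2r ?exprn_ge0 ?(ltW beta0) // ler_wpM2l // /beta lerDr.
    by rewrite addr_ge0 // !mulr_ge0.
  apply: le_trans (ler_wpM2l B0 (mnormB _ _)) _.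
  apply: le_trans (ler_wpM2l B0 (lerD H0 H1)) _.
  by rewrite le_eqVlt; apply/orP; left; apply/eqP; ring.
have G0 : 0 <= 2 * B * S by rewrite !mulr_ge0.
have [||k|Sg [Ph HSP]] := @power_solution c ph sg S (2 * B * S) beta r S0 G0 beta1 r0 rb
   (fun j k => (bnd k).1 j) (fun k => (bnd k).2).
- by move=> j k; rewrite sgS scalerA divff ?scale1r // pnatr_eq0.
- exact: td_res_right.
- by rewrite phS td_res_right // subrK.
have Phr xi : modulus (xi - c) < Num.min r (e / 2) -> away (e / 2) xi /\
    Ph xi = res xi (Sg xi 0%N).
  rewrite lt_min => /andP[xr xe].
  have axi : away (e / 2) xi.
    by have := away_near ce (ltW xe); rewrite {1}[e]splitr addrK.
  split=> //; have [_ <- _ _ _] := HSP _ xr.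
  by rewrite td_res_left //; apply: away_notin axi; rewrite divr_gt0.
exists Sg.
  have [|_ _ _ _ [_ /(_ erefl)[-> _]]] := HSP c; first by rewrite subrr modulus0.
  by apply/funext.
move=> xi xh; have [axi Phxi] := Phr xi xh.
have := xh; rewrite lt_min => /andP[xr xe].
have [sb _ der [d Hd] _] := HSP _ xr; split; [exact: axi|exact: sb| |].
  by move=> k; rewrite -Phxi; exact: der.
exists d; apply: (@hasder_locally _ _ _ Ph _ xi d (Num.min r (e / 2) - modulus (xi - c))).
- by rewrite subr_gt0.
- move=> w wx; apply: (Phr w _).2; apply: le_lt_trans (modulus_dist _ xi _) _.
  by rewrite -ltrBrDr.
- exact: Hd.
Qed.

End Transport.

(** * Charts of the transport system *)

Section Charts.
Variables (R : realType) (n : nat).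
Local Notation C := (Cplx R).
Local Notation V := 'M[C]_n.
Variables (Om : set C) (N : V -> V) (kap : nat -> V -> V) (res : C -> V -> V).
Variables (b ck : R).
Hypothesis td : transport_data Om N kap res b ck.
Hypothesis Om_closed : forall xi, ~ Om xi -> exists2 e : R, 0 < e & away Om e xi.
Hypothesis Om0 : Om 0.

(* the solution on the first sheet, singular point 0 included *)
Variables (r0 S0 : R) (sg0 : C -> nat -> V) (ph0 : C -> V).
Hypothesis r0_gt0 : 0 < r0.
Hypothesis initial : forall xi, modulus xi < r0 ->
  [/\ Om xi -> xi = 0, state_bound b (sg0 xi) S0,
      xi != 0 -> flat_at kap res sg0 xi /\ ph0 xi = res xi (sg0 xi 0%N) &
      exists d, hasder ph0 xi d].

(** The radius is so small that two solutions on overlapping discs coincide as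
    soon as they agree at one point. *)
Record good_disc (c : C) (h : R) (sg : C -> nat -> V) (e B S : R) : Prop := GoodDisc {
  gd_e : 0 < e;
  gd_B : 0 <= B;
  gd_res : forall xi, away Om e xi -> forall X, mnorm (res xi X) <= B * mnorm X;
  gd_small : 2 * h * (b + ck * B) <= 2^-1;
  gd_away : forall xi, modulus (xi - c) < h -> away Om e xi;
  gd_bound : forall xi, modulus (xi - c) < h -> state_bound b (sg xi) S;
  gd_flat : forall xi, modulus (xi - c) < h -> flat_at kap res sg xi;
  gd_der : forall xi, modulus (xi - c) < h ->
    exists d, hasder (fun w => res w (sg w 0%N)) xi d
}.

Record disc_chart : Type := DiscChart {
  dc_center : C;
  dc_radius : R;
  dc_section : C -> nat -> V;
  dc_good : exists e B S, good_disc dc_center dc_radius dc_section e B S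
}.

Definition chart_dom (i : option disc_chart) (xi : C) : Prop :=
  if i is Some d then modulus (xi - dc_center d) < dc_radius d else modulus xi < r0.

(** At the origin the system is singular and the state does not determine the
    solution; the value None there separates the first sheet from all others. *)
Definition chart_val (i : option disc_chart) (xi : C) : option (nat -> V) :=
  if i is Some d then Some (dc_section d xi)
  else if xi == 0 then None else Some (sg0 xi).

Definition regular_state (st : option (nat -> V)) : Prop :=
  exists s S, st = Some s /\ state_bound b s S.

Lemma convex_disc (c p y : C) (h t : R) : modulus (p - c) < h -> modulus (y - c) < h ->
  0 <= t -> t <= 1 -> modulus (point_on p y t - c) < h.
Proof.
move=> ph yh t0 t1.
have -> : point_on p y t - c = (1 - t)%:C%C * (p - c) + t%:C%C * (y - c).
  by rewrite /point_on rmorphB /= rmorph1; ring.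
apply: le_lt_trans (modulusD _ _) _.
rewrite !modulusM !modulus_real !ger0_norm ?subr_ge0 //.
have [->|t_gt0] := eqVneq t 0; first by rewrite subr0 mul1r mul0r addr0.
have {}t_gt0 : 0 < t by rewrite lt_neqAle eq_sym t_gt0.
have -> : h = (1 - t) * h + t * h by ring.
by apply: ler_ltD; [rewrite ler_wpM2l ?subr_ge0 // ltW|rewrite ltr_pM2l].
Qed.

Lemma state_bound_le (s : nat -> V) S S' : S <= S' -> state_bound b s S -> state_bound b s S'.
Proof.
move=> SS [S_ge0 H]; split=> [|k]; first exact: le_trans SS.
by apply: le_trans (H k) _; rewrite ler_wpM2r // exprn_ge0 // (b_ge0 td).
Qed.

Lemma disc_agree (d : disc_chart) (sg : C -> nat -> V) S x y :
  modulus (x - dc_center d) < dc_radius d -> modulus (y - dc_center d) < dc_radius d ->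
  (forall t, 0 <= t -> t <= 1 -> flat_at kap res sg (point_on x y t) /\
     state_bound b (sg (point_on x y t)) S) ->
  dc_section d x = sg x -> dc_section d y = sg y.
Proof.
move=> xd yd H; have [e [B [S' G]]] := dc_good d.
apply: (@flat_uniq _ _ _ _ _ _ _ _ td _ _ x y B (Num.max S S')); first exact: gd_B G.
  move=> t t0 t1 /=; have qd := convex_disc xd yd t0 t1; have [f bs] := H t t0 t1.
  split.
  - exact (away_notin (gd_e G) (gd_away G qd)).
  - exact (gd_res G (gd_away G qd)).
  - exact (conj (gd_flat G qd) f).
  - by apply: (state_bound_le _ (gd_bound G qd)); rewrite le_max lexx orbT.
  - by apply: (state_bound_le _ bs); rewrite le_max lexx.
apply: le_trans (gd_small G); rewrite ler_wpM2r //.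
  by rewrite addr_ge0 ?(b_ge0 td) // mulr_ge0 ?(gd_B G) ?(td_ck td).
apply: le_trans (modulus_dist _ (dc_center d) _) _.
by rewrite mulr_natl mulr2n lerD ?(ltW yd) // modulusB ltW.
Qed.

(** Both sections solve the same system on a convex set avoiding [Om], or are
    both the germ at the origin. *)
Lemma chart_agree i j x y : chart_dom i x -> chart_dom j x -> chart_dom i y ->
  chart_dom j y -> chart_val i x = chart_val j x -> chart_val i y = chart_val j y.
Proof.
have half (d : disc_chart) : chart_dom (Some d) x -> chart_dom None x ->
    chart_dom (Some d) y -> chart_dom None y ->
    chart_val (Some d) x = chart_val None x -> chart_val (Some d) y = chart_val None y.
  move=> /= xd x0 yd y0; have [e [B [S G]]] := dc_good d.
  have nz z : modulus (z - dc_center d) < dc_radius d -> z != 0.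
    move=> /(gd_away G)/(away_notin (gd_e G)) nO; apply/eqP => z0.
    by apply: nO; rewrite z0.
  rewrite !(negbTE (nz _ _)) // => -[E]; congr Some; move: E.
  apply: (@disc_agree d sg0 S0 x y xd yd) => t t0 t1.
  have q0 : modulus (point_on x y t) < r0.
    by have := @convex_disc 0 x y r0 t; rewrite !subr0; exact.
  have [_ bs fl _] := initial q0.
  exact (conj (fl (nz _ (convex_disc xd yd t0 t1))).1 bs).
case: i j => [d|] [d'|] //.
- move=> /= xd xd' yd yd' [E]; congr Some; move: E.
  have [e [B [S G]]] := dc_good d'.
  apply: (@disc_agree d (dc_section d') S x y xd yd) => t t0 t1.
  have qd := convex_disc xd' yd' t0 t1.
  exact (conj (gd_flat G qd) (gd_bound G qd)).
- exact: half.
- by move=> x0 xd y0 yd E; apply/esym/half.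
Qed.

Lemma chart_open i x : chart_dom i x ->
  exists2 r : R, 0 < r & forall y, modulus (y - x) < r -> chart_dom i y.
Proof.
have key c h : modulus (x - c) < h ->
    exists2 r : R, 0 < r & forall y, modulus (y - x) < r -> modulus (y - c) < h.
  move=> xh; exists (h - modulus (x - c)); first by rewrite subr_gt0.
  by move=> y yx; apply: le_lt_trans (modulus_dist _ x _) _; rewrite -ltrBrDr.
case: i => [d|] /=; first exact: key.
move=> x0; have [|r r_gt0 H] := key 0 r0; first by rewrite subr0.
by exists r => // y /H; rewrite subr0.
Qed.

Lemma chart_regular i x : chart_dom i x -> ~ Om x -> regular_state (chart_val i x).
Proof.
case: i => [d|] /= xd nO.
  have [e [B [S G]]] := dc_good d.
  by exists (dc_section d x), S; split; [by []|exact (gd_bound G xd)].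
have x0 : x != 0 by apply/eqP => x0; apply: nO; rewrite x0.
rewrite (negbTE x0); exists (sg0 x), S0; split=> //.
by have [] := initial xd.
Qed.

Lemma local_chart (e : R) : 0 < e -> exists2 h : R, 0 < h & forall c, away Om e c ->
  forall s S, state_bound b s S -> exists i, chart_val i c = Some s /\
    forall w, modulus (w - c) < h -> chart_dom i w /\
      exists2 s', chart_val i w = Some s' & state_bound b s' (2 * S).
Proof.
move=> e0; have [h h0 H] := local_solution td e0.
have e2 : 0 < e / 2 by rewrite divr_gt0.
have [B B0 HB] := td_res_bound td e2.
have q0 : 0 < b + ck * B.
  by rewrite ltr_pwDl ?mulr_ge0 ?(td_ck td) // (lt_le_trans ltr01 (td_b td)).
exists (Num.min h (4 * (b + ck * B))^-1); first by rewrite lt_min h0 invr_gt0 mulr_gt0.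
set h' := Num.min _ _ => c ce s S sS; have [sg sgc Hsg] := H c ce s S sS.
have hh' xi : modulus (xi - c) < h' -> modulus (xi - c) < h.
  by rewrite lt_min => /andP[].
have G : good_disc c h' sg (e / 2) B (2 * S).
  split=> //.
  - apply: (@le_trans _ _ (2 * (4 * (b + ck * B))^-1 * (b + ck * B))).
      by rewrite ler_wpM2r ?(ltW q0) // ler_wpM2l // ge_min lexx orbT.
    by rewrite le_eqVlt; apply/orP; left; apply/eqP; field; rewrite lt0r_neq0.
  - by move=> xi /hh'/Hsg[].
  - by move=> xi /hh'/Hsg[].
  - by move=> xi /hh'/Hsg[].
  - by move=> xi /hh'/Hsg[].
have G' : exists e B S, good_disc c h' sg e B S by exists (e / 2), B, (2 * S).
exists (Some (DiscChart G')); split; first by rewrite /= sgc.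
move=> w wh; split=> //; exists (sg w) => //.
by have [] := Hsg _ (hh' _ wh).
Qed.

(** The discs centred near x have a common radius, hence cover a fixed
    neighbourhood of x whatever the state is. *)
Lemma chart_cover x : ~ Om x -> exists2 r : R, 0 < r &
  forall y, modulus (y - x) < r -> ~ Om y /\ forall st, regular_state st ->
    exists2 i, chart_val i y = st & forall w, modulus (w - x) < r -> chart_dom i w.
Proof.
move=> nO; have [e e0 xe] := Om_closed nO.
have e2 : 0 < e / 2 by rewrite divr_gt0.
have [h h0 H] := local_chart e2.
exists (Num.min (e / 2) (h / 2)); first by rewrite lt_min e2 divr_gt0.
move=> y; rewrite lt_min => /andP[ye yh].
have ay : away Om (e / 2) y by have := away_near xe (ltW ye); rewrite {1}[e]splitr addrK.
split; first exact (away_notin e2 ay).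
move=> st [s [S [-> sS]]]; have [i [iy Hi]] := H y ay s S sS.
exists i => // w; rewrite lt_min => /andP[_ wh].
apply: (Hi w _).1; apply: le_lt_trans (modulus_dist _ x _) _.
by rewrite [h]splitr ltrD // modulusB.
Qed.

Lemma chart_dom0 : chart_dom None 0.
Proof. by rewrite /chart_dom modulus0. Qed.

Lemma chart_val0 : chart_val None 0 = None.
Proof. by rewrite /= eqxx. Qed.

Definition volterra_sheets : sheets Om :=
  Sheets chart_agree chart_open chart_cover chart_regular chart_dom0 chart_val0.

Definition outcome (xi : C) (st : option (nat -> V)) : V :=
  if st is Some s then res xi (s 0%N) else ph0 0.

Lemma outcome_chart0 xi : modulus xi < r0 -> outcome xi (chart_val None xi) = ph0 xi.
Proof.
move=> xi0 /=; case: eqP => [->//|/eqP nz] /=.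
by have [_ _ /(_ nz)[_ ->]] := initial xi0.
Qed.

Lemma outcome_hasder i xi : chart_dom i xi ->
  exists d, hasder (fun w => outcome w (chart_val i w)) xi d.
Proof.
case: i => [d|] xd.
  have [e [B [S G]]] := dc_good d.
  exact (gd_der G xd).
have [_ _ _ [d Hd]] := initial xd.
have [r r_gt0 H] := chart_open xd.
exists d; apply: (@hasder_locally _ _ _ ph0 _ xi d r) => // w /H w0.
by rewrite outcome_chart0.
Qed.

Lemma chart_near i xi : chart_dom i xi -> exists2 r : R, 0 < r &
  forall w, modulus (w - xi) < r -> chart_dom i w /\ (Om w -> w = 0).
Proof.
move=> xd; have [r r_gt0 H] := chart_open xd; exists r => // w /H wd; split=> //.
case: i {xd H} wd => [d|] wd; last by have [] := initial wd.
have [e [B [S G]]] := dc_good d.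
by move=> /(away_notin (gd_e G) (gd_away G wd)).
Qed.

Definition state_size (st : option (nat -> V)) (s : R) : Prop :=
  exists2 t, st = Some t & state_bound b t s.

Lemma chart_step (e : R) : 0 < e -> exists2 h : R, 0 < h & forall c, away Om e c ->
  forall st s, state_size st s -> exists i, chart_val i c = st /\
    forall w, modulus (w - c) < h -> chart_dom i w /\ state_size (chart_val i w) (2 * s).
Proof.
move=> e0; have [h h0 H] := local_chart e0; exists h => // c ce _ s [t -> ts].
by have [i [ic Hi]] := H c ce t s ts; exists i.
Qed.

Lemma outcome_bound (e : R) : 0 < e -> exists2 B : R, 0 <= B &
  forall c, away Om e c -> forall st s, state_size st s -> mnorm (outcome c st) <= B * s.
Proof.
move=> e0; have [B B0 HB] := td_res_bound td e0; exists B => // c ce _ s [t -> [s0 ts]] /=.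
apply: le_trans (HB c ce _) _; rewrite ler_wpM2l //.
by have := ts 0%N; rewrite expr0 mulr1.
Qed.

Lemma chart_size i x : chart_dom i x -> ~ Om x ->
  exists2 s, 0 <= s & state_size (chart_val i x) s.
Proof.
move=> xd xO; have [t [s [-> ts]]] := chart_regular xd xO.
by exists s; [case: ts|exists t].
Qed.

End Charts.

(** * From log-exponential expressions to a recursion *)

Section BlockDiagonal.
Variables (K : nmodType) (J : nat) (p : 'I_J -> nat).

Definition block (x : 'I_(\sum_j p j)) : 'I_J := tagnat.sig1 x.

Lemma mxdiag_block (B : forall j, 'M[K]_(p j)) x y :
  (\mxdiag_j B j) x y != 0 -> block x = block y.
Proof.
rewrite /mxdiag mxE -/(block x) -/(block y).
case: (block x =P block y) => [e|_]; last by rewrite mxE eqxx.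
by move=> _; exact: e.
Qed.

Lemma conform_mx00 m n m' n' (i : 'I_m) (j : 'I_n) :
  conform_mx (0 : 'M[K]_(m, n)) (0 : 'M[K]_(m', n')) i j = 0.
Proof.
rewrite /conform_mx; case: (m' =P m) => [e1|]; case: (n' =P n) => [e2|]; rewrite ?mxE //.
by rewrite castmxE mxE.
Qed.

Lemma mxdiag_if (P : pred 'I_J) (B : forall j, 'M[K]_(p j)) x y :
  (\mxdiag_j (if P j then B j else 0)) x y = if P (block y) then (\mxdiag_j B j) x y else 0.
Proof.
rewrite /mxdiag !mxE -/(block x) -/(block y).
case: (block x =P block y) => [e|_]; last by rewrite !mxE if_same.
have <- : P (block x) = P (block y) by rewrite e.
by case: (P _) => //; rewrite conform_mx00.
Qed.

End BlockDiagonal.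

Lemma mul_mxdiag_if (K : pzRingType) m J (p : 'I_J -> nat) (P : pred 'I_J)
   (B : forall j, 'M[K]_(p j)) (X : 'M[K]_(m, _)) x y :
  (X *m \mxdiag_j (if P j then B j else 0)) x y =
    if P (block y) then (X *m \mxdiag_j B j) x y else 0.
Proof.
rewrite !mxE; case: ifP => Py.
  by apply: eq_bigr => z _; rewrite mxdiag_if Py.
by rewrite big1 // => z _; rewrite mxdiag_if Py mulr0.
Qed.

Section Unpack.
Variables (R : realType).
Local Notation C := (Cplx R).

Lemma fsbig_list (T : choiceType) (V : nmodType) (f : T -> V) (r : seq T) : uniq r ->
  (forall i, i \notin r -> f i = 0) -> \sum_(i \in [set: T]) f i = \sum_(i <- r) f i.
Proof.
move=> ur fr; rewrite (fsbigE r) // => [|i _]; last exact: fr.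
by apply: eq_bigl => i; exact: mem_set.
Qed.

Lemma intr_Cinj : injective (fun m : int => m%:~R : C).
Proof. exact: intr_inj. Qed.

Section Size.
Variable n : nat.
Implicit Types (F : int -> 'M[C]_n) (T : logexp R n).

Lemma of_laurent_int F (m : int) : of_laurent F 0 m%:~R 0 = F m.
Proof.
rewrite /of_laurent !eqxx /= (_ : [set _ | _] = [set m]) ?fsbig_set1 //.
by apply/seteqP; split=> k /=; [move/intr_Cinj ->|move=> ->].
Qed.

Lemma of_laurent_neq0 F a l k : of_laurent F a l k != 0 ->
  [/\ a = 0, k = 0%N & exists m : int, l = m%:~R].
Proof.
rewrite /of_laurent; case: andP => [[/eqP-> /eqP->]|_]; last by rewrite eqxx.
move=> H; split=> //; apply: contrapT => nl.
by move: H; rewrite fsbig1 ?eqxx // => m /= lm; case: nl; exists m.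
Qed.

(** The exponents u and l - u of two factors, one of them a Laurent series, only
    leave a sum over powers of x. *)
Lemma lemul_laurent F T a l k (r : seq int) : uniq r ->
  (forall m, m \notin r -> F m *m T a (l - m%:~R) k = 0) ->
  lemul (of_laurent F) T a l k = \sum_(m <- r) F m *m T a (l - m%:~R) k.
Proof.
move=> ur Hr; pose h (m : int) : C * C * 'I_k.+1 := (0, m%:~R, ord0).
rewrite /lemul (fsbig_list (r := map h r)).
- rewrite big_map; apply: eq_bigr => m _.
  by rewrite /h /= of_laurent_int subr0 subn0.
- by rewrite map_inj_uniq // => m m' [] /intr_Cinj.
move=> [[u1 u2] u3] /= nu.
have [->|/of_laurent_neq0[u10 u30 [m u2m]]] := eqVneq (of_laurent F u1 u2 u3) 0.
  by rewrite mul0mx.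
move: nu; rewrite {}u10 u2m u30 of_laurent_int subr0 subn0 => nu; apply: Hr.
apply: contra nu => mr; rewrite (_ : (_, _, _) = h m) ?map_f //.
by congr (_, _, _); apply: val_inj.
Qed.

Lemma laurent_product F (G : int -> 'M[C]_n) (v w m : nat) :
  (forall k : int, k < - v%:Z -> F k = 0) -> (forall k : int, k < - w%:Z -> G k = 0) ->
  lemul (of_laurent F) (of_laurent G) = @xpow R n 0 ->
  convol (fun k => F (k%:Z - v%:Z)) (fun k => G (k%:Z - w%:Z)) m = monomial C n (v + w) m.
Proof.
move=> F0 G0 /(congr1 (fun T => T 0 ((m%:Z - (v + w)%:Z)%:~R) 0%N)).
pose r := [seq (i%:Z - v%:Z : int) | i <- iota 0 m.+1].
rewrite (@lemul_laurent _ _ _ _ _ r).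
- rewrite /r big_map -[iota 0 _]/(index_iota 0 m.+1) big_mkord => H.
  transitivity (@xpow R n 0 0 (m%:Z - (v + w)%:Z)%:~R 0).
    rewrite -H; apply: eq_bigr => i _; congr (_ *m _).
    rewrite -intrB of_laurent_int; congr (G _).
    by have := ltn_ord i; lia.
  rewrite /xpow of_laurent_int /monomial scalemx1; congr ((_ : bool)%:R%:M).
  by lia.
- by rewrite map_inj_uniq ?iota_uniq // => i j /=; lia.
move=> k kr; rewrite -intrB of_laurent_int.
have [kv|vk] := ltrP k (- v%:Z); first by rewrite F0 // mul0mx.
rewrite G0 ?mulmx0 // ltNge; apply: contra kr => H.
apply/mapP; exists (absz (k + v%:Z)); last by lia.
by rewrite mem_iota; lia.
Qed.

End Size.

Section Solution.
Variables (J : nat) (p : 'I_J -> nat) (lam a : 'I_J -> C).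
Local Notation n := (\sum_j p j).
Variables (A : nat -> 'M[C]_n) (F : int -> 'M[C]_n).

(** The coefficient of (log x)^k in x^N, for N the nilpotent part of L. *)
Definition jordan_power (k : nat) : 'M[C]_n :=
  \mxdiag_j ((k`!%:R^-1 : C) *: (nilpotent_jordan C (p j)) ^+ k).

Let FxL := lemul (of_laurent F) (xpow_jordan p lam).
Let Y := lemul FxL (exp_level_one p a).

Lemma xpow_jordanE b l k : xpow_jordan p lam b l k =
  \mxdiag_j (if (b == 0) && (l == lam j) then
    (k`!%:R^-1 : C) *: (nilpotent_jordan C (p j)) ^+ k else 0).
Proof. by []. Qed.

(** In the column y only the power of x whose exponent is l - lam contributes,
    and it is an integer power at most once. *)
Lemma FxL_entry l k x y : FxL 0 l k x y =
  if pselect (exists m : int, l = lam (block y) + m%:~R) is left H then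
    (F (projT1 (cid H)) *m jordan_power k) x y else 0.
Proof.
pose M (j : 'I_J) : int := if pselect (exists m : int, l = lam j + m%:~R) is left H then
   projT1 (cid H) else 0.
pose r := undup [seq M j | j <- enum 'I_J].
rewrite /FxL (@lemul_laurent _ _ _ _ _ _ r) ?undup_uniq //; last first.
  move=> m mr; apply/matrixP => x' y'.
  rewrite xpow_jordanE (mul_mxdiag_if (fun j => (0 == 0) && (l - m%:~R == lam j))) eqxx /=.
  case: eqP => [lm|_]; last by rewrite ?mxE.
  case/negP: mr; rewrite mem_undup.
  have -> : m = M (block y').
    rewrite /M; case: pselect => [H|]; last by case; exists m; rewrite -lm subrK.
    case: cid => m' /= lm'; apply: intr_Cinj; apply: (addrI (lam (block y'))).
    by rewrite -lm' -lm subrK.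
  by rewrite map_f // mem_enum.
rewrite summxE.
have Er m : (F m *m xpow_jordan p lam 0 (l - m%:~R) k) x y =
    if l - m%:~R == lam (block y) then (F m *m jordan_power k) x y else 0.
  by rewrite xpow_jordanE (mul_mxdiag_if (fun j => (0 == 0) && (l - m%:~R == lam j))) eqxx.
under eq_bigr do rewrite Er.
case: pselect => [H|nH]; last first.
  by rewrite big1 // => m _; case: eqP => // lm; case: nH; exists m; rewrite -lm subrK.
case: cid => m lm /=.
rewrite (bigD1_seq m) ?undup_uniq //=; last first.
  rewrite mem_undup; have -> : m = M (block y); last by rewrite map_f // mem_enum.
  rewrite /M; case: pselect => [H'|]; last by case; exists m.
  case: cid => m' /= lm'; apply: intr_Cinj; apply: (addrI (lam (block y))).
  by rewrite -lm' -lm.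
rewrite lm addrK eqxx [X in _ + X]big1 ?addr0 // => m' m'm; case: eqP => // E.
case/eqP: m'm; apply: intr_Cinj; apply: (addrI (lam (block y))).
by rewrite -{1}E subrK.
Qed.

Lemma FxL_int m k x y : FxL 0 (lam (block y) + m%:~R) k x y = (F m *m jordan_power k) x y.
Proof.
rewrite FxL_entry; case: pselect => [H|]; last by case; exists m.
by case: cid => m' /= /addrI/intr_Cinj ->.
Qed.

Lemma FxL_neq0 b l k : b != 0 -> FxL b l k = 0.
Proof.
move=> b0; rewrite /FxL (@lemul_laurent _ _ _ _ _ _ [::]) ?big_nil // => m _.
apply/matrixP => x y.
rewrite xpow_jordanE (mul_mxdiag_if (fun j => (b == 0) && (l - m%:~R == lam j))).
by rewrite (negbTE b0) /= ?mxE.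
Qed.

Lemma Y_entry b l k x y : Y b l k x y = if b == a (block y) then FxL 0 l k x y else 0.
Proof.
have E b' l' k' X x' y' : (X *m exp_level_one p a b' l' k') x' y' =
    if [&& b' == a (block y'), l' == 0 & (k' == 0)%N] then X x' y' else 0.
  have -> : exp_level_one p a b' l' k' = \mxdiag_j
     (if [&& b' == a j, l' == 0 & (k' == 0)%N] then 1%:M else 0) by [].
  rewrite (mul_mxdiag_if (fun j => [&& b' == a j, l' == 0 & (k' == 0)%N])).
  by rewrite (mxdiagZ 1) mulmx1.
rewrite /Y /lemul (fsbig_list (r := [:: (0, l, ord_max)])) //.
  by rewrite big_seq1 E subr0 subrr subnn !eqxx !andbT.
move=> [[u1 u2] u3]; rewrite inE => nu; apply/matrixP => x' y'; rewrite E mxE.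
case: ifP => // /and3P[_ /=]; rewrite subr_eq0 subn_eq0 => /eqP lu ku.
have [u10|/FxL_neq0->] := eqVneq u1 0; last by rewrite mxE.
case/eqP: nu; rewrite u10 -lu; congr (_, _, _); apply: val_inj => /=.
by apply/eqP; rewrite eqn_leq ku -ltnS ltn_ord.
Qed.

(** Clearing the pole of F by x^v turns L into L - v. *)
Definition monodromy_exponent (v : nat) : 'M[C]_n :=
  diag_mx (\row_y (lam (block y) - v%:R)) + jordan_power 1.

Lemma monodromy_exponent_block v x y : monodromy_exponent v x y != 0 ->
  block x = block y.
Proof.
rewrite /monodromy_exponent mxE [X in X + _]mxE; case: (x =P y) => [->//|_].
rewrite mulr0n add0r; exact: (@mxdiag_block C J p).
Qed.

Lemma jordan_power0 : jordan_power 0 = 1%:M.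
Proof.
rewrite /jordan_power -(mxdiagZ 1); apply/eq_mxdiagP => j.
by rewrite expr0 fact0 invr1 scale1r.
Qed.

(** The column y is read at the exponent x^(lam + M) of its own block, without
    logarithm. There the derivative of log x contributes the nilpotent part of
    L, and A times the solution is a finite sum. *)
Lemma laurent_solution (v m : nat) :
  (forall k : int, k < - v%:Z -> F k = 0) ->
  lemul (@xpow R n 2) (lederiv Y) = lemul (of_powerseries A) Y ->
  let Fs k := F (k%:Z - v%:Z) in
  convol A Fs m = Fs m *m diag_mx (\row_y a (block y)) +
    xshift (fun k => k%:R *: Fs k + Fs k *m monodromy_exponent v) m.
Proof.
move=> F0 eqY Fs; apply/matrixP => x y.
pose M : int := m%:Z - v%:Z; pose b := a (block y); pose l : C := lam (block y) + M%:~R.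
have Yint (k : int) i z : Y b (lam (block y) + k%:~R) i z y = (F k *m jordan_power i) z y.
  by rewrite Y_entry eqxx FxL_int.
have : lemul (@xpow R n 2) (lederiv Y) b l 0 x y = lemul (of_powerseries A) Y b l 0 x y.
  by rewrite eqY.
rewrite {1}/xpow (@lemul_laurent _ _ _ _ _ _ [:: 2]) //; last first.
  by move=> k; rewrite inE => /negbTE->; rewrite mulr0n raddf0 mul0mx.
rewrite big_seq1 eqxx mul1mx /lederiv.
have e2 : l - 2%:~R + 2 = l by rewrite subrK.
have e1 : l - 2%:~R + 1 = lam (block y) + (M - 1)%:~R.
  by rewrite /l [(M - 1)%:~R]intrB -[2%:~R]/(2 : C) -[1%:~R]/(1 : C); ring.
have entryD (X1 X2 X3 : 'M[C]_n) (c1 c2 c3 : C) : (c1 *: X1 + c2 *: X2 + c3 *: X3) x y =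
  c1 * X1 x y + c2 * X2 x y + c3 * X3 x y by rewrite !mxE.
rewrite e2 e1 entryD /l (Yint M 0) (Yint (M - 1) 0) (Yint (M - 1) 1) jordan_power0 !mulmx1 mul1r -/l.
have [B HB] : exists B : nat, forall k : nat, (B <= k)%N -> Y b (l - k%:~R) 0 = 0.
  have bnd (j : 'I_J) : exists B : nat, forall (k : nat) (M' : int),
      l - k%:~R = lam j + M'%:~R -> - v%:Z <= M' -> (k < B)%N.
    have [[M1 lM1]|nM] := pselect (exists M1 : int, l = lam j + M1%:~R); last first.
      exists 0%N => k M' E; case: nM; exists (M' + k%:Z).
      by rewrite intrD addrA -E subrK.
    exists (absz (M1 + v%:Z)).+1 => k M'; rewrite lM1 -addrA -intrB.
    by move=> /addrI/intr_Cinj <-; lia.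
  have [f Hf] := choice bnd.
  exists (\max_j f j) => k Bk; apply/matrixP => x' y'; rewrite Y_entry [RHS]mxE.
  case: eqP => // _; rewrite FxL_entry; case: pselect => // H; case: cid => M' /= E.
  have [vM|Mv] := lerP (- v%:Z) M'; last by rewrite F0 // mul0mx mxE.
  have := Hf _ k M' E vM; rewrite ltnNge.
  by rewrite (leq_trans _ Bk) // (leq_bigmax (block y')).
pose N := maxn B m.+1.
rewrite (@lemul_laurent _ _ _ _ _ _ [seq (i%:Z : int) | i <- iota 0 N]); first last.
- move=> [k|k] kr; last by rewrite mul0mx.
  rewrite HB ?mulmx0 // leqNgt; apply: contra kr => kB.
  by rewrite map_f // mem_iota add0n /N leq_max kB.
- by rewrite map_inj_uniq ?iota_uniq // => i j [].
have -> : iota 0 N = index_iota 0 N by rewrite /index_iota subn0.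
rewrite big_map big_mkord summxE => EQ.
have AF (i : nat) : (A i *m Y b (l - i%:~R) 0) x y = (A i *m F (M - i%:Z)) x y.
  rewrite !mxE; apply: eq_bigr => s _; congr (_ * _).
  have -> : l - i%:~R = lam (block y) + (M - i%:Z)%:~R by rewrite /l intrB addrA.
  by rewrite Yint jordan_power0 mulmx1.
have mN : (m.+1 <= N)%N by rewrite leq_maxr.
have -> : convol A Fs m x y = \sum_(i < N) (A i *m Y b (l - i%:~R) 0) x y.
  rewrite /convol summxE -(big_mkord xpredT (fun i => (A i *m Fs (m - i)%N) x y)).
  rewrite -(big_mkord xpredT (fun i => (A i *m Y b (l - i%:~R) 0) x y)).
  rewrite [RHS](big_cat_nat (n := m.+1)) //= [X in _ = _ + X]big_nat_cond.
  rewrite [X in _ = _ + X]big1 ?addr0 => [|i /andP[/andP[mi _] _]]; last first.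
    by rewrite AF F0 ?mulmx0 ?mxE // /M; lia.
  rewrite !big_mkord; apply: eq_bigr => i _; rewrite AF /Fs; congr ((_ *m F _) _ _).
  by have := ltn_ord i; rewrite /M; lia.
rewrite -EQ [RHS]mxE mul_mx_diag.
have shE : xshift (fun k => k%:R *: Fs k + Fs k *m monodromy_exponent v) m x y =
   (lam (block y) + (M - 1)%:~R) * F (M - 1) x y + (F (M - 1) *m jordan_power 1) x y.
  case: m @M {l e1 e2 HB N EQ AF mN Yint B} => [|k] M /=.
    have -> : F (M - 1) = 0 by apply: F0; rewrite /M; lia.
    by rewrite mul0mx !mxE mulr0 addr0.
  have -> : M - 1 = k%:Z - v%:Z by rewrite /M; lia.
  rewrite /monodromy_exponent mulmxDr addrA mxE; congr (_ + _).
  rewrite mxE mul_mx_diag !mxE intrB /Fs -!pmulrn; ring.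
rewrite shE -[LHS]addrA; congr (_ + _).
by rewrite [RHS]mxE [X in _ = _ * X]mxE mulrC.
Qed.

End Solution.
End Unpack.

(** * The germ at the origin *)

Section InitialSolution.
Variables (R : realType) (n : nat).
Local Notation C := (Cplx R).
Local Notation V := 'M[C]_n.
Variables (Om : set C) (N : V -> V) (kap : nat -> V -> V) (res : C -> V -> V).
Variables (b ck : R).
Hypothesis td : transport_data Om N kap res b ck.

(** The coefficients of the inhomogeneity of the convolution equation
    satisfied by the Borel transform of the series sum_i f_i x^(i+1). *)
Definition source (f : nat -> V) (m : nat) : V :=
  (if m is m'.+1 then m%:R *: f m' else 0) - N (f m) - \sum_(i < m) kap (m.-1 - i) (f i).

(** The factorial growth of the f_i makes phi converge; in the coefficient of
    order m of s_k it is compensated by the factor i! / m! with i < m, which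
    leaves the geometric growth in k of the kernel and of the source. *)
Lemma initial_solution (f : nat -> V) (B K S : R) (e : R) :
  0 <= B -> 1 <= K -> 0 <= S ->
  (forall i, mnorm (f i) <= B * K ^+ i * (i`!)%:R) ->
  (forall m, mnorm (source f m) <= S * b ^+ m) ->
  0 < e -> (forall z, Om z -> z != 0 -> e <= modulus z) ->
  exists (r0 S0 : R) (sg0 : C -> nat -> V) (ph0 : C -> V), 0 < r0 /\
    forall xi, modulus xi < r0 ->
     ([/\ Om xi -> xi = 0, state_bound b (sg0 xi) S0,
      xi != 0 -> flat_at kap res sg0 xi /\ ph0 xi = res xi (sg0 xi 0%N) &
      exists d, hasder ph0 xi d] /\
      is_sum (fun k => xi ^+ k *: ((k`!%:R)^-1 *: f k)) (ph0 xi)).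
Proof.
move=> B0 K1 S0 fB sB e0 Om_sep.
have b1 := td_b td; have b0 := b_ge0 td; have ck0 := td_ck td.
have K0 : 0 <= K := le_trans ler01 K1.
pose beta := b * K.
have beta1 : 1 <= beta by rewrite mulr_ege1.
have beta0 : 0 < beta := lt_le_trans ltr01 beta1.
have bbeta : b <= beta by rewrite ler_peMr.
have Kbeta : K <= beta by rewrite ler_peMl.
pose ph k := (k`!%:R : C)^-1 *: f k.
pose sg j k := (k`!%:R : C)^-1 *:
  (source f (j + k) + \sum_(i < k) kap (j + k.-1 - i) (f i)).
have fact_neq0 k : (k`!%:R : C) != 0 by rewrite pnatr_eq0 -lt0n fact_gt0.
pose r := Num.min (4 * beta)^-1 e.
have r0 : 0 < r by rewrite lt_min e0 invr_gt0 mulr_gt0.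
have rb : r * beta <= 4^-1.
  apply: (@le_trans _ _ ((4 * beta)^-1 * beta)).
    by rewrite ler_wpM2r ?(ltW beta0) // ge_min lexx.
  by rewrite invfM divfK ?lt0r_neq0.
have rec j k : k.+1%:R *: sg j k.+1 = sg j.+1 k + kap j (ph k).
  rewrite /sg /ph (td_kap_scale td) -scalerDr scalerA factS natrM invfM mulrA divff ?mul1r.
    congr (_ *: _); rewrite big_ord_recr /= addnK addSnnS addrA; congr (_ + _ + _).
    apply: eq_bigr => i _.
    by congr (kap (_ - _) _); case: k i => [[]//|k i]; rewrite addSnnS.
  by rewrite pnatr_eq0.
have init : 0 *: ph 0%N - N (ph 0%N) = sg 0%N 0%N.
  by rewrite /sg /ph /source !big_ord0 fact0 invr1 !scale1r scale0r subr0 addr0.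
have NZ c X : N (c *: X) = c *: N X by exact: td_N_scale td _ _.
have eqs k : 0 *: ph k.+1 - N (ph k.+1) + ph k = sg 0%N k.+1.
  rewrite /sg /source /= !add0n subrK scale0r add0r /ph NZ addrC.
  rewrite scalerBr; congr (_ - _).
  by rewrite scalerA factS natrM invfM mulrC mulrA divff ?mul1r // pnatr_eq0.
have phB k : mnorm (ph k) <= B * beta ^+ k.
  rewrite mnormZ modulusV modulus_nat.
  rewrite ler_pdivrMl ?ltr0n ?fact_gt0 // mulrC.
  apply: le_trans (fB k) _; rewrite ler_wpM2r // ler_wpM2l //.
  by rewrite lerXn2r ?nnegrE ?(ltW beta0).
have sgB j k : mnorm (sg j k) <= (S + ck * B) * b ^+ j * beta ^+ k.
  rewrite mnormZ modulusV modulus_nat ler_pdivrMl ?ltr0n ?fact_gt0 //.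
  apply: le_trans (mnormD _ _) _; rewrite mulrDl mulrDl mulrDr; apply: lerD.
    apply: le_trans (sB _) _.
    have -> : k`!%:R * (S * b ^+ j * beta ^+ k) = S * b ^+ j * (k`!%:R * beta ^+ k) by ring.
    rewrite exprD mulrA ler_wpM2l ?mulr_ge0 ?exprn_ge0 //.
    apply: (@le_trans _ _ (beta ^+ k)); first by rewrite lerXn2r ?nnegrE ?(ltW beta0).
    by rewrite ler_peMl ?exprn_ge0 ?(ltW beta0) // ler1n fact_gt0.
  case: k => [|k].
    rewrite big_ord0 mnorm0 !mulr_ge0 ?exprn_ge0 ?(ltW beta0) //.
  apply: le_trans (mnorm_sum _ _ _) _.
  apply: (@le_trans _ _ (\sum_(i < k.+1) ck * B * b ^+ j * beta ^+ k * (k`!)%:R)).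
    apply: ler_sum => i _; apply: le_trans (td_kap_bound td _ _) _ => /=.
    have ik : (i <= k)%N by rewrite -ltnS.
    apply: le_trans (ler_wpM2l _ (fB i)) _; first by rewrite mulr_ge0 ?exprn_ge0.
    have -> : ck * b ^+ (j + k - i) * (B * K ^+ i * i`!%:R) =
      ck * B * b ^+ j * (b ^+ (k - i) * K ^+ i) * i`!%:R.
      by rewrite -addnBA // exprD; ring.
    apply: ler_pM => //; rewrite ?ler_nat ?leq_fact //.
      by rewrite !mulr_ge0 ?exprn_ge0.
    rewrite ler_wpM2l ?mulr_ge0 ?exprn_ge0 //.
    have -> : beta ^+ k = beta ^+ (k - i) * beta ^+ i by rewrite -exprD subnK.
    by apply: ler_pM; rewrite ?exprn_ge0 // lerXn2r ?nnegrE ?(ltW beta0).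
  rewrite sumr_const card_ord -[leLHS]mulr_natr factS natrM.
  have -> : k.+1%:R * k`!%:R * (ck * B * b ^+ j * beta ^+ k.+1) =
     ck * B * b ^+ j * beta ^+ k.+1 * k`!%:R * k.+1%:R by ring.
  rewrite ler_wpM2r // ler_wpM2r // ler_wpM2l ?mulr_ge0 ?exprn_ge0 //.
  by rewrite exprS ler_peMl ?exprn_ge0 ?(ltW beta0).
have SB0 : 0 <= S + ck * B by rewrite addr_ge0 ?mulr_ge0.
have [Sg [Ph H]] := @power_solution R n Om N kap res b ck td 0 ph sg (S + ck * B) B beta r
  SB0 B0 beta1 r0 rb sgB phB rec init eqs.
exists r, (2 * (S + ck * B)), Sg, Ph; split=> // xi xr.
have xr' : modulus (xi - 0) < r by rewrite subr0.
have [bs E0 der dP [sm _]] := H _ xr'.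
have Omx : Om xi -> xi = 0.
  move=> /Om_sep He; apply/eqP; apply: contraLR xr => /He ex.
  by rewrite -leNgt ge_min ex orbT.
split; last by rewrite subr0 in sm.
split; [exact: Omx|exact: bs| |exact: dP].
move=> x0; have nO : ~ Om xi by move=> /Omx x0'; rewrite x0' eqxx in x0.
have PE : Ph xi = res xi (Sg xi 0%N) by rewrite -E0 (td_res_left td).
by split; [move=> k; rewrite -PE; exact: der|exact: PE].
Qed.

End InitialSolution.

(** * Topology in terms of the modulus *)

Section Topology.
Variable R : realType.
Local Notation C := (Cplx R).

Lemma real_pos_cplx (e : C) : 0 < e -> exists2 d : R, 0 < d & e = d%:C%C.
Proof.
case: e => x y; rewrite ltcE /= => /andP[/eqP-> x0]; exists x => //.
Qed.

Lemma cvg_modulus (T : Type) (F : set_system T) (FF : Filter F) (f : T -> C) (l : C) :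
  (f @ F --> l) <-> (forall e : R, 0 < e -> \forall t \near F, modulus (f t - l) < e).
Proof.
split=> [/cvgrPdist_lt H e e0|H].
  have e0' : 0 < (e%:C%C : C) by rewrite ltcR.
  have := H _ e0'; apply: filterS => t.
  by rewrite distrC modulus_norm ltcR.
apply/cvgrPdist_lt => e /real_pos_cplx[d d0 ->].
by apply: filterS (H d d0) => t; rewrite distrC modulus_norm ltcR.
Qed.

Lemma nbhs_modulus (z : C) (P : set C) :
  (exists2 e : R, 0 < e & forall w, modulus (w - z) < e -> P w) -> nbhs z P.
Proof.
move=> [e e0 H]; apply/nbhs_ballP; exists (e%:C%C : C) => /=; first by rewrite ltcR.
by move=> w; rewrite /ball /= distrC modulus_norm ltcR => /H.
Qed.

Lemma within01_cont (g : R -> C) : {within `[0, 1]%classic, continuous g} -> continuous01 g.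
Proof.
move=> /subspace_continuousP H t t01 e e0.
have := H t; rewrite /= in_itv /= t01 => /(_ isT) /cvg_modulus/(_ e e0).
rewrite near_withinE => /nbhs_ballP[d /= d0 Hd].
exists d => // s s01 st; apply: Hd; last by rewrite /= in_itv.
by rewrite /ball /= distrC.
Qed.

Lemma cont_within01 (g : R -> C) : continuous01 g -> {within `[0, 1]%classic, continuous g}.
Proof.
move=> H; apply/subspace_continuousP => t /=; rewrite in_itv /= => t01.
apply/cvg_modulus => e e0; have [d d0 Hd] := H t t01 e e0.
rewrite near_withinE; apply/nbhs_ballP; exists d => //= s.
by rewrite /ball /= distrC => st; rewrite in_itv /= => s01; exact: Hd.
Qed.

Lemma within_square_cont (H : R * R -> C) :
  {within `[0, 1]%classic `*` `[0, 1]%classic, continuous H} ->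
  forall s t, 0 <= s <= 1 -> 0 <= t <= 1 -> forall e, 0 < e -> exists2 d : R, 0 < d &
     forall s' t', 0 <= s' <= 1 -> 0 <= t' <= 1 -> `|s' - s| < d -> `|t' - t| < d ->
       modulus (H (s', t') - H (s, t)) < e.
Proof.
move=> /subspace_continuousP HH s t s01 t01 e e0.
have := HH (s, t); rewrite /= !in_itv /= s01 t01 => /(_ (conj isT isT)).
move=> /cvg_modulus/(_ e e0); rewrite near_withinE => /nbhs_ballP[d /= d0 Hd].
exists d => // s' t' s'01 t'01 ss tt; apply: Hd.
  by split; rewrite /ball /= distrC.
by split; rewrite /= in_itv.
Qed.

Lemma square_cont_snd (g : R -> C) : continuous01 g ->
  {within `[0, 1]%classic `*` `[0, 1]%classic, continuous (fun u : R * R => g u.2)}.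
Proof.
move=> H; apply/subspace_continuousP => -[s t] /= [].
rewrite !in_itv /= => s01 t01.
apply/cvg_modulus => e e0; have [d d0 Hd] := H t t01 e e0.
rewrite near_withinE; apply/nbhs_ballP; exists d => //= -[s' t'] [_ /=].
by rewrite /ball /= distrC => tt [_]; rewrite /= in_itv /= => t'01; exact: Hd.
Qed.

Lemma hasder_derivable n m (f : C -> 'M[C]_(n, m)) z d i j :
  hasder f z d -> derivable (fun w => f w i j) z 1.
Proof.
move=> fd; apply/cvg_ex; exists (d i j); apply/cvg_modulus => e e0.
have e2 : 0 < e / 2 by rewrite divr_gt0.
have [h h0 H] := fd _ e2.
apply/nbhs_ballP; exists (h%:C%C : C) => /=; first by rewrite ltcR.
move=> k; rewrite /ball /= sub0r normrN modulus_norm ltcR => kh k0.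
have := H (k + z); rewrite addrK => /(_ kh) {}H.
have nk : 0 < modulus k by rewrite modulus_gt0.
have -> : k^-1 *: (f (k *: 1 + z) i j - f z i j) - d i j =
   k^-1 * ((f (k + z) - f z - k *: d) i j).
  have -> : k *: (1 : C) = k by rewrite /GRing.scale /= mulr1.
  by rewrite !mxE /GRing.scale /=; field.
rewrite modulusM modulusV mulrC ltr_pdivrMr //.
apply: le_lt_trans (mnorm_entry _ _ _) _.
by apply: le_lt_trans H _; rewrite ltr_pM2r // ltr_pdivrMr // mulr_natr mulr2n ltrDl.
Qed.

End Topology.

(** * Continuation along paths and homotopy classes *)

Section Continuation.
Variable R : realType.
Local Notation C := (Cplx R).
Variables (Om : set C) (S : sheets Om).
Hypothesis Om0 : Om 0.

Lemma admissible_cont g : admissible Om g -> continuous01 g.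
Proof. by case=> /within01_cont. Qed.

Lemma admissible_lift g : admissible Om g ->
  exists2 L, path_lift (S := S) g 0 1 L & L 0 = sheet_state0 S.
Proof.
move=> ag; have [_ g0 gO] := ag.
apply: (@lift_exists R Om S Om0 g) => //; first exact: admissible_cont.
Qed.

Lemma homotopic_refl g : admissible Om g -> homotopic Om g g.
Proof.
move=> ag; exists (fun u => g u.2); split=> //.
  exact/square_cont_snd/admissible_cont.
Qed.

Lemma homotopic_end g g' : homotopic Om g g' -> g' 1 = g 1.
Proof.
case=> H [_ H01 H1 _].
have [|_ <-] := H01 1; first by rewrite ler01 lexx.
have [|<- _] := H01 1; first by rewrite ler01 lexx.
by rewrite !H1 ?lexx ?ler01.
Qed.

Lemma continuous01_eq (g g' : R -> C) : (forall t, 0 <= t <= 1 -> g t = g' t) ->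
  continuous01 g -> continuous01 g'.
Proof.
move=> gg cg t t01 e e0; have [d d0 H] := cg t t01 e e0.
by exists d => // s s01 st; rewrite -!gg //; exact: H.
Qed.

Lemma homotopic_admissible g g' : homotopic Om g g' -> admissible Om g.
Proof.
case=> H [cH H01 H1 aH].
have gE t : 0 <= t <= 1 -> H (0, t) = g t by move=> /H01[].
have [|cg g0 gO] := aH 0; first by rewrite lexx ler01.
split.
- apply/cont_within01/(@continuous01_eq (fun t => H (0, t))) => //.
  exact: within01_cont.
- by rewrite -gE ?lexx ?ler01.
move=> t t01 Ot s /andP[s0 st].
have s01 : 0 <= s <= 1 by rewrite s0; case/andP: t01 => _; exact: le_trans.
by rewrite -gE // (gO t) ?gE // s0.
Qed.

(** Every stage of the homotopy is admissible, hence has a lift, and the lifts of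
    nearby stages end on the same sheet. *)
Lemma lift_homotopic g g' L L' : homotopic Om g g' ->
  path_lift (S := S) g 0 1 L -> L 0 = sheet_state0 S -> path_lift (S := S) g' 0 1 L' -> L' 0 = sheet_state0 S ->
  L 1 = L' 1.
Proof.
case=> H [cH H01 H1 aH] Lg L0 Lg' L'0.
have ex (s : R) : exists Ls, 0 <= s <= 1 ->
    path_lift (S := S) (fun t => H (s, t)) 0 1 Ls /\ Ls 0 = sheet_state0 S.
  have [s01|ns] := boolP (0 <= s <= 1); last by exists L.
  by have [Ls ? ?] := admissible_lift (aH s s01); exists Ls.
have [Ls HL] := choice ex.
have i0 : 0 <= (0 : R) <= 1 by rewrite lexx ler01.
have i1 : 0 <= (1 : R) <= 1 by rewrite ler01 lexx.
have gE t : 0 <= t -> t <= 1 -> H (0, t) = g t by move=> t0 t1; have [|] := H01 t; rewrite ?t0.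
have g'E t : 0 <= t -> t <= 1 -> H (1, t) = g' t by move=> t0 t1; have [|] := H01 t; rewrite ?t0.
have -> : L 1 = Ls 0 1.
  have [l0 e0] := HL 0 i0.
  by apply: (lift_uniq ler01 Lg (lift_eq gE l0)); rewrite L0 e0.
have -> : L' 1 = Ls 1 1.
  have [l1 e1] := HL 1 i1.
  by apply: (lift_uniq ler01 Lg' (lift_eq g'E l1)); rewrite L'0 e1.
apply: (@lift_homotopy R Om S (fun s t => H (s, t)) Ls).
- move=> s t s01 t01 e e0; exact: (within_square_cont cH).
- by move=> s /aH[].
- by move=> s s01; rewrite !H1.
- by move=> s /HL[].
- by move=> s /HL[].
Qed.

Variables (n : nat) (out : C -> sheet_state S -> 'M[C]_n).

(** A lift of some element of the class is chosen; the value is independent of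
    the choice by homotopy invariance. *)
Definition continuation (i j : 'I_n) (P : pathclass R) : C :=
  let X := [set gL : (R -> C) * (R -> sheet_state S) |
    [/\ P gL.1, path_lift (S := S) gL.1 0 1 gL.2 & gL.2 0 = sheet_state0 S]] in
  if pselect (X !=set0) is left H then
    let: (g, L) := projT1 (cid H) in out (g 1) (L 1) i j
  else 0.

Lemma continuation_lift i j g L : admissible Om g ->
  path_lift (S := S) g 0 1 L -> L 0 = sheet_state0 S ->
  continuation i j (hclass Om g) = out (g 1) (L 1) i j.
Proof.
move=> ag Lg L0; rewrite /continuation; case: pselect => [H|[]]; last first.
  by exists (g, L); split=> //; exact: homotopic_refl.
case: cid => -[g' L'] /= [gg' Lg' L'0].
by rewrite (homotopic_end gg') (lift_homotopic gg' Lg L0 Lg' L'0).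
Qed.

Lemma half_itv (t : R) : 0 <= t <= 1 -> t <= 2^-1 -> 0 <= 2 * t <= 1.
Proof. by move=> /andP[t0 t1] t2; apply/andP; split; lra. Qed.

Lemma half_itv' (t : R) : 0 <= t <= 1 -> 2^-1 <= t -> 0 <= 2 * t - 1 <= 1.
Proof. by move=> /andP[t0 t1] t2; apply/andP; split; lra. Qed.

Lemma concat_cont (g h : R -> C) : continuous01 g -> continuous01 h -> g 1 = h 0 ->
  continuous01 (concat g h).
Proof.
move=> cg ch gh t t01 e e0; rewrite /concat.
have [t2|t2] := lerP t 2^-1; last first.
  have [d d0 Hd] := ch _ (half_itv' t01 (ltW t2)) e e0.
  exists (Num.min (d / 2) (t - 2^-1)); first by rewrite lt_min divr_gt0 // subr_gt0.
  move=> s s01; rewrite lt_min => /andP[sd s2].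
  have {}s2 : 2^-1 < s by have := ler_norm (t - s); rewrite distrC; lra.
  rewrite leNgt s2 /=; apply: Hd; first exact: half_itv' (ltW s2).
  have -> : 2 * s - 1 - (2 * t - 1) = 2 * (s - t) by ring.
  by rewrite normrM ger0_norm // mulrC -ltr_pdivlMr.
have [d d0 Hd] := cg _ (half_itv t01 t2) e e0.
have near s : 0 <= s <= 1 -> s <= 2^-1 -> `|s - t| < d / 2 ->
    modulus (g (2 * s) - g (2 * t)) < e.
  move=> s01 s2 st; apply: Hd; first exact: half_itv.
  by rewrite -mulrBr normrM ger0_norm // mulrC -ltr_pdivlMr.
move: t2; rewrite le_eqVlt => /orP[/eqP t2|t2].
  have t2' : 2^-1 <= t by rewrite t2.
  have [d' d'0 Hd'] := ch _ (half_itv' t01 t2') e e0.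
  exists (Num.min (d / 2) (d' / 2)); first by rewrite lt_min !divr_gt0.
  move=> s s01; rewrite lt_min => /andP[sd sd'].
  case: ifP => s2; first exact: near.
  have s2' : 2^-1 < s by rewrite ltNge s2.
  have tt : 2 * t - 1 = 0 by rewrite t2 divff // subrr.
  have -> : g (2 * t) = h (2 * t - 1) by rewrite tt -gh t2 divff.
  apply: Hd'; first exact: half_itv' (ltW s2').
  have -> : 2 * s - 1 - (2 * t - 1) = 2 * (s - t) by ring.
  by rewrite normrM ger0_norm // mulrC -ltr_pdivlMr.
exists (Num.min (d / 2) (2^-1 - t)); first by rewrite lt_min divr_gt0 // subr_gt0.
move=> s s01; rewrite lt_min => /andP[sd s2].
have {}s2 : s <= 2^-1 by have := ler_norm (s - t); lra.
by rewrite s2; exact: near.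
Qed.

Lemma concat_left (g h : R -> C) t : t <= 2^-1 -> concat g h t = g (2 * t).
Proof. by rewrite /concat => ->. Qed.

Lemma concat_right (g h : R -> C) t : g 1 = h 0 -> 2^-1 <= t -> concat g h t = h (2 * t - 1).
Proof.
move=> gh; rewrite /concat le_eqVlt => /orP[/eqP<-|t2].
  by rewrite lexx divff // gh subrr.
by rewrite leNgt t2.
Qed.

Lemma lift_concat g h L L' : continuous01 g -> continuous01 h -> g 1 = h 0 ->
  path_lift (S := S) g 0 1 L -> path_lift (S := S) h 0 1 L' -> L 1 = L' 0 ->
  path_lift (S := S) (concat g h) 0 1 (fun t => if t <= 2^-1 then L (2 * t + 0) else L' (2 * t - 1)).
Proof.
move=> cg ch gh Lg Lh LL; apply: (@lift_glue _ _ _ _ 0 2^-1 1 (fun t => L (2 * t + 0))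
  (fun t => L' (2 * t - 1))) => //; rewrite ?invr_ge0 ?invf_le1 ?ler1n //.
- exact: concat_cont.
- apply: (@lift_eq _ _ _ (fun t => g (2 * t + 0))).
    by move=> t _ t2; rewrite concat_left // addr0.
  by apply: lift_affine => //; rewrite mulr0 addr0 divff // addr0.
- apply: (@lift_eq _ _ _ (fun t => h (2 * t + -1))).
    by move=> t t2 _; rewrite concat_right.
  by apply: lift_affine => //; rewrite divff // subrr mulr1 (_ : 2 - 1 = 1) //; ring.
by rewrite divff // addr0 subrr.
Qed.

Lemma lift_concat_left g h L : path_lift (S := S) (concat g h) 0 1 L ->
  path_lift (S := S) g 0 1 (fun t => L (2^-1 * t + 0)).
Proof.
move=> Lc; apply: (@lift_eq _ _ _ (fun t => concat g h (2^-1 * t + 0))).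
  move=> t t0 t1; rewrite concat_left addr0; last by lra.
  by rewrite mulrA divff // mul1r.
apply: lift_affine; first by rewrite invr_gt0.
by apply: lift_sub Lc; lra.
Qed.

Lemma lift_concat_right g h L : g 1 = h 0 -> path_lift (S := S) (concat g h) 0 1 L ->
  path_lift (S := S) h 0 1 (fun t => L (2^-1 * t + 2^-1)).
Proof.
move=> gh Lc; apply: (@lift_eq _ _ _ (fun t => concat g h (2^-1 * t + 2^-1))).
  move=> t t0 t1; rewrite concat_right //; last by lra.
  by congr h; lra.
apply: lift_affine; first by rewrite invr_gt0.
by apply: lift_sub Lc; lra.
Qed.

Lemma segment_point (z w : C) t : segment z w t = point_on z w t.
Proof. by []. Qed.

Lemma segment_cont (z w : C) : continuous01 (segment z w).
Proof.
move=> t _ e e0; have m0 := modulus_ge0 (w - z).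
exists (e / (modulus (w - z) + 1)); first by rewrite divr_gt0 // ltr_wpDl.
move=> s _ st; rewrite !segment_point point_on_dist.
apply: le_lt_trans (_ : `|s - t| * (modulus (w - z) + 1) < e).
  by rewrite ler_wpM2l // lerDl.
by rewrite -ltr_pdivlMr // ltr_wpDl.
Qed.

Lemma segment_ball (z w : C) (r t : R) : modulus (w - z) < r -> 0 <= t <= 1 ->
  modulus (segment z w t - z) < r.
Proof.
move=> wr /andP[t0 t1]; apply: le_lt_trans wr.
by rewrite -{2}(point_on0 z w) segment_point point_on_dist subr0 ger0_norm //
  ler_piMl ?modulus_ge0.
Qed.

Hypothesis out_hasder : forall i xi, sheet_dom (s := S) i xi ->
  exists d, hasder (fun w => out w (sheet_val i w)) xi d.

Hypothesis chart_disc : forall i xi, sheet_dom (s := S) i xi -> exists2 r : R, 0 < r &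
  forall w, modulus (w - xi) < r -> sheet_dom i w /\ (Om w -> w = 0).

(** The last chart met by the lift of g also carries a short segment starting at
    the end of g. Such a segment misses the origin, unless g rests there and the
    segment is its first departure. *)
Lemma continuation_prolong g : admissible Om g -> exists k, exists2 r : R, 0 < r &
  forall w, modulus (w - g 1) < r -> sheet_dom (s := S) k w /\
    forall i j, continuation i j (hclass Om (concat g (segment (g 1) w))) =
      out w (sheet_val k w) i j.
Proof.
move=> ag; have [L Lg L0] := admissible_lift ag.
have [k [e e0 Hk]] := Lg 1 ler01 (lexx 1).
have [dk Lk] : sheet_dom k (g 1) /\ L 1 = sheet_val k (g 1) by apply: Hk; rewrite ?ler01 ?lexx ?subrr ?normr0.
have [r r0 Hr] := chart_disc dk.
pose r' := if g 1 == 0 then r else Num.min r (modulus (g 1)).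
have r'0 : 0 < r'.
  by rewrite /r'; case: eqP => // /eqP g1; rewrite lt_min r0 modulus_gt0.
have r'r : r' <= r by rewrite /r'; case: ifP => // _; rewrite ge_min lexx.
exists k, r' => // w wr'; have wr : modulus (w - g 1) < r := lt_le_trans wr' r'r.
split=> [|i j]; first by have [] := Hr w wr.
have [cg g0 gO] := ag; have {}cg := within01_cont cg.
have gh : g 1 = segment (g 1) w 0 by rewrite segment_point point_on0.
have ch := @segment_cont (g 1) w.
have ac : admissible Om (concat g (segment (g 1) w)).
  split; first exact/cont_within01/concat_cont.
    by rewrite concat_left ?mulr0 // invr_ge0.
  move=> t t01; have [t2|t2] := lerP t 2^-1.
    rewrite concat_left // => Ot s /andP[s0 st].
    have s2 : s <= 2^-1 by exact: le_trans t2.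
    rewrite concat_left //; apply: (gO (2 * t)) => //; first exact: half_itv.
    by rewrite mulr_ge0 // ler_pM2l.
  rewrite concat_right ?ltW //; set u := 2 * t - 1 => Ot.
  have u01 : 0 <= u <= 1 by exact: half_itv' (ltW t2).
  have u0 : 0 < u by rewrite /u; lra.
  have q0 : segment (g 1) w u = 0.
    exact: (Hr _ (segment_ball wr u01)).2 Ot.
  have g10 : g 1 = 0.
    apply/eqP; apply: contraT => g10.
    have := segment_ball wr' u01; rewrite q0 sub0r modulusN /r' (negbTE g10).
    by rewrite lt_min ltxx andbF.
  have gz s : 0 <= s -> s <= 1 -> g s = 0.
    by move=> s0 s1; apply: (gO 1); rewrite ?g10 ?ler01 ?lexx ?s0.
  have w0 : w = 0.
    move: q0; rewrite /segment g10 add0r subr0 => /eqP.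
    rewrite mulf_eq0 => /orP[/eqP[uE]|/eqP//].
    by rewrite uE ltxx in u0.
  move=> s /andP[s0 st]; have [s2|s2] := lerP s 2^-1.
    by rewrite concat_left // gz // ?mulr_ge0 //; lra.
  by rewrite concat_right ?ltW // /segment g10 w0 subrr mulr0 addr0.
have Lh : path_lift (S := S) (segment (g 1) w) 0 1 (fun t => sheet_val k (segment (g 1) w t)).
  by apply: lift_chart => t t0 t1; apply: (Hr _ _).1; apply: segment_ball => //; rewrite t0.
rewrite (continuation_lift i j ac (lift_concat cg ch gh Lg Lh _)) /=; last 2 first.
- by rewrite segment_point point_on0.
- by rewrite invr_ge0 ler0n mulr0 addr0.
have n12 : (1 <= 2^-1 :> R) = false by apply/negbTE; rewrite -ltNge; lra.
rewrite n12 concat_right //; last by rewrite invf_le1 ?ler1n.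
have -> : 2 * 1 - 1 = 1 :> R by ring.
by rewrite !segment_point point_on1.
Qed.

Lemma continuation_resurgent i j : resurgent Om (continuation i j).
Proof.
move=> g ag; have [k [r r0 Hr]] := continuation_prolong ag.
apply: nbhs_modulus; exists r => // w wr.
have [dw _] := Hr w wr; have [d Hd] := out_hasder dw.
pose M w' : 'M[C]_n :=
  \matrix_(i', j') continuation i' j' (hclass Om (concat g (segment (g 1) w'))).
have HM : hasder M w d.
  apply: (@hasder_locally _ _ _ _ M w d (r - modulus (w - g 1)) _ _ Hd).
    by rewrite subr_gt0.
  move=> w' ww; have [|_ E] := Hr w'.
    by apply: le_lt_trans (modulus_dist _ w _) _; rewrite -ltrBrDr.
  by apply/matrixP => i' j'; rewrite mxE E.
have := @hasder_derivable _ _ _ M w d i j HM; congr (derivable _ w 1).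
by apply/funext => w'; rewrite mxE.
Qed.

Lemma continuation_segment i j (k : sheet_chart S) xi (r : R) :
  k = sheet_chart0 S -> (forall w, modulus w < r -> sheet_dom k w /\ (Om w -> w = 0)) ->
  modulus xi < r -> continuation i j (hclass Om (segment 0 xi)) = out xi (sheet_val k xi) i j.
Proof.
move=> k0 Hk xr.
have on t : 0 <= t <= 1 -> modulus (segment 0 xi t) < r.
  by move=> t01; have := @segment_ball 0 xi r t; rewrite !subr0 => /(_ xr t01).
have as_ : admissible Om (segment 0 xi).
  split; first exact/cont_within01/segment_cont.
    by rewrite segment_point point_on0.
  have segE s : segment 0 xi s = s%:C%C * xi by rewrite /segment add0r subr0.
  move=> t t01 Ot s /andP[s0 st]; have /eqP := (Hk _ (on t t01)).2 Ot.
  rewrite !segE mulf_eq0 => /orP[/eqP[t0]|/eqP->]; last by rewrite mulr0.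
  have -> : s = 0 by apply/eqP; rewrite eq_le s0 -t0 st.
  by rewrite mul0r.
have Ls : path_lift (S := S) (segment 0 xi) 0 1 (fun t => sheet_val k (segment 0 xi t)).
  by apply: lift_chart => t t0 t1; apply: (Hk _ (on t _)).1; rewrite t0.
rewrite (continuation_lift i j as_ Ls).
  by rewrite !segment_point point_on1.
by rewrite segment_point point_on0 k0 sheets_val0.
Qed.

End Continuation.

(** * Exponential growth on sectors *)

Section Growth.
Variable R : realType.
Local Notation C := (Cplx R).

Lemma trig_lipschitz (f df : R -> R) : (forall x : R, is_derive x 1 f (df x)) ->
  (forall x, `|df x| <= 1) -> continuous f -> forall x y, `|f x - f y| <= `|x - y|.
Proof.
move=> der bnd cf x y.
wlog xy : x y / x <= y.
  move=> H; have [xy|yx] := leP x y; first exact: H.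
  by rewrite distrC [leRHS]distrC H // ltW.
have [|c _ E] := @MVT_segment R f df x y xy (fun x _ => der x).
  exact: continuous_subspaceT.
by rewrite distrC E [leRHS]distrC normrM ler_piMl.
Qed.

Lemma polar_dist (c : C) (r r' th th' : R) : 0 <= r' ->
  modulus (polar c r th - polar c r' th') <= 2 * `|r - r'| + 2 * r' * `|th - th'|.
Proof.
move=> r0.
have cosL : `|cos th - cos th'| <= `|th - th'|.
  apply: (trig_lipschitz (@is_derive_cos R) _ (@continuous_cos R)) => x.
  by rewrite normrN ler_norml sin_geN1 sin_le1.
have sinL : `|sin th - sin th'| <= `|th - th'|.
  apply: (trig_lipschitz (@is_derive_sin R) _ (@continuous_sin R)) => x.
  by rewrite ler_norml cos_geN1 cos_le1.
have c1 : `|cos th| <= 1 by rewrite ler_norml cos_geN1 cos_le1.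
have s1 : `|sin th| <= 1 by rewrite ler_norml sin_geN1 sin_le1.
apply: le_trans (modulus_le_ReIm _) _.
have -> : polar c r th - polar c r' th' =
    ((r * cos th - r' * cos th') +i* (r * sin th - r' * sin th'))%C.
  by rewrite /polar; apply/eqP; rewrite eq_complex /=; case: c => x y /=; apply/andP; split; apply/eqP; ring.
have aux (u u' : R) : `|u| <= 1 -> `|u - u'| <= `|th - th'| ->
    `|r * u - r' * u'| <= `|r - r'| + r' * `|th - th'|.
  move=> u1 uu; have -> : r * u - r' * u' = (r - r') * u + r' * (u - u') by ring.
  apply: le_trans (ler_normD _ _) _; rewrite !normrM (ger0_norm r0).
  by apply: lerD; [rewrite ler_piMr|rewrite ler_wpM2l].
by have := aux _ _ c1 cosL; have := aux _ _ s1 sinL; rewrite /=; lra.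
Qed.

Lemma convex_gt (z x y v : R) : z < x -> z < y -> 0 <= v <= 1 -> z < x + v * (y - x).
Proof.
move=> zx zy /andP[v0 v1]; have [xy|yx] := leP x y.
  by apply: lt_le_trans zx _; rewrite lerDl mulr_ge0 // subr_ge0.
apply: lt_le_trans zy _; rewrite -lerBlDl -subr_ge0.
have -> : v * (y - x) - (y - x) = (1 - v) * (x - y) by ring.
by rewrite mulr_ge0 ?subr_ge0 // ltW.
Qed.

Lemma convex_lt (z x y v : R) : x < z -> y < z -> 0 <= v <= 1 -> x + v * (y - x) < z.
Proof.
move=> xz yz v01; rewrite -ltrN2.
have -> : - (x + v * (y - x)) = - x + v * (- y - - x) by ring.
by apply: convex_gt; rewrite ?ltrN2.
Qed.

Lemma continuous01_bounded (g : R -> C) : continuous01 g ->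
  exists B : R, forall t, 0 <= t <= 1 -> modulus (g t) <= B.
Proof.
move=> cg.
pose Q x y := exists B : R, forall t, x <= t -> t <= y -> modulus (g t) <= B.
suff [B HB] : Q 0 1 by exists B => t /andP[]; exact: HB.
apply: (@interval_gluing R 0 1 Q ler01) => [x y z _ _ _ _ [B HB] [B' HB']|t t0 t1].
  exists (Num.max B B') => t xt tz; rewrite le_max.
  by have [ty|ty] := leP t y; [rewrite HB|rewrite HB' ?orbT // ltW].
have t01 : 0 <= t <= 1 by rewrite t0.
have [d d0 Hd] := cg t t01 1 ltr01.
exists d => // x y x0 xt ty y1 tx yt; exists (modulus (g t) + 1) => s xs sy.
have := Hd s; have -> : 0 <= s <= 1 by apply/andP; split; lra.
have -> : `|s - t| < d by rewrite ltr_norml; apply/andP; split; lra.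
move=> /(_ isT isT) H; have := modulusD (g s - g t) (g t); rewrite subrK; lra.
Qed.

Variables (Om : set C) (S : sheets Om).
Hypothesis Om0 : Om 0.
Variables (n : nat) (out : C -> sheet_state S -> 'M[C]_n) (size_le : sheet_state S -> R -> Prop).

Hypothesis step_chart : forall e : R, 0 < e -> exists2 h : R, 0 < h &
  forall c, away Om e c -> forall st s, size_le st s -> exists i, sheet_val (s := S) i c = st /\
    forall w, modulus (w - c) < h -> sheet_dom i w /\ size_le (sheet_val i w) (2 * s).
Hypothesis out_bound : forall e : R, 0 < e -> exists2 B : R, 0 <= B &
  forall c, away Om e c -> forall st s, size_le st s -> mnorm (out c st) <= B * s.
Hypothesis chart_size : forall i x, sheet_dom (s := S) i x -> ~ Om x -> exists2 s, 0 <= s & size_le (sheet_val i x) s.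

(** A path cut into N pieces of length less than h multiplies the size of the
    state by at most 2^N: a discrete form of Gronwall's inequality. *)
Lemma lift_steps (e h : R) (g : R -> C) L (N : nat) s :
  (forall c, away Om e c -> forall st s, size_le st s -> exists i, sheet_val (s := S) i c = st /\
    forall w, modulus (w - c) < h -> sheet_dom i w /\ size_le (sheet_val i w) (2 * s)) ->
  (0 < N)%N -> path_lift (S := S) g 0 1 L -> (forall t, 0 <= t <= 1 -> away Om e (g t)) ->
  (forall t t', 0 <= t -> t <= t' -> t' <= 1 -> t' - t <= N%:R^-1 -> modulus (g t' - g t) < h) ->
  size_le (L 0) s -> size_le (L 1) (2 ^+ N * s).
Proof.
move=> Hstep N0 Lg ag gh L0.
have NR0 : 0 < N%:R :> R by rewrite ltr0n.
suff H k : (k <= N)%N -> size_le (L (k%:R / N%:R)) (2 ^+ k * s).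
  by have := H N (leqnn N); rewrite divff // lt0r_neq0.
elim: k => [_|k IH kN]; first by rewrite mul0r expr0 mul1r.
set t := k%:R / N%:R in IH *; set t' := k.+1%:R / N%:R.
have t0 : 0 <= t by rewrite divr_ge0 // ltW.
have tt : t' - t = N%:R^-1 by rewrite /t' /t -mulrBl -natr1 addrAC subrr add0r mul1r.
have t'1 : t' <= 1 by rewrite /t' ler_pdivrMr // mul1r ler_nat.
have Ni0 : 0 <= N%:R^-1 :> R by rewrite invr_ge0 ltW.
have tt' : t <= t' by lra.
have t1 : t <= 1 by lra.
have t01 : 0 <= t <= 1 by rewrite t0.
have [i [it Hi]] := Hstep _ (ag t t01) _ _ (IH (ltnW kN)).
have di u : t <= u -> u <= t' -> modulus (g u - g t) < h.
  by move=> tu ut'; apply: gh => //; lra.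
have Lt' : L t' = sheet_val i (g t').
  apply: (@lift_uniq _ _ S g t t' L (fun u => sheet_val i (g u)) tt' (lift_sub t0 t'1 Lg)).
    by apply: lift_chart => u tu ut'; exact: (Hi _ (di u tu ut')).1.
  by rewrite it.
rewrite Lt' exprS -mulrA; exact: (Hi _ (di t' tt' (lexx t'))).2.
Qed.

(** Far away only the sector matters, as the disc and the tube are bounded. The
    path from the base point of the sector to a point at radius r has length
    O(r) and keeps its distance to [Om]. *)
Lemma continuation_growth i j (nu : R) Delta : 0 < nu ->
  sectorial_region Om nu Delta -> exp_growth Om Delta (continuation (S := S) out i j).
Proof.
move=> nu0 [D [[rho0 delta0 r00] [_ _ par1 p1] _ [d nud Hd] [sub DE]]].
set c := sr_vertex D in p1; set r1 := sr_r1 D in p1 par1; set th1 := sr_theta1 D in p1 par1.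
pose p := sr_path D.
pose gs := concat (segment 0 (p 0)) p.
pose path u := concat gs (sector_path D u).
have d0 : 0 < d by exact: lt_trans nud.
have aw z : plane_sector D z -> away Om d z by move=> zD w; apply: Hd; right.
have adm u : sector_params D u -> admissible Om (path u).
  move=> uD; have : surface Om (hclass Om (path u)).
    by apply: sub; rewrite DE; right; exists u.
  move=> [g ag gE]; apply: (@homotopic_admissible _ _ _ g).
  have : hclass Om g g by exact: homotopic_refl.
  by rewrite gE.
have gs1 : gs 1 = p 1.
  rewrite /gs concat_right ?segment_point ?point_on1 //; last by rewrite invf_le1 ?ler1n.
  by congr p; lra.
have sp0 u : sector_path D u 0 = p 1.
  by rewrite /sector_path !mul0r !addr0 -/r1 -/th1 /p p1.
have gh u : gs 1 = sector_path D u 0 by rewrite sp0.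
pose u1 := (r1, th1).
(* the tube and the disc are bounded *)
have cG := admissible_cont (adm u1 par1).
have [B0 HB0] := continuous01_bounded cG.
have pB t : 0 <= t <= 1 -> modulus (p t) <= B0.
  move=> /andP[t0 t1].
  have -> : p t = path u1 (2^-1 * (2^-1 * t + 2^-1)).
    rewrite /path concat_left; last by lra.
    rewrite mulrA divff // mul1r /gs concat_right ?segment_point ?point_on1 //; last by lra.
    by congr p; lra.
  by apply: HB0; apply/andP; split; lra.
pose M := Num.max (sr_rho D) (sr_delta D + B0).
have [L1 LL1 L10] := admissible_lift S Om0 (adm u1 par1).
have Lgs1 := lift_concat_left LL1.
have p1O : ~ Om (p 1).
  apply: (away_notin d0); apply: aw; exists u1 => //.
have [s0 s0_ge0 Hs0] : exists2 s, 0 <= s & size_le (L1 2^-1) s.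
  have [k [e e0 Hk]] := Lgs1 1 ler01 (lexx 1).
  have [dk] : sheet_dom k (gs 1) /\ L1 (2^-1 * 1 + 0) = sheet_val k (gs 1).
    by apply: Hk; rewrite ?ler01 ?lexx ?subrr ?normr0.
  rewrite mulr1 addr0 => ->; apply: chart_size => //.
  by rewrite gs1.
have [h h0 Hh] := step_chart d0.
have [B B_ge0 HB] := out_bound d0.
(* the path in the sector has length at most (r1 + r) q *)
pose q := 2 + 2 * (sr_beta D - sr_alpha D).
have [r10 /andP[a1 b1]] := par1.
have q0 : 0 <= q by rewrite /q; move: a1 b1 => /=; lra.
exists (B * s0 * expR (1 + (r1 + modulus c) * q / h)), (q / h), M.
move=> g ag Dg Mg.
have endpt P : hclass Om g = hclass Om P -> g 1 = P 1.
  move=> gP; apply: (@homotopic_end _ Om).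
  by have : hclass Om g g by [exact: homotopic_refl]; rewrite gP.
move: Dg; rewrite DE => -[[[w wD wE]|[t [w [t01 wt wE]]]]|[u uD uE]].
- have := endpt _ (esym wE); rewrite segment_point point_on1 => gw.
  move: Mg; rewrite gw /M ge_max => /andP[Mw _].
  by move: wD; rewrite /plane_disc /= ltNge Mw.
- have := endpt _ wE.
  rewrite concat_right ?segment_point ?point_on0; last 2 first.
  + rewrite concat_right ?segment_point ?point_on1 ?mulr0 ?invf_le1 ?ler1n //.
    by congr (sr_path D _); lra.
  + by rewrite invf_le1 ?ler1n.
  have -> : 2 * 1 - 1 = 1 :> R by ring.
  rewrite point_on1 => gw.
  move: Mg; rewrite gw /M ge_max => /andP[_ Mw].
  have := modulusD (w - p t) (p t); rewrite subrK; have := pB t t01; move: wt; rewrite -/p; lra.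
have gE := endpt _ (esym uE).
rewrite -uE.
have [L Lu Lu0] := admissible_lift S Om0 (adm u uD).
rewrite (continuation_lift Om0 out i j (adm u uD) Lu Lu0).
have path1 : path u 1 = polar c u.1 u.2.
  rewrite /path concat_right //; last by rewrite invf_le1 ?ler1n.
  have -> : 2 * 1 - 1 = 1 :> R by ring.
  by rewrite /sector_path !mul1r ![_ + (_ - _)]addrC !subrK.
have [u10 /andP[a2 b2]] := uD.
have r1_gt0 : 0 < r1 := le_lt_trans r00 r10.
have u1_gt0 : 0 < u.1 := le_lt_trans r00 u10.
have inside (v : R) : 0 <= v <= 1 ->
    sector_params D (r1 + v * (u.1 - r1), th1 + v * (u.2 - th1)).
  move=> v01; split; first exact: convex_gt.
  by apply/andP; split; [exact: convex_gt|exact: convex_lt].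
have Lr := lift_concat_right (gh u) Lu.
have start : L (2^-1 * 0 + 2^-1) = L1 2^-1.
  have := lift_uniq ler01 (lift_concat_left Lu) Lgs1.
  by rewrite !mulr0 !mulr1 !addr0 add0r Lu0 L10; exact.
pose x := (r1 + u.1) * q / h.
have x0 : 0 <= x by rewrite divr_ge0 ?(ltW h0) // mulr_ge0 // addr_ge0 ?ltW.
pose N := (Num.trunc x).+1.
have xN : x < N%:R by exact: Num.Theory.truncnS_gt.
have Nx : N%:R <= x + 1.
  by rewrite /N -natr1 lerD2r; have /andP[] := Num.Theory.truncn_itv x0.
have NR0 : 0 < N%:R :> R by rewrite ltr0n.
have awp v : 0 <= v <= 1 -> away Om d (sector_path D u v).
  by move=> v01; apply: aw; exists (r1 + v * (u.1 - r1), th1 + v * (u.2 - th1)) => //; exact: inside.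
have sz : size_le (L (2^-1 * 1 + 2^-1)) (2 ^+ N * s0).
  apply: (@lift_steps d h (sector_path D u) (fun t => L (2^-1 * t + 2^-1)) N s0 Hh) => //.
    move=> t t' t0 tt' t'1 dt.
    have t01 : 0 <= t <= 1 by rewrite t0 (le_trans tt').
    have rt0 : 0 <= r1 + t * (u.1 - r1).
      by apply: ltW; apply: le_lt_trans r00 _; have [] := inside t t01.
    have rt1 : r1 + t * (u.1 - r1) <= r1 + u.1.
      rewrite lerD2l; apply: (@le_trans _ _ (t * u.1)).
        by rewrite ler_wpM2l // gerBl ltW.
      by rewrite ler_piMl ?(ltW u1_gt0) //; case/andP: t01.
    rewrite /sector_path -/c -/r1 -/th1; apply: le_lt_trans (polar_dist _ _ _ _ rt0) _.
    have e1 : r1 + t' * (u.1 - r1) - (r1 + t * (u.1 - r1)) = (t' - t) * (u.1 - r1) by ring.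
    have e2 : th1 + t' * (u.2 - th1) - (th1 + t * (u.2 - th1)) = (t' - t) * (u.2 - th1) by ring.
    rewrite e1 e2 !normrM ger0_norm ?subr_ge0 //.
    have d1 : `|u.1 - r1| <= r1 + u.1 by rewrite ler_norml; apply/andP; split; lra.
    have d2 : `|u.2 - th1| <= sr_beta D - sr_alpha D.
      by rewrite ler_norml; apply/andP; split; move: a1 b1 a2 b2 => /=; lra.
    have tt0 : 0 <= t' - t by rewrite subr_ge0.
    apply: (@le_lt_trans _ _ ((t' - t) * ((r1 + u.1) * q))).
      have -> : (t' - t) * ((r1 + u.1) * q) = 2 * ((t' - t) * (r1 + u.1)) +
         2 * (r1 + u.1) * ((t' - t) * (sr_beta D - sr_alpha D)) by rewrite /q; ring.
      apply: lerD; first by rewrite ler_wpM2l // ler_wpM2l.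
      apply: ler_pM; rewrite ?mulr_ge0 //; first by rewrite ler_wpM2l.
      by rewrite ler_wpM2l.
    apply: (@le_lt_trans _ _ (N%:R^-1 * ((r1 + u.1) * q))).
      by rewrite ler_wpM2r // mulr_ge0 // addr_ge0 ?ltW.
    by rewrite ltr_pdivrMl // -ltr_pdivrMr.
  by rewrite start.
have half1 : 2^-1 * 1 + 2^-1 = 1 :> R by field.
rewrite half1 in sz.
have aw1 : away Om d (path u 1).
  by rewrite path1; apply: aw; exists u.
apply: le_trans (mnorm_entry _ _ _) _; apply: le_trans (HB _ aw1 _ _ sz) _.
have pow : 2 ^+ N <= expR (x + 1).
  apply: (@le_trans _ _ (expR 1 ^+ N)).
    rewrite lerXn2r ?nnegrE ?expR_ge0 //.
    by have := expR_ge1Dx (1 : R); rewrite -mulr2n.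
  by rewrite -expRM_natl mulr1 ler_expR.
have -> : B * s0 * expR (1 + (r1 + modulus c) * q / h) * expR (q / h * modulus (g 1)) =
   B * (expR (1 + (r1 + modulus c) * q / h + q / h * modulus (g 1)) * s0).
  by rewrite (expRD (1 + (r1 + modulus c) * q / h)); ring.
rewrite ler_wpM2l // ler_wpM2r //; apply: le_trans pow _; rewrite ler_expR.
have rg : u.1 <= modulus (g 1) + modulus c.
  rewrite (gE : g 1 = path u 1) path1.
  have u1E : u.1 = modulus (polar c u.1 u.2 - c).
    rewrite /polar addrAC subrr add0r modulusM modulus_real gtr0_norm //.
    by rewrite /modulus /= cos2Dsin2 sqrtr1 mulr1.
  by rewrite [leLHS]u1E -(modulusN c); exact: modulusD.
have hq : 0 <= q / h by rewrite divr_ge0 // ltW.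
have := ler_wpM2r hq rg.
have -> : x = r1 * (q / h) + u.1 * (q / h) by rewrite /x; ring.
have -> : (r1 + modulus c) * q / h = r1 * (q / h) + modulus c * (q / h) by ring.
lra.
Qed.

End Growth.

(** * The kernel of the convolution equation *)

Section Data.
Variable R : realType.
Local Notation C := (Cplx R).

Lemma finite_lower_bound (T : finType) (P : T -> Prop) (f : T -> R) :
  (forall t, P t -> 0 < f t) -> exists2 e : R, 0 < e & forall t, P t -> e <= f t.
Proof.
move=> fP.
suff [e e0 He] : exists2 e : R, 0 < e & forall t, t \in enum T -> P t -> e <= f t.
  by exists e => // t; apply: He; rewrite mem_enum.
elim: (enum T) => [|t s [e e0 He]]; first by exists 1.
have [Pt|nPt] := pselect (P t).
  exists (Num.min e (f t)); first by rewrite lt_min e0 fP.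
  move=> u; rewrite in_cons ge_min => /orP[/eqP->|us] Pu; first by rewrite lexx orbT.
  by rewrite He.
by exists e => // u; rewrite in_cons => /orP[/eqP->|us] Pu //; exact: He.
Qed.

Lemma convergent_geometric n (A : nat -> 'M[C]_n) : convergent_powerseries A ->
  exists CA b : R, [/\ 0 <= CA, 1 <= b & forall k, mnorm (A k) <= CA * b ^+ k].
Proof.
move=> [r r0 HA].
pose z : C := (r / 2)%:C%C.
have r2 : 0 < r / 2 by rewrite divr_gt0.
have mz : modulus z = r / 2 by rewrite modulus_real gtr0_norm.
have bnd i j : exists B : R, forall k, modulus (A k i j) * (r / 2) ^+ k <= B.
  have : cvgn (cpseries (fun k => A k i j) z) by apply: HA; rewrite mz; lra.
  move=> /cvg_series_cvg_0/cvg_modulus/(_ 1 ltr01)[N0 _ H].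
  exists (1 + \sum_(k < N0) modulus (A k i j) * (r / 2) ^+ k) => k.
  have pos l : 0 <= modulus (A l i j) * (r / 2) ^+ l.
    by rewrite mulr_ge0 ?modulus_ge0 // exprn_ge0 // ltW.
  have [Nk|kN] := leqP N0 k.
    have := H k Nk; rewrite subr0 modulusM modulusX mz => /ltW /le_trans; apply.
    by rewrite lerDl sumr_ge0.
  by rewrite (bigD1 (Ordinal kN)) //= addrCA lerDl addr_ge0 // sumr_ge0.
have [B HB] : exists B : 'I_n -> 'I_n -> R, forall i j k, modulus (A k i j) * (r / 2) ^+ k <= B i j.
  have [B HB] := choice (fun ij : 'I_n * 'I_n => bnd ij.1 ij.2).
  by exists (fun i j => B (i, j)) => i j; exact: (HB (i, j)).
have B0 i j : 0 <= B i j.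
  by apply: le_trans (HB i j 0%N); rewrite expr0 mulr1 modulus_ge0.
pose b := Num.max 1 (2 / r).
have b1 : 1 <= b by rewrite le_max lexx.
exists (\sum_i \sum_j B i j), b; split=> // [|k].
  by rewrite sumr_ge0 // => i _; rewrite sumr_ge0.
rewrite /mnorm mulr_suml ler_sum // => i _; rewrite mulr_suml ler_sum // => j _.
apply: (@le_trans _ _ (B i j * (2 / r) ^+ k)).
  have -> : 2 / r = (r / 2)^-1 by rewrite invf_div.
  by rewrite exprVn ler_pdivlMr ?exprn_gt0.
have r2' : 0 <= 2 / r by rewrite divr_ge0 // ltW.
by rewrite ler_wpM2l // lerXn2r ?nnegrE ?(le_trans ler01 b1) // le_max lexx orbT.
Qed.

Section Kernel.
Variables (n : nat) (Om : set C) (A : nat -> 'M[C]_n) (a : 'I_n -> C) (L : 'M[C]_n) (cs : seq C).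
Hypothesis diff_in_Om : forall j k, Om (a j - a k).
Hypothesis annih : shifted_product (A 0%N) cs = 0.
Hypothesis csP : forall c, c \in cs -> exists j, c = a j.
Variables (CA b : R).
Hypothesis CA0 : 0 <= CA.
Hypothesis b1 : 1 <= b.
Hypothesis A_bound : forall k, mnorm (A k) <= CA * b ^+ k.

(** The derivatives at 0 of the kernel of the convolution equation. *)
Definition kernel_op (k : nat) (X : 'M[C]_n) : 'M[C]_n :=
  A k.+1 *m X - (if k is 0 then X *m L else 0).

Lemma kernel_transport_data :
  transport_data Om (leading_op (A 0%N) a) kernel_op (resolvent (A 0%N) a cs)
    b (CA * b + mnorm L).
Proof.
have b0 : 0 <= b := le_trans ler01 b1.
have notOm xi : ~ Om xi -> forall z, (exists j k, z = a j - a k) -> xi != z.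
  by move=> xO z [j [k ->]]; apply/eqP => E; apply: xO; rewrite E.
split.
- by move=> X Y; rewrite /leading_op mulmxDr mulmxDl opprD addrACA.
- by move=> c X; rewrite /leading_op -scalemxAr -scalemxAl scalerBr.
- exists (mnorm (A 0%N) + mnorm (diag_mx (\row_j a j))) => X.
  apply: le_trans (mnormB _ _) _; rewrite mulrDl lerD ?mnormM //.
  by rewrite mulrC mnormM.
- move=> [|k] X Y; rewrite /kernel_op mulmxDr ?mulmxDl ?subr0 //.
  by rewrite opprD addrACA.
- move=> [|k] c X; rewrite /kernel_op -scalemxAr ?subr0 //.
  by rewrite -scalemxAl scalerBr.
- exact: b1.
- by rewrite addr_ge0 ?mulr_ge0 ?mnorm_ge0.
- move=> k X; apply: le_trans (mnormB _ _) _; rewrite !mulrDl; apply: lerD.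
    apply: le_trans (mnormM _ _) _; rewrite ler_wpM2r ?mnorm_ge0 //.
    by apply: le_trans (A_bound _) _; rewrite exprS mulrA.
  case: k => [|k]; last by rewrite mnorm0 !mulr_ge0 ?mnorm_ge0 ?exprn_ge0.
  by rewrite expr0 mulr1 mulrC mnormM.
- by move=> xi X xO; apply: resolvent_right annih csP _ _ (notOm _ xO).
- by move=> xi X xO; apply: resolvent_left annih csP _ _ (notOm _ xO).
- move=> e e0; have [B B0 HB] := resolvent_bound (A 0%N) csP e0.
  by exists B => // xi xO; apply: HB => z [j [k ->]]; exact: xO.
Qed.

End Kernel.
End Data.

(** * Summable-resurgence of the formal solution *)

Section SourceBound.
Variables (R : realType) (n : nat).
Local Notation C := (Cplx R).
Variables (A : nat -> 'M[C]_n) (a : 'I_n -> C) (L : 'M[C]_n) (F : int -> 'M[C]_n) (v : nat).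
Local Notation Fs := (fun k : nat => F (k%:Z - v%:Z)).
Local Notation f := (fun i : nat => F i.+1).
Hypothesis eqF : forall m, convol A Fs m = Fs m *m diag_mx (\row_j a j) +
  xshift (fun k => k%:R *: Fs k + Fs k *m (L - v%:R%:M)) m.

Lemma kernel_sum m : \sum_(i < m) kernel_op A L (m.-1 - i) (f i) =
  \sum_(i < m) A i.+1 *m F (m - i)%N - (if m is 0 then 0 else F m *m L).
Proof.
rewrite (reindex_inj rev_ord_inj) /=.
transitivity (\sum_(i < m) (A i.+1 *m F (m - i)%N - (if i : nat is 0 then F (m - i)%N *m L else 0))).
  apply: eq_bigr => i _; have im := ltn_ord i.
  have -> : (m.-1 - (m - i.+1) = i)%N by lia.
  have -> : ((m - i.+1).+1 = m - i)%N by lia.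
  by rewrite /kernel_op; case: (i : nat).
rewrite sumrB; congr (_ - _); case: m => [|m]; first by rewrite big_ord0.
by rewrite big_ord_recl /= subn0 big1 ?addr0.
Qed.

(** The equation of F cancels everything but the products of coefficients of A
    with the polar part of F. *)
Lemma source_eq m : source (leading_op (A 0%N) a) (kernel_op A L) f m =
  \sum_(l < v.+1) A (l + m.+1)%N *m F (- l%:Z) - (if m is 0 then F 0 *m L else 0).
Proof.
have tail (g : nat -> 'M[C]_n) :
    \sum_(m.+1 <= i < (m.+1 + v).+1) g i = \sum_(l < v.+1) g (l + m.+1)%N.
  rewrite -{1}(add0n m.+1) big_addn (_ : ((m.+1 + v).+1 - m.+1 = v.+1)%N) ?big_mkord //.
  by lia.
have := eqF (m.+1 + v)%N.
rewrite {1}/convol -(big_mkord xpredT (fun i => A i *m F ((m.+1 + v - i)%N%:Z - v%:Z))).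
rewrite (@big_cat_nat _ _ _ m.+1) //=; last exact: (leq_trans (leq_addr v m.+1) (leqnSn _)).
rewrite big_mkord big_ord_recl subn0 tail.
have F1 : F ((m.+1 + v)%N%:Z - v%:Z) = F m.+1 by congr F; lia.
rewrite F1.
have -> : \sum_(i < m) A (lift ord0 i) *m F ((m.+1 + v - lift ord0 i)%N%:Z - v%:Z) =
   \sum_(i < m) A i.+1 *m F (m - i)%N.
  apply: eq_bigr => i _; rewrite lift0; congr (_ *m F _).
  by have := ltn_ord i; lia.
have -> : \sum_(i < v.+1) A (i + m.+1)%N *m F ((m.+1 + v - (i + m.+1))%N%:Z - v%:Z) =
   \sum_(l < v.+1) A (l + m.+1)%N *m F (- l%:Z).
  apply: eq_bigr => i _; congr (_ *m F _).
  by have := ltn_ord i; lia.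
have F2 : F ((m + v)%N%:Z - v%:Z) = F m by congr F; lia.
rewrite F2 => E.
rewrite /source kernel_sum /leading_op.
set T := \sum_(l < v.+1) _ in E *; set K := \sum_(i < m) _ in E *.
have {}E : A 0%N *m F m.+1 = F m.+1 *m diag_mx (\row_j a j) +
   (m%:R *: F m + F m *m L) - K - T.
  have -> : m%:R *: F m + F m *m L = (m + v)%:R *: F m + F m *m (L - v%:R%:M).
    rewrite mulmxBr mul_mx_scalar natrD scalerDl.
    by rewrite [RHS]addrACA subrr addr0.
  by rewrite -E addrAC !addrK.
rewrite E; case: m @K T {E F1 F2 tail} => [|m] K T.
  by rewrite scale0r !add0r opprB !opprD; apply/matrixP => i j; rewrite !mxE; ring.
by apply/matrixP => i j; rewrite !mxE; ring.
Qed.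

Lemma source_bound (CA b : R) : 0 <= CA -> 1 <= b ->
  (forall k, mnorm (A k) <= CA * b ^+ k) ->
  exists2 S : R, 0 <= S & forall m,
    mnorm (source (leading_op (A 0%N) a) (kernel_op A L) f m) <= S * b ^+ m.
Proof.
move=> CA0 b1 AB; have b0 : 0 <= b := le_trans ler01 b1.
pose T := \sum_(l < v.+1) CA * b ^+ l.+1 * mnorm (F (- l%:Z)).
have T0 : 0 <= T.
  by apply: sumr_ge0 => l _; rewrite !mulr_ge0 ?exprn_ge0 ?mnorm_ge0.
exists (T + mnorm (F 0 *m L)) => [|m]; first by rewrite addr_ge0 ?mnorm_ge0.
rewrite source_eq; apply: le_trans (mnormB _ _) _; rewrite mulrDl; apply: lerD.
  apply: le_trans (mnorm_sum _ _ _) _; rewrite /T mulr_suml; apply: ler_sum => l _.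
  apply: le_trans (mnormM _ _) _; rewrite mulrAC ler_wpM2r ?mnorm_ge0 //.
  by apply: le_trans (AB _) _; rewrite -addSnnS exprD mulrA.
case: m => [|m]; first by rewrite expr0 mulr1.
by rewrite mnorm0 mulr_ge0 ?exprn_ge0 ?mnorm_ge0.
Qed.

End SourceBound.

Theorem corollary2p8 (R : realType) (J : nat) (p : 'I_J -> nat)
    (lam a : 'I_J -> Cplx R)
    (A : nat -> 'M[Cplx R]_(\sum_j p j))
    (F : int -> 'M[Cplx R]_(\sum_j p j))
    (p_gt0 : forall j, (0 < p j)%N)
    (A_cvg : convergent_powerseries A)
    (A0_neq0 : A 0%N != 0)
    (F_laurent : laurent_series F)
    (F_inv : laurent_invertible F)
    (a_level_one : exists j k, a j != a k)
    (F_solution :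
      let Y := lemul (lemul (of_laurent F) (xpow_jordan p lam))
                     (exp_level_one p a) in
      lemul (xpow _ 2) (lederiv Y) = lemul (of_powerseries A) Y) :
  let Om : set (Cplx R) := [set z | exists j k, z = a j - a k] in
  forall i j, summable_resurgent_series Om (fun m => F m i j).
Proof.
move=> Om i j.
pose aB y := a (block (p := p) y).
have [CA [b [CA0 b1 AB]]] := convergent_geometric A_cvg.
have [v F0] : exists v : nat, forall k : int, k < - v%:Z -> F k = 0.
  by have [N HN] := F_laurent; exists (absz N) => k kN; apply: HN; lia.
have [G [[NG HG] FG GF]] := F_inv.
have [w G0] : exists w : nat, forall k : int, k < - w%:Z -> G k = 0.
  by exists (absz NG) => k kN; apply: HG; lia.
(* the power series x^v F and x^w G *)
pose Fs k := F (k%:Z - v%:Z); pose Gs k := G (k%:Z - w%:Z).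
pose Lv := monodromy_exponent p lam v; pose L := monodromy_exponent p lam 0.
have gau : formal_gauge A Fs Gs aB Lv (v + w).
  split=> m; first exact: laurent_solution.
    exact: laurent_product.
  by rewrite addnC; exact: laurent_product.
have [B [K [B0 K1 FB]]] := formal_solution_gevrey gau CA0 b1 AB
  (fun x y h => congr1 a (monodromy_exponent_block h)).
have {B K B0 K1 FB} [B [K [B0 K1 FB]]] := gevrey_shift v.+1 B0 K1 FB.
have fB k : mnorm (F k.+1) <= B * K ^+ k * (k`!)%:R.
  by have := FB k; rewrite /Fs (_ : (k + v.+1)%N%:Z - v%:Z = k.+1%:Z) //; lia.
have annih := leading_annihilated gau.
have csP := @exponents_repeatedP _ _ aB (v + w).
have diffO y z : Om (aB y - aB z) by exists (block y), (block z).
have td := kernel_transport_data L diffO annih csP CA0 b1 AB.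
have LvL : Lv = L - v%:R%:M.
  apply/matrixP => x y; rewrite /Lv /L /monodromy_exponent !mxE subr0.
  by case: (x == y); rewrite ?mulr1n ?mulr0n ?subr0 // addrAC.
have [S S_ge0 sB] : exists2 S : R, 0 <= S & forall m,
    mnorm (source (leading_op (A 0%N) aB) (kernel_op A L) (fun i => F i.+1) m) <= S * b ^+ m.
  apply: (source_bound (v := v) _ CA0 b1 AB) => m; rewrite -LvL.
  exact: (gauge_eq gau).
have Om0 : Om 0 by have [j0 [k0 _]] := a_level_one; exists j0, j0; rewrite subrr.
have Om_closed xi : ~ Om xi -> exists2 e : R, 0 < e & away Om e xi.
  move=> xO; have [|e e0 He] := @finite_lower_bound R ('I_J * 'I_J)%type (fun=> True)
    (fun jk => modulus (xi - (a jk.1 - a jk.2))).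
    move=> [j0 k0] _; rewrite modulus_gt0 subr_eq0; apply/eqP => E.
    by apply: xO; exists j0, k0.
  by exists e => // z [j0 [k0 ->]]; exact: (He (j0, k0)).
have [e e0 He] := @finite_lower_bound R ('I_J * 'I_J)%type (fun jk => a jk.1 - a jk.2 != 0)
    (fun jk => modulus (a jk.1 - a jk.2)) (fun t nz => etrans (modulus_gt0 _) nz).
have Om_sep z : Om z -> z != 0 -> e <= modulus z.
  by move=> [j0 [k0 ->]]; exact: (He (j0, k0)).
have [r0 [S0 [sg0 [ph0 [r0_gt0 H]]]]] := initial_solution td B0 K1 S_ge0 fB sB e0 Om_sep.
have init xi (xr : modulus xi < r0) := (H xi xr).1.
pose sh := volterra_sheets td Om_closed Om0 r0_gt0 init.
pose out := outcome (resolvent (A 0%N) aB (exponents_repeated aB (v + w))) ph0.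
exists (continuation (S := sh) out i j).
  exists r0 => // xi xr.
  have -> : continuation (S := sh) out i j (hclass Om (segment 0 xi)) = ph0 xi i j.
    rewrite (@continuation_segment R Om sh Om0 _ out i j None xi r0 erefl _ xr).
      by rewrite /out (outcome_chart0 _ init xr).
    by move=> w' wr; split=> //; have [] := init _ wr.
  apply/cvg_modulus => e' e'0; have [N0 HN] := (H xi xr).2 _ e'0.
  exists N0 => // N NN; have := HN N NN; apply: le_lt_trans.
  rewrite modulusB; apply: le_trans (mnorm_entry _ i j); rewrite !mxE summxE.
  rewrite /cpseries /series /= big_mkord.
  rewrite le_eqVlt; apply/orP; left; apply/eqP; congr (modulus (_ - _)).
  by apply: eq_bigr => k _; rewrite !mxE /borel; ring.
split.
  apply: (@continuation_resurgent R Om sh Om0 _ out) => k xi.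
    exact (outcome_hasder init (i := k) (xi := xi)).
  exact (chart_near init (i := k) (xi := xi)).
move=> nu nu0 _ Delta Dreg.
apply: (@continuation_growth R Om sh Om0 _ out (@state_size _ _ b) _ _ _ i j nu Delta nu0 Dreg).
- exact (chart_step td r0 sg0).
- exact (outcome_bound td ph0).
- exact (chart_size Om0 init).
Qed.
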